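(* Suppose that the coefficients $A_0,\ldots,A_{n-1}$ in the equation $$f^{(n)}+A_{n-1}(z)f^{(n-1)}+\cdots+A_1(z)f'+A_0(z)f=0$$ are entire, and that $T(r)$ is a characteristic function of this equation. If $f$ is a solution of the equation for which $$\log T(r)\cdot\log^m\big(\log T(r)\big)=o(T(r,f)),\qquad r\to\infty,\ r\notin E,$$ is valid for some $m>1$, where $E\subset[0,\infty)$ satisfies $\overline{\operatorname{dens}}(E)<1$, then $f$ is a P-standard solution of the equation.
   Context: $T(r,f)$ is the Nevanlinna characteristic of $f$, and $\log^m x=(\log x)^m$. A characteristic function of the equation is $$T(r)=\frac1{2\pi}\int_0^{2\pi}\log\sqrt{1+\sum_{k=1}^n|f_k(re^{i\theta})|^2}\,d\theta ,$$ where $\{f_1,\ldots,f_n\}$ is a solution base (a set of $n$ linearly independent, necessarily entire, solutions) of the equation. The upper linear density of $E\subset[0,\infty)$ is $\overline{\operatorname{dens}}(E)=\limsup_{r\to\infty}\frac1r\int_{E\cap[0,r]}dt$. For a meromorphic function $f$ in $\mathbb{C}$ and $a\in\mathbb{C}$, put $\mathscr{L}(r,a,f)=\max_{|z|=r}\log^+\frac{1}{|f(z)-a|}$, where $\log^+x=\max\{\log x,0\}$, and $$\delta_P(a,f)=\liminf_{r\to\infty}\frac{\mathscr{L}(r,a,f)}{T(r,f)} .$$ A solution $f$ is called P-standard if $\delta_P(a,f)=0$ for every $a\in\mathbb{C}\setminus\{0\}$.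
   Formalization: The coefficient A_0 is additionally assumed not identically zero; without this the claim fails, e.g. for f''-f'=0 with f=1+e^z, where δ_P(1,f)=π. *)

(* Defs.v *)
From HB Require Import structures.
From mathcomp Require Import all_boot all_order all_algebra.
From mathcomp Require Import all_classical all_reals all_analysis.
From mathcomp Require Import measurable_realfun.
From mathcomp Require Import complex.
Set Implicit Arguments.
Unset Strict Implicit.
Unset Printing Implicit Defensive.
Import Order.TTheory GRing.Theory Num.Theory.
Import numFieldNormedType.Exports.
Local Open Scope classical_set_scope.
Local Open Scope ring_scope.

Section Defs.
Variable R : realType.

(* The regular algebra of R[i] carries the normed topology of R[i] as a
   module over itself, so derivability below is complex differentiability. *)
Notation C := (R[i]^o).

Implicit Types (f : C -> C) (r t : R) (a z w : C).

(* The norm of R[i] is valued in R[i]; this is the same modulus, in R. *)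
Definition cabs z : R := complex.Re `|z|.

Definition circle_point r t : C := Complex (r * cos t) (r * sin t).

Definition entire f : Prop := forall z, derivable f z 1.

Definition circle_mean (u : C -> R) r : R :=
  (2 * pi)^-1 *
  \int[@lebesgue_measure R]_(t in `[0, 2 * pi]) u (circle_point r t).

(* log^+ x is taken to be 0 at x = 0; here ln 0 = 0. *)
Definition logp (x : R) : R := Num.max (ln x) 0.

(* A meromorphic function is given by a total function into the complex
   numbers, whose value at a pole is arbitrary. The order of the pole at z is
   the least k such that (w - z)^k f(w) has a finite limit as w -> z; it is 0
   when z is not a pole. *)
Definition pole_order f z : nat :=
  let P k := cvg ((fun w : C => (w - z) ^+ k * f w : C) @ z^') in
  xget 0%N [set k : nat | P k /\ forall j : nat, P j -> (k <= j)%N].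

Definition pole_count f t : R :=
  \sum_(z \in [set z | cabs z <= t]) ((pole_order f z)%:R : R).

Definition nevanlinna_m f r : R := circle_mean (fun z => logp (cabs (f z))) r.

Definition nevanlinna_N f r : R :=
  \int[@lebesgue_measure R]_(t in `]0, r])
    ((pole_count f t - pole_count f 0) / t)
  + pole_count f 0 * ln r.

Definition nevanlinna_T f r : R := nevanlinna_m f r + nevanlinna_N f r.

(* On extended reals 0^-1 = +oo and lne +oo = +oo, so this is +oo as soon as f
   takes the value a on the circle |z| = r. For f continuous and r >= 0 the
   supremum is a maximum. *)
Definition prox_max r a f : \bar R :=
  ereal_sup [set maxe (lne ((cabs (f z - a))%:E^-1)%E) 0%E
            | z in [set z | cabs z = r]].

Definition deltaP a f : \bar R :=
  limf_einf (fun r => (prox_max r a f / (nevanlinna_T f r)%:E)%E)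
    (pinfty_nbhs R).

(* E is Lebesgue measurable, i.e. a Borel set up to a negligible set. *)
Definition lebesgue_measurable (E : set R) : Prop :=
  completed_algebra_gen (@lebesgue_measure R) E.

Definition upper_density (E : set R) : \bar R :=
  limf_esup (fun r : R => ((r^-1)%:E *
      \int[@completed_lebesgue_measure R]_(t in E `&` `[0%R, r]%classic) 1)%E)
    (pinfty_nbhs R).

(* The filter of "r tends to +oo outside E". *)
Definition pinfty_off (E : set R) : filter_on R :=
  FilterType (within (~` E) (pinfty_nbhs R)) (within_filter _ _).

Section Equation.
Variables (n : nat) (A : 'I_n -> C -> C).

Definition is_solution f : Prop :=
  entire f /\
  forall z, derive1n n f z + \sum_(k < n) A k z * derive1n k f z = 0.

Definition lin_indep (F : 'I_n -> C -> C) : Prop :=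
  forall c : 'I_n -> C,
    (forall z, \sum_(k < n) c k * F k z = 0) -> forall k, c k = 0.

Definition solution_base (F : 'I_n -> C -> C) : Prop :=
  (forall k, is_solution (F k)) /\ lin_indep F.

Definition is_characteristic (T : R -> R) : Prop :=
  exists2 F : 'I_n -> C -> C, solution_base F &
    forall r, 0 <= r ->
      T r = circle_mean
        (fun z => ln (Num.sqrt (1 + \sum_(k < n) cabs (F k z) ^+ 2))) r.

Definition P_standard f : Prop :=
  is_solution f /\ forall a, a != 0 -> deltaP a f = 0%E.

End Equation.
End Defs.

(* Main.v *)
Require Import Defs.
From HB Require Import structures.
From mathcomp Require Import all_boot all_order all_algebra.
From mathcomp Require Import all_classical all_reals all_analysis.
From mathcomp Require Import measurable_realfun.
From mathcomp Require Import complex.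
From mathcomp Require Import ring lra zify.
Set Implicit Arguments.
Unset Strict Implicit.
Unset Printing Implicit Defensive.
Import Order.TTheory GRing.Theory Num.Theory.
Import numFieldNormedType.Exports.
Local Open Scope classical_set_scope.
Local Open Scope ring_scope.
Local Notation Re := (@complex.Re _).
Local Notation Im := (@complex.Im _).

(** Let [M(s)] be the maximum on [|z| <= s] of the sum of the moduli of the base
    solutions, [phi = ln ln M], and let [a = ln phi]. The theorem follows from a
    bound [ln (1 / |f - a0|) <= C phi (ln phi)^m] on circles [|z| = r] with [r]
    arbitrarily large and outside [E], together with [phi <= 2 ln T(r)] there:
    the hypothesis says that [ln T(r) (ln ln T(r))^m] is [o(T(r, f))], so that
    the proximity to [a0] is [o(T(r, f))] along these radii.

    The bound comes from the equation itself. Applied to [g = f - a0] the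
    differential operator gives [- a0 A_0], so
    [|a0 A_0(z)| <= |g(z)| (sum of |A_k(z)| |g^(k)(z) / g(z)|)],
    and one needs upper bounds for the [|A_k|] and the logarithmic derivatives of
    [g], and a lower bound for [|A_0|]. Work in a window of width [L] near the
    radius [rho], with [rho / L] of the order of [(ln phi)^m].

    - For an entire function bounded by [exp N] on [|z| <= rho], the theorem
      [entire_radial_estimates] holds on all circles of the window off a set of
      radii of measure [eta L]: the modulus is at least
      [exp (- K (rho / L) N)], and the logarithmic derivatives are at most a
      power of [(rho / L) N]. It is proved for polynomials: the zeros are reflected
      in a circle, Harnack's inequality is applied to the zero-free polynomial so
      obtained, and the Blaschke factors are estimated on average over the
      radii. Polynomial approximation with zeros split off at the origin avoids
      any discussion of zeros of entire functions.

    - The coefficients are recovered from the solutions by successive reduction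
      of order, dividing the operator by the Wronskian with one solution at a
      time. Where all the functions that occur have logarithmic derivatives at
      most [B], [annihilator_bound] gives [|A_k| <= (4 B)^(n^2)]. With [B] a power of
      [(rho / L) ln M] and Cauchy's formula, [ln |A_k|] is at most a multiple
      of [phi] (lemma [coef_growth]). The same reduction shows that any solution
      lies in the span of the base ([solution_in_span]), so that [f] does not grow
      faster than [M].

    - Hence the lower bound for [|A_0|] costs [K (rho / L) phi], of the order
      [phi (ln phi)^m], and the logarithmic derivatives of [g] cost only a
      multiple of [phi] (lemma [local_estimate]).

    All this requires [phi] to be essentially constant over a bounded number of
    windows. The half-line is tiled by intervals of length [s / (ln phi)^m]; the
    tiles near which [a = ln phi] grows by one have small total length, because each
    of them is paid for by a drop of the potential [a^(1 - m)], and [m > 1]. Since [E]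
    has upper density below one, some far tile is not of this kind and is not
    nearly filled by [E] ([good_tile]), which leaves room for the exceptional
    radii of the estimates above. Finally [ln M(s)] is at most
    [(r + s) / (r - s)] times [T(r)] up to constants, by Poisson's formula
    ([log_max_bound]), and this compares [phi] with [ln T(r)]. *)

(** * The modulus and complex differentiation *)

Section Modulus.
Variable R : realType.
Notation C := (R[i]^o).
Implicit Types (z w : C) (x y r t : R).

Lemma cabsE z : cabs z = Num.sqrt (Re z ^+ 2 + Im z ^+ 2).
Proof. by rewrite /cabs normc_def. Qed.

Lemma normrE z : `|z| = (cabs z)%:C%C.
Proof. by rewrite /cabs normc_def. Qed.

Lemma cabs_ge0 z : 0 <= cabs z.
Proof. by rewrite cabsE sqrtr_ge0. Qed.

Lemma sqr_cabs z : cabs z ^+ 2 = Re z ^+ 2 + Im z ^+ 2.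
Proof. by rewrite cabsE sqr_sqrtr // addr_ge0 // sqr_ge0. Qed.

Lemma cabsM z w : cabs (z * w) = cabs z * cabs w.
Proof. by apply: complexI; rewrite rmorphM /= -!normrE normrM. Qed.

Lemma cabsN z : cabs (- z) = cabs z.
Proof. by apply: complexI; rewrite -!normrE normrN. Qed.

Lemma cabsB z w : cabs (z - w) = cabs (w - z).
Proof. by rewrite -cabsN opprB. Qed.

Lemma cabsD z w : cabs (z + w) <= cabs z + cabs w.
Proof. by rewrite -lecR rmorphD /= -!normrE ler_normD. Qed.

Lemma cabsBl z w : cabs z - cabs w <= cabs (z - w).
Proof. by rewrite lerBlDr -{1}(subrK w z) cabsD. Qed.

Lemma cabs0 : cabs (0 : C) = 0.
Proof. by apply: complexI; rewrite -normrE normr0. Qed.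

Lemma cabs1 : cabs (1 : C) = 1.
Proof. by apply: complexI; rewrite -normrE normr1. Qed.

Lemma cabs_eq0 z : (cabs z == 0) = (z == 0).
Proof. by rewrite -(inj_eq (@complexI R)) -normrE normr_eq0. Qed.

Lemma cabs_gt0 z : (0 < cabs z) = (z != 0).
Proof. by rewrite lt_neqAle cabs_ge0 andbT eq_sym cabs_eq0. Qed.

Lemma cabsV z : cabs z^-1 = (cabs z)^-1.
Proof.
apply: complexI; rewrite -normrE normfV normrE.
have [->|z0] := eqVneq (cabs z) 0; first by rewrite !invr0.
by rewrite fmorphV.
Qed.

Lemma cabsX z n : cabs (z ^+ n) = cabs z ^+ n.
Proof. by elim: n => [|n IH]; rewrite ?expr0 ?cabs1 // !exprS cabsM IH. Qed.

Lemma cabs_real x : cabs (x%:C%C : C) = `|x|.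
Proof. by rewrite cabsE /= expr0n addr0 sqrtr_sqr. Qed.

Lemma cabs_prod (I : Type) (s : seq I) (F : I -> C) :
  cabs (\prod_(i <- s) F i) = \prod_(i <- s) cabs (F i).
Proof.
elim: s => [|i s IH]; first by rewrite !big_nil cabs1.
by rewrite !big_cons cabsM IH.
Qed.

Lemma cabs_sum (I : Type) (s : seq I) (P : pred I) (F : I -> C) :
  cabs (\sum_(i <- s | P i) F i) <= \sum_(i <- s | P i) cabs (F i).
Proof.
elim/big_ind2: _ => [|a b c d h1 h2|//]; first by rewrite cabs0.
by apply: (le_trans (cabsD _ _)); apply: lerD.
Qed.

Lemma Re_le_cabs z : `|Re z| <= cabs z.
Proof.
by rewrite cabsE -sqrtr_sqr ler_wsqrtr // lerDl sqr_ge0.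
Qed.

Lemma Im_le_cabs z : `|Im z| <= cabs z.
Proof.
by rewrite cabsE -sqrtr_sqr ler_wsqrtr // lerDr sqr_ge0.
Qed.

Lemma cabs_le_ReIm z : cabs z <= `|Re z| + `|Im z|.
Proof.
rewrite -(@ler_pXn2r _ 2) ?nnegrE ?cabs_ge0 ?addr_ge0 // sqr_cabs.
rewrite sqrrD !real_normK ?num_real // lerD2r lerDl.
by rewrite mulrn_wge0 // mulr_ge0.
Qed.

Lemma cabs_circle_point r t : cabs (circle_point r t) = `|r|.
Proof.
rewrite cabsE /= !exprMn -mulrDr cos2Dsin2 mulr1 sqrtr_sqr //.
Qed.

Lemma cabs_conj z : cabs (conjc z : C) = cabs z.
Proof. by case: z => a b; rewrite !cabsE /= sqrrN. Qed.

Lemma mulc_conj z : z * (conjc z : C) = ((cabs z) ^+ 2)%:C%C.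
Proof.
rewrite sqr_cabs; case: z => a b /=; apply/eqP; rewrite eq_complex /=.
by apply/andP; split; apply/eqP; ring.
Qed.

End Modulus.

Section Derivative.
Variable R : realType.
Notation C := (R[i]^o).
Implicit Types (F G : C -> C) (z w d h : C) (e : R).

(** Complex differentiability with real-valued epsilons; [hasderP] identifies
    it with the topological notion. *)
Definition hasder F z d := forall e, 0 < e -> exists2 del : R, 0 < del &
  forall h, cabs h < del -> cabs (F (z + h) - F z - d * h) <= e * cabs h.

Definition ccont F z := forall e, 0 < e -> exists2 del : R, 0 < del &
  forall w, cabs (w - z) < del -> cabs (F w - F z) < e.

Lemma hasder_ccont F z d : hasder F z d -> ccont F z.
Proof.
move=> /(_ 1 ltr01)[del del0 H] e e0.
have c0 : 0 < 1 + cabs d by rewrite ltr_wpDr ?cabs_ge0.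
exists (Num.min del (e / (1 + cabs d))); first by rewrite lt_min del0 divr_gt0.
move=> w; rewrite lt_min => /andP[h1 h2].
have := H (w - z) h1; rewrite subrKC mul1r => {}H.
have -> : F w - F z = (F w - F z - d * (w - z)) + d * (w - z) by rewrite subrK.
apply: le_lt_trans (cabsD _ _) _; rewrite cabsM.
apply: le_lt_trans (lerD H (lexx _)) _.
by rewrite -{1}[cabs (w - z)]mul1r -mulrDl mulrC -ltr_pdivlMr.
Qed.

Lemma lt0_real (e : R[i]) : 0 < e -> exists2 x : R, 0 < x & e = x%:C%C.
Proof.
move=> e0; exists (Re e).
  by move: e0; rewrite ltcE => /andP[].
by rewrite RRe_real // realE (ltW e0).
Qed.

Lemma cabs_slope (A d h : C) : h != 0 ->
  cabs (d - h^-1 *: A) = cabs (A - d * h) / cabs h.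
Proof.
move=> h0; rewrite -cabsV -cabsM cabsB; congr cabs.
by rewrite mulrBl mulfK // mulrC.
Qed.

Lemma hasderP F z d : hasder F z d <-> is_derive z (1 : C) F d.
Proof.
split=> [H|].
  have L : (fun h : C => h^-1 *: (F (h *: (1 : C) + z) - F z)) @ 0^' --> (d : C).
    apply/cvgrPdist_le => _ /lt0_real[e e0 ->].
    have [del del0 Hd] := H e e0.
    apply/(@nbhs_ballP _ C); exists (del%:C%C : R[i]).
      by rewrite /= ltcR.
    move=> h /=; rewrite /ball /= sub0r normrN normrE ltcR => hd h0.
    rewrite normrE lecR [_ *: 1]mulr1 [h + z]addrC cabs_slope //.
    by rewrite ler_pdivrMr ?cabs_gt0 // Hd.
  split; first by apply: cvgP L.
  exact/cvg_lim.
move=> [Hc Hl]; have : (fun h : C => h^-1 *: (F (h *: (1 : C) + z) - F z)) @ 0^' --> (d : C).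
  by rewrite -Hl; exact: Hc.
move=> /cvgrPdist_le L e e0.
have /L/(@nbhs_ballP _ C) : (0 : R[i]) < e%:C%C by rewrite ltcR.
move=> [_ /lt0_real[del del0 ->] Hd].
exists del => // h hd.
have [->|h0] := eqVneq h 0; first by rewrite addr0 subrr mulr0 subrr cabs0 mulr0.
have /= := Hd h; rewrite /ball /= sub0r normrN normrE ltcR => /(_ hd h0).
rewrite normrE lecR [_ *: 1]mulr1 [h + z]addrC cabs_slope //.
by rewrite ler_pdivrMr ?cabs_gt0.
Qed.

Lemma hasder_derive1 F z d : hasder F z d -> derive1 F z = d.
Proof. by move=> /hasderP[_ <-]; rewrite derive1E. Qed.

Lemma hasder_derivable F z d : hasder F z d -> derivable F z 1.
Proof. by move=> /hasderP[]. Qed.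

Lemma derivable_hasder F z : derivable F z 1 -> hasder F z (derive1 F z).
Proof. by move=> H; apply/hasderP; rewrite derive1E; apply/derivableP. Qed.

Lemma hasder_cst (c : C) z : hasder (fun=> c) z 0.
Proof. by apply/hasderP; exact: is_derive_cst. Qed.

Lemma hasder_id z : hasder id z 1.
Proof. by apply/hasderP; exact: is_derive_id. Qed.

Lemma hasderD F G z d h : hasder F z d -> hasder G z h ->
  hasder (fun w => F w + G w) z (d + h).
Proof.
by move=> /hasderP HF /hasderP HG; apply/hasderP; exact: is_deriveD.
Qed.

Lemma hasderN F z d : hasder F z d -> hasder (fun w => - F w) z (- d).
Proof.
by move=> /hasderP HF; apply/hasderP; exact: is_deriveN.
Qed.

Lemma hasderB F G z d h : hasder F z d -> hasder G z h ->
  hasder (fun w => F w - G w) z (d - h).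
Proof. by move=> HF HG; apply: hasderD => //; apply: hasderN. Qed.

Lemma hasderM F G z d h : hasder F z d -> hasder G z h ->
  hasder (fun w => F w * G w) z (d * G z + F z * h).
Proof.
move=> HF HG e e0.
pose M := 1 + cabs (F z) + cabs (G z) + cabs d.
have M1 : 1 <= M by rewrite /M -!addrA lerDl !addr_ge0 ?cabs_ge0.
have M0 : 0 < M by apply: lt_le_trans M1.
pose e1 := e / (3 * M); have e10 : 0 < e1 by rewrite divr_gt0 // mulr_gt0.
have [dF dF0 {}HF] := HF e1 e10.
have [dC dC0 HC] := hasder_ccont HG e10.
have [dD dD0 HD] := hasder_ccont HG ltr01.
have [dG dG0 {}HG] := HG e1 e10.
exists (Num.min (Num.min dF dG) (Num.min dC dD)).
  by rewrite !lt_min dF0 dG0 dC0 dD0.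
move=> k; rewrite !lt_min => /andP[/andP[/HF kF /HG kG] /andP[kC kD]].
have := HC (z + k); have := HD (z + k); rewrite [z + k - z]addrAC subrr add0r.
move=> /(_ kD) {}HD /(_ kC)/ltW {}HC.
have GM : cabs (G (z + k)) <= M.
  have : cabs (G (z + k)) <= cabs (G (z + k) - G z) + cabs (G z).
    by rewrite -{1}(subrK (G z) (G (z + k))) cabsD.
  have := cabs_ge0 (F z); have := cabs_ge0 d; rewrite /M; lra.
have -> : F (z + k) * G (z + k) - F z * G z - (d * G z + F z * h) * k =
  (F (z + k) - F z - d * k) * G (z + k) +
  (F z * (G (z + k) - G z - h * k) + d * k * (G (z + k) - G z)) by ring.
apply: le_trans (cabsD _ _) _; apply: le_trans (lerD (lexx _) (cabsD _ _)) _.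
rewrite !cabsM; have k0 := cabs_ge0 k.
have Fd : cabs (F z) <= M by rewrite /M; have := cabs_ge0 (G z); have := cabs_ge0 d; lra.
have dM : cabs d <= M by rewrite /M; have := cabs_ge0 (G z); have := cabs_ge0 (F z); lra.
have -> : e * cabs k = e1 * cabs k * M + (M * (e1 * cabs k) + M * cabs k * e1).
  by rewrite /e1; field; rewrite gt_eqF.
by rewrite !lerD // ler_pM ?mulr_ge0 ?cabs_ge0 // ler_pM // ?cabs_ge0.
Qed.

Lemma hasderV F z d : F z != 0 -> hasder F z d ->
  hasder (fun w => (F w)^-1) z (- d / F z ^+ 2).
Proof.
move=> Fz0 /hasderP[HF Hd]; apply/hasderP; split; first exact: derivableV.
rewrite deriveV // Hd -[_ *: _]/(_ * _).
by rewrite mulrC mulNr mulrN.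
Qed.

Lemma hasderX z n : hasder (fun w => w ^+ n) z (n%:R * z ^+ n.-1).
Proof.
elim: n => [|n IH]; first by rewrite mul0r; exact: hasder_cst.
have := hasderM (hasder_id z) IH.
congr hasder; first by apply: funext => w; rewrite exprS.
case: n {IH} => [|n] /=; first by rewrite expr0 !mul0r mulr0 addr0 !mulr1.
by rewrite mul1r mulrCA -exprS -{1}[z ^+ n.+1]mul1r -mulrDl nat1r.
Qed.

Lemma hasder_shift F z0 z d : hasder F (z0 + z) d ->
  hasder (fun w => F (z0 + w)) z d.
Proof.
by move=> H e e0; have [del del0 Hd] := H e e0; exists del => // h hd;
  rewrite addrA; apply: Hd.
Qed.

Lemma hasder_near F G z d rho : 0 < rho ->
  (forall w, cabs (w - z) < rho -> F w = G w) -> hasder F z d -> hasder G z d.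
Proof.
move=> rho0 FG H e e0; have [del del0 Hd] := H e e0.
exists (Num.min del rho); first by rewrite lt_min del0.
move=> h; rewrite lt_min => /andP[h1 h2].
rewrite -!FG ?subrr ?cabs0 //; first exact: Hd.
by rewrite [z + h]addrC addrK.
Qed.

Lemma entireP F : entire F <-> forall z, hasder F z (derive1 F z).
Proof.
split=> H z; first exact: derivable_hasder.
exact: hasder_derivable (H z).
Qed.

Lemma entire_ccont F : entire F -> forall z, ccont F z.
Proof. by move=> /entireP H z; exact: hasder_ccont (H z). Qed.

End Derivative.

(** * Integrals of continuous functions over segments and circles *)

Section SegmentIntegral.
Variable R : realType.
Notation C := (R[i]^o).
Implicit Types (a b c t M : R) (v w : R -> R) (g h : R -> C).
Local Notation mu := (@lebesgue_measure R).

Definition rint a b v : R := \int[mu]_(t in `[a, b]) v t.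

Lemma rint_integrable a b v : continuous v ->
  mu.-integrable `[a, b] (EFin \o v).
Proof.
move=> cv; apply: continuous_compact_integrable; first exact: segment_compact.
by apply: continuous_subspaceT => x; exact: cv.
Qed.

Lemma rintD a b v w : continuous v -> continuous w ->
  rint a b (fun t => v t + w t) = rint a b v + rint a b w.
Proof. by move=> cv cw; apply: RintegralD => //; exact: rint_integrable. Qed.

Lemma rintB a b v w : continuous v -> continuous w ->
  rint a b (fun t => v t - w t) = rint a b v - rint a b w.
Proof. by move=> cv cw; apply: RintegralB => //; exact: rint_integrable. Qed.

Lemma rintZ a b v M : continuous v ->
  rint a b (fun t => M * v t) = M * rint a b v.
Proof. by move=> cv; apply: RintegralZl => //; exact: rint_integrable. Qed.

Lemma rint_cst a b M : a <= b -> rint a b (fun=> M) = M * (b - a).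
Proof.
move=> ab; rewrite /rint Rintegral_cst //=.
rewrite lebesgue_measure_itv /= lte_fin.
by move: ab; rewrite le_eqVlt => /orP[/eqP->|->] //; rewrite ltxx subrr.
Qed.

Lemma ler_rint a b v w : continuous v -> continuous w ->
  (forall t, a <= t <= b -> v t <= w t) -> rint a b v <= rint a b w.
Proof.
move=> cv cw H; by apply: le_Rintegral => //; exact: rint_integrable.
Qed.

Lemma rint_split a c b v : continuous v -> a <= c -> c <= b ->
  rint a b v = rint a c v + rint c b v.
Proof.
move=> cv ac cb.
have := @Rintegral_itvB _ v (BLeft a) (BRight b) c (rint_integrable a b cv).
rewrite !bnd_simp => /(_ ac cb)/eqP; rewrite subr_eq => /eqP.
rewrite /rint => ->; rewrite addrC; congr (_ + _).
apply: Rintegral_itv_obnd_cbnd.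
apply: integrableS (rint_integrable c b cv) => //.
by apply: subset_itvr; rewrite bnd_simp.
Qed.

Lemma normr_rint a b v M : a <= b -> continuous v ->
  (forall t, a <= t <= b -> `|v t| <= M) -> `|rint a b v| <= M * (b - a).
Proof.
move=> ab cv H; rewrite ler_norml -mulNr -!rint_cst //.
by apply/andP; split; apply: ler_rint => //; try exact: cst_continuous;
  move=> t /H; rewrite ler_norml => /andP[].
Qed.

Lemma contD v w : continuous v -> continuous w -> continuous (fun t => v t + w t).
Proof. by move=> cv cw t; apply: (@cvgD R R R); [exact: cv|exact: cw]. Qed.

Lemma contB v w : continuous v -> continuous w -> continuous (fun t => v t - w t).
Proof. by move=> cv cw t; apply: (@cvgB R R R); [exact: cv|exact: cw]. Qed.

Lemma contM v w : continuous v -> continuous w -> continuous (fun t => v t * w t).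
Proof. by move=> cv cw t; apply: (@cvgM R R); [exact: cv|exact: cw]. Qed.

Definition tcont g := forall t e, 0 < e -> exists2 del : R, 0 < del &
  forall s, `|s - t| < del -> cabs (g s - g t) < e.

Lemma tcontP g :
  tcont g <-> continuous (fun t => Re (g t)) /\ continuous (fun t => Im (g t)).
Proof.
split=> [H|[Hr Hi] t e e0].
  split=> t; apply/cvgrPdist_lt => e e0; have [del del0 Hd] := H t e e0;
    apply/(@nbhs_ballP _ R); exists del => //= s;
    rewrite /ball /= distrC => /Hd; rewrite cabsB; apply: le_lt_trans;
    [rewrite -raddfB; exact: (Re_le_cabs (g t - g s))
    |rewrite -raddfB; exact: (Im_le_cabs (g t - g s))].
have e2 : 0 < e / 2 by rewrite divr_gt0.
have /cvgrPdist_lt/(_ _ e2)/(@nbhs_ballP _ R)[d1 /= d10 H1] := Hr t.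
have /cvgrPdist_lt/(_ _ e2)/(@nbhs_ballP _ R)[d2 /= d20 H2] := Hi t.
exists (Num.min d1 d2); first by rewrite lt_min d10.
move=> s; rewrite lt_min distrC => /andP[/H1 + /H2].
rewrite cabsB => h1 h2; apply: le_lt_trans (cabs_le_ReIm _) _.
rewrite [e]splitr; apply: ltrD; first by move: h1; rewrite -raddfB.
by move: h2; rewrite -raddfB.
Qed.

Definition cint a b g : C :=
  Complex (rint a b (fun t => Re (g t))) (rint a b (fun t => Im (g t))).

Lemma cintD a b g h : tcont g -> tcont h ->
  cint a b (fun t => g t + h t) = cint a b g + cint a b h.
Proof.
move=> /tcontP[g1 g2] /tcontP[h1 h2]; rewrite /cint.
rewrite -[_ + _ in RHS]/(Complex (_ + _) (_ + _)) -!rintD //.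
by congr (Complex (rint _ _ _) (rint _ _ _)); apply: funext => t;
  rewrite raddfD.
Qed.

Lemma cintZ a b g (k : C) : tcont g ->
  cint a b (fun t => k * g t) = k * cint a b g.
Proof.
move=> /tcontP[g1 g2]; rewrite /cint; case: k => x y.
have cZ u v : continuous v -> continuous (fun t : R => u * v t).
  by move=> cv; apply: contM => // t; exact: cvg_cst.
rewrite -[_ * _ in RHS]/(Complex (_ - _) (_ + _)) -!rintZ // -rintD -?rintB //;
  try exact: cZ.
by congr (Complex (rint _ _ _) (rint _ _ _)); apply: funext => t;
  case: (g t).
Qed.

Lemma cint_cst a b (k : C) : a <= b -> cint a b (fun=> k) = k * ((b - a)%:C)%C.
Proof.
move=> ab; rewrite /cint !rint_cst //; case: k => x y /=.
by apply/eqP; rewrite eq_complex /= !mulr0 subr0 add0r !eqxx.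
Qed.

Lemma tcont_cst (k : C) : tcont (fun=> k).
Proof. by move=> t e e0; exists 1 => // s _; rewrite subrr cabs0. Qed.

Lemma tcontD g h : tcont g -> tcont h -> tcont (fun t => g t + h t).
Proof.
move=> /tcontP[g1 g2] /tcontP[h1 h2]; apply/tcontP; split.
  have -> : (fun s => Re (g s + h s)) = (fun s => Re (g s) + Re (h s)).
    by apply: funext => s; rewrite raddfD.
  exact: contD.
have -> : (fun s => Im (g s + h s)) = (fun s => Im (g s) + Im (h s)).
  by apply: funext => s; rewrite raddfD.
exact: contD.
Qed.

Lemma tcontM g h : tcont g -> tcont h -> tcont (fun t => g t * h t).
Proof.
move=> /tcontP[g1 g2] /tcontP[h1 h2]; apply/tcontP; split.
  have -> : (fun s => Re (g s * h s)) =
     (fun s => Re (g s) * Re (h s) - Im (g s) * Im (h s)).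
    by apply: funext => s; case: (g s) => ? ?; case: (h s).
  by apply: contB; apply: contM.
have -> : (fun s => Im (g s * h s)) =
   (fun s => Re (g s) * Im (h s) + Im (g s) * Re (h s)).
  by apply: funext => s; case: (g s) => ? ?; case: (h s).
by apply: contD; apply: contM.
Qed.

Lemma tcontZ g (k : C) : tcont g -> tcont (fun t => k * g t).
Proof. by apply: tcontM; exact: tcont_cst. Qed.

Lemma tcontN g : tcont g -> tcont (fun t => - g t).
Proof. by move=> /(tcontZ (- 1)); under eq_fun do rewrite mulN1r. Qed.

Lemma tcontB g h : tcont g -> tcont h -> tcont (fun t => g t - h t).
Proof. by move=> cg /tcontN ch; exact: tcontD. Qed.

Lemma cintB a b g h : tcont g -> tcont h ->
  cint a b (fun t => g t - h t) = cint a b g - cint a b h.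
Proof.
move=> cg ch; rewrite -mulN1r -cintZ // -cintD //; last exact: tcontZ.
by congr cint; apply: funext => t; rewrite mulN1r.
Qed.

Lemma cint_split a c b g : tcont g -> a <= c -> c <= b ->
  cint a b g = cint a c g + cint c b g.
Proof.
move=> /tcontP[g1 g2] ac cb; rewrite /cint (rint_split g1 ac cb).
by rewrite (rint_split g2 ac cb).
Qed.

Lemma cabs_cint a b g M : a <= b -> tcont g ->
  (forall t, a <= t <= b -> cabs (g t) <= M) ->
  cabs (cint a b g) <= 2 * M * (b - a).
Proof.
move=> ab /tcontP[g1 g2] H; apply: le_trans (cabs_le_ReIm _) _.
rewrite -mulrA mulr2n mulrDl mul1r; apply: lerD; apply: normr_rint => // t /H.
  by apply: le_trans; exact: Re_le_cabs.
by apply: le_trans; exact: Im_le_cabs.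
Qed.

End SegmentIntegral.

(** * Goursat's lemma and Cauchy's formula *)

Lemma ltr_sum4 (K : realDomainType) (x1 x2 x3 x4 e : K) :
  x1 < e -> x2 < e -> x3 < e -> x4 < e -> x1 + x2 + (x3 + x4) < 4 * e.
Proof. lra. Qed.

Lemma itv_dist (K : realDomainType) (a l x y : K) :
  a <= x <= a + l -> a <= y <= a + l -> `|x - y| <= l.
Proof.
by move=> /andP[h1 h2] /andP[h3 h4]; rewrite ler_norml; apply/andP; split; lra.
Qed.

Section Goursat.
Variable R : realType.
Notation C := (R[i]^o).
Implicit Types (a c p q s t e : R) (h : R -> R -> C).

Definition hol h a c := exists al : C, forall e, 0 < e -> exists2 del : R, 0 < del &
  forall s t, `|s - a| < del -> `|t - c| < del ->
    cabs (h s t - h a c - al * Complex (s - a) (t - c)) <=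
    e * (`|s - a| + `|t - c|).

(** The integral of [h] along the boundary of [[a, a + p] x [c, c + q]], with
    opposite sides grouped: the contribution of an affine function is then the
    integral of a constant on each pair of sides. *)
Definition bdint h a c p q : C :=
  cint a (a + p) (fun s => h s c - h s (c + q)) +
  Complex 0 1 * cint c (c + q) (fun t => h (a + p) t - h a t).

Variable h : R -> R -> C.
Hypothesis hs : forall t, tcont (h^~ t).
Hypothesis ht : forall s, tcont (h s).

Let tc1 t t' : tcont (fun s => h s t - h s t').
Proof. by apply: tcontB; exact: hs. Qed.

Let tc2 s s' : tcont (fun t => h s t - h s' t).
Proof. by apply: tcontB; exact: ht. Qed.

Lemma bdint_splits a c p q : 0 <= p -> bdint h a c p q =
  bdint h a c (p / 2) q + bdint h (a + p / 2) c (p / 2) q.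
Proof.
move=> p0; rewrite /bdint.
have -> : a + p / 2 + p / 2 = a + p by rewrite -addrA -splitr.
have p2 : 0 <= p / 2 by rewrite divr_ge0.
rewrite (@cint_split _ a (a + p / 2) (a + p)) ?lerDl //; last first.
  by rewrite lerD2l ler_pdivrMr // ler_peMr // ler1n.
by rewrite !cintB //; ring.
Qed.

Lemma bdint_splitt a c p q : 0 <= q -> bdint h a c p q =
  bdint h a c p (q / 2) + bdint h a (c + q / 2) p (q / 2).
Proof.
move=> q0; rewrite /bdint.
have -> : c + q / 2 + q / 2 = c + q by rewrite -addrA -splitr.
have q2 : 0 <= q / 2 by rewrite divr_ge0.
rewrite (@cint_split _ c (c + q / 2) (c + q)) ?lerDl //; last first.
  by rewrite lerD2l ler_pdivrMr // ler_peMr // ler1n.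
by rewrite !cintB //; ring.
Qed.

Lemma bdint_quarter a c p q e : 0 <= p -> 0 <= q ->
  4 * e <= cabs (bdint h a c p q) ->
  exists b : bool * bool, e <=
    cabs (bdint h (a + b.1%:R * (p / 2)) (c + b.2%:R * (q / 2)) (p / 2) (q / 2)).
Proof.
move=> p0 q0; apply: contra_leP => H.
have {}H (b1 b2 : bool) : cabs (bdint h (a + b1%:R * (p / 2)) (c + b2%:R * (q / 2)) (p / 2) (q / 2)) < e.
  by rewrite ltNge; apply/negP => H'; apply: H; exists (b1, b2).
rewrite bdint_splits // (bdint_splitt _ _ _ q0) (bdint_splitt (a + p / 2) _ _ q0).
have := H false false; have := H false true; have := H true false; have := H true true.
rewrite !mul0r !mul1r !addr0 => h1 h2 h3 h4.
apply: le_lt_trans (cabsD _ _) _.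
apply: le_lt_trans (lerD (cabsD _ _) (cabsD _ _)) _.
by apply: ltr_sum4; assumption.
Qed.

Lemma bdint_local a c p q s t (al : C) e : 0 <= p -> 0 <= q ->
  a <= s <= a + p -> c <= t <= c + q ->
  (forall s' t', a <= s' <= a + p -> c <= t' <= c + q ->
    cabs (h s' t' - h s t - al * Complex (s' - s) (t' - t)) <= e) ->
  cabs (bdint h a c p q) <= 4 * e * (p + q).
Proof.
move=> p0 q0 sp tq H; rewrite /bdint.
have ap : a <= a + p by rewrite lerDl.
have cq : c <= c + q by rewrite lerDl.
have e1 s' : a <= s' <= a + p ->
    cabs (h s' c - h s' (c + q) - al * Complex 0 (- q)) <= 2 * e.
  move=> s'p; have -> : al * Complex 0 (- q) =
      al * Complex (s' - s) (c - t) - al * Complex (s' - s) (c + q - t).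
    rewrite -mulrBr; congr (_ * _); apply/eqP; rewrite eq_complex /=.
    by apply/andP; split; apply/eqP; ring.
  set A := al * _; set B := al * _.
  have -> : h s' c - h s' (c + q) - (A - B) =
    (h s' c - h s t - A) - (h s' (c + q) - h s t - B) by ring.
  apply: le_trans (cabsD _ _) _; rewrite cabsN mulr2n mulrDl mul1r.
  by apply: lerD; apply: H => //; rewrite lexx ?cq.
have e2 t' : c <= t' <= c + q ->
    cabs (h (a + p) t' - h a t' - al * Complex p 0) <= 2 * e.
  move=> t'q; have -> : al * Complex p 0 =
      al * Complex (a + p - s) (t' - t) - al * Complex (a - s) (t' - t).
    rewrite -mulrBr; congr (_ * _); apply/eqP; rewrite eq_complex /=.
    by apply/andP; split; apply/eqP; ring.
  set A := al * _; set B := al * _.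
  have -> : h (a + p) t' - h a t' - (A - B) =
    (h (a + p) t' - h s t - A) - (h a t' - h s t - B) by ring.
  apply: le_trans (cabsD _ _) _; rewrite cabsN mulr2n mulrDl mul1r.
  by apply: lerD; apply: H => //; rewrite lexx ?ap.
have -> : cint a (a + p) (fun s => h s c - h s (c + q)) +
  Complex 0 1 * cint c (c + q) (fun t => h (a + p) t - h a t) =
  cint a (a + p) (fun s => h s c - h s (c + q) - al * Complex 0 (- q)) +
  Complex 0 1 * cint c (c + q) (fun t => h (a + p) t - h a t - al * Complex p 0).
  rewrite [in RHS]cintB //; last exact: tcont_cst.
  rewrite [in RHS](@cintB _ _ _ (fun t => h (a + p) t - h a t)) //; last exact: tcont_cst.
  rewrite !cint_cst // ![_ + _ - a]addrAC ![_ + _ - c]addrAC !subrr !add0r.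
  set X := cint _ _ _; set Y := cint _ _ _.
  have -> : al * Complex 0 (- q) * (p%:C)%C = - (Complex 0 1 * (al * Complex p 0 * (q%:C)%C)).
    case: (al) => x y; apply/eqP; rewrite eq_complex /=.
    by apply/andP; split; apply/eqP; ring.
  by ring.
apply: le_trans (cabsD _ _) _; rewrite cabsM.
have -> : cabs (Complex 0 1 : C) = 1 by rewrite cabsE /= expr0n add0r expr1n sqrtr1.
rewrite mul1r mulrDr; apply: lerD.
  apply: le_trans (@cabs_cint _ _ _ _ (2 * e) ap _ _) _ => //.
    by apply: tcontB; [exact: tc1|exact: tcont_cst].
  by rewrite addrAC subrr add0r mulrA -natrM.
apply: le_trans (@cabs_cint _ _ _ _ (2 * e) cq _ _) _ => //.
  by apply: tcontB; [exact: tc2|exact: tcont_cst].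
by rewrite addrAC subrr add0r mulrA -natrM.
Qed.

Lemma nested_point (u l : nat -> R) : (forall n, 0 <= l n) ->
  (forall n, u n <= u n.+1) -> (forall n, u n.+1 + l n.+1 <= u n + l n) ->
  exists x, forall n, u n <= x <= u n + l n.
Proof.
move=> l0 h1 h2.
have um m n : (m <= n)%N -> u m <= u n.
  move=> /subnKC <-; elim: (n - m)%N => [|k IH]; first by rewrite addn0.
  by rewrite addnS (le_trans IH).
have vm m n : (m <= n)%N -> u n + l n <= u m + l m.
  move=> /subnKC <-; elim: (n - m)%N => [|k IH]; first by rewrite addn0.
  by rewrite addnS (le_trans (h2 _)).
have ub n : ubound (range u) (u n + l n).
  move=> _ [m _ <-]; have [mn|nm] := leqP m n.
    by apply: (le_trans (um _ _ mn)); rewrite lerDl.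
  by apply: le_trans (vm _ _ (ltnW nm)); rewrite lerDl.
exists (sup (range u)) => n; apply/andP; split.
  apply: sup_upper_bound; last by exists n.
  by split; [exists (u 0), 0%N|exists (u 0 + l 0); exact: ub].
by apply: sup_le_ub; [exists (u 0), 0%N|exact: ub].
Qed.

Theorem goursat a c p q : 0 < p -> 0 < q ->
  (forall s t, a <= s <= a + p -> c <= t <= c + q -> hol h s t) ->
  bdint h a c p q = 0.
Proof.
move=> p0 q0 H; apply/eqP; rewrite -cabs_eq0; apply: contraT => n0.
set e0 := cabs _ in n0; have {n0} e00 : 0 < e0 by rewrite lt_neqAle eq_sym n0 cabs_ge0.
pose pn n := p / 2 ^+ n; pose qn n := q / 2 ^+ n.
have pn0 n : 0 < pn n by rewrite divr_gt0 // exprn_gt0.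
have qn0 n : 0 < qn n by rewrite divr_gt0 // exprn_gt0.
have pnS n : pn n.+1 = pn n / 2 by rewrite /pn exprSr invfM mulrA.
have qnS n : qn n.+1 = qn n / 2 by rewrite /qn exprSr invfM mulrA.
pose bad n (x : R * R) := e0 / 4 ^+ n <= cabs (bdint h x.1 x.2 (pn n) (qn n)).
pose good n (x y : R * R) := [/\ bad n.+1 y,
  x.1 <= y.1, y.1 + pn n.+1 <= x.1 + pn n, x.2 <= y.2 &
  y.2 + qn n.+1 <= x.2 + qn n].
have step n x : bad n x -> exists y, good n x y.
  move=> bx; have bx' : 4 * (e0 / 4 ^+ n.+1) <= cabs (bdint h x.1 x.2 (pn n) (qn n)).
    by apply: le_trans bx; rewrite exprS invfM mulrCA mulVKf.
  have [[b1 b2] hb] := bdint_quarter (ltW (pn0 n)) (ltW (qn0 n)) bx'.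
  exists (x.1 + b1%:R * (pn n / 2), x.2 + b2%:R * (qn n / 2)).
  have hp := pn0 n; have hq := qn0 n.
  split; rewrite /= ?pnS ?qnS.
  - by rewrite /bad /= pnS qnS.
  - by case: b1 {hb} => /=; lra.
  - by case: b1 {hb} => /=; lra.
  - by case: b2 {hb} => /=; lra.
  - by case: b2 {hb} => /=; lra.
pose u := fix u n : R * R := if n is m.+1 then xget (0, 0) (good m (u m)) else (a, c).
have gu n : bad n (u n) /\ good n (u n) (u n.+1).
  elim: n => [|n [_ [b _ _ _ _]]].
    have b0 : bad 0%N (u 0%N) by rewrite /bad /pn /qn /= !expr0 !divr1.
    by split => //; exact: (xgetPex (0, 0) (step _ _ b0)).
  by split => //; exact: (xgetPex (0, 0) (step _ _ b)).
have [s sP] : exists s, forall n, (u n).1 <= s <= (u n).1 + pn n.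
  by apply: nested_point => n; [exact: ltW| |]; have [_ []] := gu n.
have [t tP] : exists t, forall n, (u n).2 <= t <= (u n).2 + qn n.
  by apply: nested_point => n; [exact: ltW| |]; have [_ []] := gu n.
have [al Hal] : hol h s t.
  by apply: H; [have := sP 0%N|have := tP 0%N]; rewrite /= /pn /qn expr0 divr1.
have pq0 : 0 < p + q by rewrite addr_gt0.
pose e := e0 / (8 * (p + q) ^+ 2).
have e_gt0 : 0 < e by rewrite divr_gt0 // mulr_gt0 // exprn_gt0.
have [del del0 Hdel] := Hal e e_gt0.
have [n hn] : exists n, (p + q) / 2 ^+ n < del.
  have [n hn] : exists n, (p + q) / del < n%:R.
    by exists (Num.bound ((p + q) / del)); apply: archi_boundP; rewrite divr_ge0 ?ltW.
  exists n; rewrite ltr_pdivrMr ?exprn_gt0 // mulrC -ltr_pdivrMr //.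
  by apply: lt_trans hn _; rewrite -natrX ltr_nat ltn_expl.
have [bn _] := gu n.
have hpq : (pn n + qn n) = (p + q) / 2 ^+ n by rewrite /pn /qn mulrDl.
have := @bdint_local (u n).1 (u n).2 (pn n) (qn n) s t al (e * (pn n + qn n))
  (ltW (pn0 n)) (ltW (qn0 n)) (sP n) (tP n).
have hp := pn0 n; have hq := qn0 n.
have Hd s' t' : (u n).1 <= s' <= (u n).1 + pn n -> (u n).2 <= t' <= (u n).2 + qn n ->
    cabs (h s' t' - h s t - al * Complex (s' - s) (t' - t)) <= e * (pn n + qn n).
  move=> hs' ht'; have := sP n; have := tP n => htn hsn.
  have h1 : `|s' - s| <= pn n := itv_dist hs' hsn.
  have h2 : `|t' - t| <= qn n := itv_dist ht' htn.
  have h12 : `|s' - s| + `|t' - t| < del by apply: le_lt_trans (lerD h1 h2) _; rewrite hpq.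
  apply: le_trans (Hdel _ _ _ _) _; [| |].
  - by apply: le_lt_trans h12; rewrite lerDl.
  - by apply: le_lt_trans h12; rewrite lerDr.
  by rewrite ler_pM2l // lerD.
move=> /(_ Hd) B; move: (le_trans bn B).
rewrite hpq leNgt => /negP[]; rewrite ltr_pdivlMr ?exprn_gt0 //.
have -> : (4 : R) ^+ n = 2 ^+ n * 2 ^+ n by rewrite -exprMn -natrM.
rewrite /e.
have x0 : (2 : R) ^+ n != 0 by rewrite expf_neq0.
have -> : 4 * (e0 / (8 * (p + q) ^+ 2) * ((p + q) / 2 ^+ n)) * ((p + q) / 2 ^+ n) *
  (2 ^+ n * 2 ^+ n) = e0 / 2 by field; rewrite x0 gt_eqF.
by rewrite ltr_pdivrMr // ltr_pMr // ltr1n.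
Qed.

End Goursat.

Section CircleMean.
Variable R : realType.
Notation C := (R[i]^o).
Implicit Types (F G : C -> C) (g : R -> C) (v : R -> R) (z w d k : C).
Implicit Types (r s t x e M : R).

Lemma real_slope v x (d : R) : is_derive x 1 v d -> forall e, 0 < e ->
  exists2 del : R, 0 < del &
  forall h, `|h| < del -> `|v (x + h) - v x - d * h| <= e * `|h|.
Proof.
move=> [Hc Hl] e e0.
have : (fun h : R => h^-1 *: (v (h *: (1 : R) + x) - v x)) @ 0^' --> (d : R).
  by rewrite -Hl; exact: Hc.
move=> /cvgrPdist_le/(_ e e0)/(@nbhs_ballP _ R)[del /= del0 Hd].
exists del => // h hd.
have [->|h0] := eqVneq h 0; first by rewrite addr0 subrr mulr0 subrr !normr0 mulr0.
have := Hd h; rewrite /ball /= sub0r normrN => /(_ hd h0).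
rewrite [_ *: 1]mulr1 [h + x]addrC.
have -> : d - h^-1 *: (v (x + h) - v x) = - (v (x + h) - v x - d * h) / h.
  by rewrite -[_ *: _]/(_ * _); field.
by rewrite normrM normrN normfV ler_pdivrMr // normr_gt0.
Qed.

Lemma circle_pointM r s t x :
  circle_point (r * s) (t + x) = circle_point r t * circle_point s x :> C.
Proof.
apply/eqP; rewrite eq_complex /= cosD sinD.
by apply/andP; split; apply/eqP; ring.
Qed.

(** [circle_point (expR s) t] is the complex exponential of [s + i t]. *)
Lemma cexp_slope s0 t0 : hol (fun s t => circle_point (expR s) t) s0 t0.
Proof.
exists (circle_point (expR s0) t0) => e e0.
set P := circle_point _ _.
have P0 : 0 < 1 + cabs P by rewrite ltr_wpDr ?cabs_ge0.
pose e1 := Num.min 1 (e / (5 * (1 + cabs P))).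
have e10 : 0 < e1 by rewrite lt_min ltr01 divr_gt0 // mulr_gt0.
have e1e : 5 * e1 * cabs P <= e.
  have : e1 <= e / (5 * (1 + cabs P)) by rewrite ge_min lexx orbT.
  rewrite ler_pdivlMr ?mulr_gt0 // => h.
  apply: le_trans h.
  have -> : e1 * (5 * (1 + cabs P)) = 5 * e1 * cabs P + 5 * e1 by ring.
  lra.
have e11 : e1 <= 1 by rewrite ge_min lexx.
have [d1 d10 H1] := real_slope (is_derive_expR 0) e10.
have [d2 d20 H2] := real_slope (is_derive_cos 0) e10.
have [d3 d30 H3] := real_slope (is_derive_sin 0) e10.
have d40 : 0 < Num.min d1 (e1 / 2) by rewrite lt_min d10 divr_gt0.
exists (Num.min (Num.min d1 (e1 / 2)) (Num.min d2 d3)).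
  by rewrite !lt_min d10 d20 d30 divr_gt0.
move=> s t; set x := s - s0; set y := t - t0.
rewrite !lt_min => /andP[/andP[x1 x2] _] /andP[_ /andP[y2 y3]].
have := H1 _ x1; have := H2 _ y2; have := H3 _ y3.
rewrite !add0r expR0 cos0 sin0 oppr0 !mul0r !mul1r !subr0 !addr0 => h3 h2 h1.
have -> : circle_point (expR s) t = P * circle_point (expR x) y :> C.
  by rewrite -circle_pointM -expRD /x /y !subrKC.
have -> : P * circle_point (expR x) y - P - P * Complex x y =
  P * (circle_point (expR x) y - 1 - Complex x y) by ring.
rewrite cabsM.
suff : cabs (circle_point (expR x) y - 1 - Complex x y : C) <= 5 * e1 * (`|x| + `|y|).
  move=> H; apply: le_trans (ler_wpM2l (cabs_ge0 P) H) _.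
  by rewrite mulrCA !mulrA ler_wpM2r ?addr_ge0 // mulrAC.
apply: le_trans (cabs_le_ReIm _) _; rewrite /= subr0.
have -> : expR x * cos y - 1 - x =
  (expR x - 1 - x) * cos y + (1 + x) * (cos y - 1) by ring.
have -> : expR x * sin y - y =
  (expR x - 1) * sin y + (sin y - y) by ring.
have ce : `|cos y| <= 1 by rewrite ler_norml cos_geN1 cos_le1.
have xe : `|1 + x| <= 2.
  by apply: le_trans (ler_normD _ _) _; rewrite normr1; lra.
have ex : `|expR x - 1| <= 2 * `|x|.
  have -> : expR x - 1 = (expR x - 1 - x) + x by ring.
  apply: le_trans (ler_normD _ _) _.
  have := ler_wpM2r (normr_ge0 x) e11; lra.
have sy : `|sin y| <= 2 * `|y|.
  have -> : sin y = (sin y - y) + y by ring.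
  apply: le_trans (ler_normD _ _) _.
  have := ler_wpM2r (normr_ge0 y) e11; lra.
have A1 : `|(expR x - 1 - x) * cos y| <= e1 * `|x|.
  by rewrite normrM -[leRHS]mulr1; apply: ler_pM.
have A2 : `|(1 + x) * (cos y - 1)| <= 2 * (e1 * `|y|).
  by rewrite normrM; apply: ler_pM.
have A3 : `|(expR x - 1) * sin y| <= e1 * (2 * `|y|).
  rewrite normrM; apply: ler_pM => //.
  by apply: le_trans ex _; lra.
have A4 := ler_normD ((expR x - 1 - x) * cos y) ((1 + x) * (cos y - 1)).
have A5 := ler_normD ((expR x - 1) * sin y) (sin y - y).
have B1 := mulr_ge0 (ltW e10) (normr_ge0 x).
have B2 := mulr_ge0 (ltW e10) (normr_ge0 y).
lra.
Qed.

Lemma hol_comp F s0 t0 d : hasder F (circle_point (expR s0) t0) d ->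
  hol (fun s t => F (circle_point (expR s) t)) s0 t0.
Proof.
have [al Hal] := cexp_slope s0 t0; set P := circle_point _ _ => HF.
exists (d * al) => e e0.
have a1 : 0 < 1 + cabs al by rewrite ltr_wpDr ?cabs_ge0.
have d1 : 0 < 1 + cabs d by rewrite ltr_wpDr ?cabs_ge0.
pose e1 := Num.min 1 (e / (1 + cabs d) / 2).
have e10 : 0 < e1 by rewrite lt_min ltr01 !divr_gt0.
pose e2 := e / (1 + cabs al) / 2; have e20 : 0 < e2 by rewrite !divr_gt0.
have [de1 de10 {}HF] := HF e2 e20.
have [de2 de20 {}Hal] := Hal e1 e10.
exists (Num.min de2 (de1 / (1 + cabs al) / 2)).
  by rewrite lt_min de20 !divr_gt0.
move=> s t; set x := s - s0; set y := t - t0.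
rewrite !lt_min => /andP[x1 x2] /andP[y1 y2].
have := Hal s t x1 y1; rewrite -/x -/y -/P; set Q := circle_point (expR s) t.
set S := `|x| + `|y| => H1.
have S0 : 0 <= S by rewrite addr_ge0.
have cS : cabs (Complex x y : C) <= S by apply: le_trans (cabs_le_ReIm _) _.
have QP : cabs (Q - P) <= (1 + cabs al) * S.
  have -> : Q - P = (Q - P - al * Complex x y) + al * Complex x y by rewrite subrK.
  apply: le_trans (cabsD _ _) _; rewrite cabsM mulrDl mul1r; apply: lerD.
    apply: le_trans H1 _; rewrite -[leRHS]mul1r ler_wpM2r // ge_min lexx //.
  by apply: ler_wpM2l => //; rewrite cabs_ge0.
have Sd : S < de1 / (1 + cabs al) by rewrite /S; lra.
have QPd : cabs (Q - P) < de1.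
  by apply: le_lt_trans QP _; rewrite mulrC -ltr_pdivlMr.
have := HF (Q - P) QPd; rewrite subrKC => H2.
have -> : F Q - F P - d * al * Complex x y =
  (F Q - F P - d * (Q - P)) + d * (Q - P - al * Complex x y) by ring.
apply: le_trans (cabsD _ _) _; rewrite cabsM [e]splitr mulrDl; apply: lerD.
  apply: le_trans H2 _; apply: le_trans (ler_wpM2l (ltW e20) QP) _.
  by rewrite mulrA ler_wpM2r // /e2 mulrAC divfK ?gt_eqF.
apply: le_trans (ler_wpM2l (cabs_ge0 d) H1) _.
rewrite mulrA ler_wpM2r //.
have : e1 <= e / (1 + cabs d) / 2 by rewrite ge_min lexx orbT.
move=> h; apply: le_trans (ler_wpM2l (cabs_ge0 d) h) _.
rewrite mulrA ler_wpM2r ?invr_ge0 // mulrCA -[leRHS]mulr1 ler_wpM2l ?ltW //.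
by rewrite ltr_pdivrMr // mul1r ltrDr.
Qed.

Lemma tcont_comp F g : tcont g -> (forall t, ccont F (g t)) ->
  tcont (fun t => F (g t)).
Proof.
move=> cg cF t e e0; have [d1 d10 H1] := cF t e e0.
by have [d2 d20 H2] := cg t d1 d10; exists d2 => // s /H2/H1.
Qed.

Lemma tcont_circle r : tcont (circle_point r : R -> C).
Proof.
have cr : continuous (fun _ : R => r) by move=> t; exact: cvg_cst.
by apply/tcontP; split; apply: contM => // t /=;
  [exact: continuous_cos|exact: continuous_sin].
Qed.

Lemma tcont_ray r t : tcont (fun s => circle_point (expR s) t : C).
Proof.
have cr (x : R) : continuous (fun _ : R => x) by move=> ?; exact: cvg_cst.
by apply/tcontP; split; apply: contM => // s /=; exact: continuous_expR.
Qed.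

Definition tmean g : C := ((2 * pi)^-1)%:C%C * cint 0 (2 * pi) g.

Definition cmean F r : C := tmean (fun t => F (circle_point r t)).

Lemma twopi_gt0 : 0 < 2 * pi :> R.
Proof. by rewrite mulr_gt0 // pi_gt0. Qed.

Lemma tmeanD g1 g2 : tcont g1 -> tcont g2 ->
  tmean (fun t => g1 t + g2 t) = tmean g1 + tmean g2.
Proof. by move=> c1 c2; rewrite /tmean cintD // mulrDr. Qed.

Lemma tmeanB g1 g2 : tcont g1 -> tcont g2 ->
  tmean (fun t => g1 t - g2 t) = tmean g1 - tmean g2.
Proof. by move=> c1 c2; rewrite /tmean cintB // mulrBr. Qed.

Lemma tmeanZ g k : tcont g -> tmean (fun t => k * g t) = k * tmean g.
Proof. by move=> c; rewrite /tmean cintZ // mulrCA. Qed.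

Lemma tmean_cst k : tmean (fun=> k) = k.
Proof.
rewrite /tmean cint_cst ?ltW ?twopi_gt0 // subr0 mulrCA -rmorphM /=.
by rewrite mulVf ?mulr1 // gt_eqF // twopi_gt0.
Qed.

Lemma cabs_tmean g M : tcont g -> (forall t, cabs (g t) <= M) ->
  cabs (tmean g) <= 2 * M.
Proof.
move=> cg H; rewrite /tmean cabsM cabs_real ger0_norm; last first.
  by rewrite invr_ge0 ltW // twopi_gt0.
rewrite ler_pdivrMl ?twopi_gt0 //.
have p0 := twopi_gt0.
apply: le_trans (cabs_cint (ltW p0) cg (fun t _ => H t)) _.
by rewrite subr0 mulrC.
Qed.

Lemma cmean_const F r1 r2 : 0 < r1 -> r1 < r2 -> (forall z, ccont F z) ->
  (forall z, r1 <= cabs z <= r2 -> exists d, hasder F z d) ->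
  cmean F r1 = cmean F r2.
Proof.
move=> r10 r12 cF H.
have r20 : 0 < r2 by apply: lt_trans r12.
pose h s t := F (circle_point (expR s) t).
have hs t : tcont (h^~ t) by apply: tcont_comp => //; exact: tcont_ray.
have ht s : tcont (h s) by apply: tcont_comp => //; exact: tcont_circle.
have p0 : 0 < ln r2 - ln r1 by rewrite subr_gt0 ltr_ln.
have := @goursat _ h hs ht (ln r1) 0 _ _ p0 twopi_gt0.
rewrite subrKC add0r => G.
have {}G : bdint h (ln r1) 0 (ln r2 - ln r1) (2 * pi) = 0.
  apply: G => s t /andP[s1 s2] _.
  have [|d Hd] := H (circle_point (expR s) t).
    rewrite cabs_circle_point ger0_norm ?expR_ge0 //.
    by rewrite -{1}(lnK r10) -{1}(lnK r20) !ler_expR s1.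
  exact: hol_comp Hd.
move: G; rewrite /bdint add0r subrKC.
have -> : cint (ln r1) (ln r2) (fun s => h s 0 - h s (2 * pi)) = 0.
  rewrite -[RHS](mulr0 (0 : C)).
  have -> : (fun s => h s 0 - h s (2 * pi)) = (fun s => 0 * h s 0).
    apply: funext => s; rewrite mul0r /h /circle_point mulr_natl cos2pi sin2pi.
    by rewrite cos0 sin0 subrr.
  by rewrite cintZ // mul0r mulr0.
rewrite add0r cintB // => /eqP; rewrite mulf_eq0 => /orP[/eqP[]/eqP|].
  by rewrite oner_eq0.
rewrite subr_eq0 => /eqP G; rewrite /cmean /tmean; congr (_ * _).
by move: G; rewrite /h !lnK // => ->.
Qed.

Lemma disc_bounded F r : (forall z, ccont F z) ->
  exists2 M : R, 0 < M & forall z, cabs z <= r -> cabs (F z) <= M.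
Proof.
move=> cF; pose f (x : R * R) : R := cabs (F (Complex x.1 x.2)).
have cf : continuous f.
  move=> x; apply/cvgrPdist_lt => e e0.
  have [del del0 H] := cF (Complex x.1 x.2) e e0.
  have de2 : 0 < del / 2 by rewrite divr_gt0.
  apply/(@nbhs_ballP _ (R * R)%type); exists (del / 2) => //= y [/= h1 h2].
  rewrite /f; have : cabs (F (Complex y.1 y.2) - F (Complex x.1 x.2)) < e.
    apply: H; apply: le_lt_trans (cabs_le_ReIm _) _ => /=.
    rewrite [del]splitr; apply: ltrD; rewrite distrC //.
  apply: le_lt_trans; rewrite ler_norml; apply/andP; split.
    by rewrite lerNl opprB cabsBl.
  by rewrite cabsB cabsBl.
have cK : compact (`[- r, r]%classic `*` `[- r, r]%classic : set (R * R)).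
  by apply: compact_setX; exact: segment_compact.
have [r0|r0] := ltP r 0.
  by exists 1 => // z zr; have := cabs_ge0 z; lra.
have [|x _ Hx] := compact_EVT_max _ cK (continuous_subspaceT cf).
  by exists (0, 0); split; rewrite /= in_itv /= r0 oppr_le0 r0.
exists (1 + f x); first by rewrite ltr_wpDr // cabs_ge0.
move=> z zr; have := Hx (Re z, Im z).
have -> : f (Re z, Im z) = cabs (F z) by rewrite /f; case: (z).
move=> h; apply: le_trans (h _) _; last by rewrite lerDr.
by rewrite inE; split; rewrite /= in_itv /= -ler_norml (le_trans _ zr) //;
  [exact: Re_le_cabs|exact: Im_le_cabs].
Qed.

Lemma circle_pointB r s t : cabs (circle_point r t - circle_point s t : C) = `|r - s|.
Proof.
rewrite -(cabs_circle_point (r - s) t); congr cabs.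
by apply/eqP; rewrite eq_complex /= !mulrBl !eqxx.
Qed.

Lemma cmean_cont F r0 : (forall z, ccont F z) -> forall e, 0 < e ->
  exists2 del : R, 0 < del & forall r, `|r - r0| < del ->
    cabs (cmean F r - cmean F r0) < e.
Proof.
move=> cF.
have [M M0 HM] := disc_bounded (`|r0| + 1) cF.
have HM' x y : x \in `]r0 - 1, r0 + 1[ -> cabs (F (circle_point x y)) <= M.
  rewrite in_itv /= => /andP[x1 x2]; apply: HM; rewrite cabs_circle_point.
  have -> : x = r0 + (x - r0) by rewrite subrKC.
  by apply: le_trans (ler_normD _ _) _; rewrite lerD2l ler_norml; apply/andP; split; lra.
have key (P : C -> R) : (forall z, `|P z| <= cabs z) -> (forall z w, P (z - w) = P z - P w) ->
   {for r0, continuous (fun r => rint 0 (2 * pi) (fun t => P (F (circle_point r t))))}.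
  move=> HP PB.
  have cP g : tcont g -> continuous (fun t => P (g t)).
    move=> cg t; apply/cvgrPdist_lt => e e0; have [del del0 Hd] := cg t e e0.
    apply/(@nbhs_ballP _ R); exists del => //= s.
    rewrite /ball /= distrC => /Hd; rewrite cabsB; apply: le_lt_trans.
    by rewrite -PB HP.
  apply: (@continuity_under_integral R _ _ (@lebesgue_measure R)
    (fun r t => P (F (circle_point r t))) `[0, 2 * pi] _ (r0 - 1) (r0 + 1) _ _ (fun=> M)) => //.
  - move=> x _; apply: rint_integrable; apply: cP.
    by apply: tcont_comp => //; exact: tcont_circle.
  - apply: aeW => y _ x _; apply/cvgrPdist_lt => e e0.
    have [del del0 Hd] := cF (circle_point x y) e e0.
    apply/(@nbhs_ballP _ R); exists del => //= x'.
    rewrite /ball /= distrC -(circle_pointB _ _ y) => /Hd; apply: le_lt_trans.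
    by rewrite distrC -PB HP.
  - by apply: rint_integrable => ?; exact: cvg_cst.
  - move=> x xI; apply: aeW => y _; apply: le_trans (HP _) _.
    by apply: HM'; exact: xI.
  - by rewrite inE /= in_itv /=; apply/andP; split; lra.
have cRe := key (fun z => Re z) (@Re_le_cabs R) (fun z w => raddfB _ z w).
have cIm := key (fun z => Im z) (@Im_le_cabs R) (fun z w => raddfB _ z w).
move=> e e0; have e2 : 0 < e * pi by rewrite mulr_gt0 // pi_gt0.
move/cvgrPdist_lt: cRe => /(_ _ e2)/(@nbhs_ballP _ R)[d1 /= d10 H1].
move/cvgrPdist_lt: cIm => /(_ _ e2)/(@nbhs_ballP _ R)[d2 /= d20 H2].
exists (Num.min d1 d2); first by rewrite lt_min d10.
move=> r; rewrite lt_min distrC => /andP[/H1 h1 /H2 h2].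
rewrite /cmean /tmean -mulrBr cabsM cabs_real ger0_norm; last first.
  by rewrite invr_ge0 ltW // twopi_gt0.
rewrite ltr_pdivrMl ?twopi_gt0 // cabsB.
apply: le_lt_trans (cabs_le_ReIm _) _ => /=.
have -> : 2 * pi * e = e * pi + e * pi by ring.
exact: ltrD.
Qed.

End CircleMean.

Section Cauchy.
Variable R : realType.
Notation C := (R[i]^o).
Implicit Types (F f : C -> C) (g : R -> C) (z w d k : C).
Implicit Types (r s t x e M : R).

Lemma geometric_small (q A e : R) : 0 <= q < 1 -> 0 < e ->
  exists D, A * q ^+ D < e.
Proof.
move=> /andP[q0 q1] e0; have A0 : 0 < 1 + `|A| by rewrite ltr_wpDr.
have : (fun n => q ^+ n) @ \oo --> (0 : R).
  by apply: cvg_expr; rewrite ger0_norm.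
have e1 : 0 < e / (1 + `|A|) by rewrite divr_gt0.
move=> /cvgrPdist_lt/(_ _ e1)[D _ /(_ D (leqnn D))] /=.
rewrite sub0r normrN ger0_norm ?exprn_ge0 // ltr_pdivlMr // => h.
exists D; apply: le_lt_trans h; rewrite mulrC ler_wpM2l ?exprn_ge0 //.
by apply: le_trans (ler_norm _) _; rewrite lerDr.
Qed.

Lemma le0_eps (x : R) : (forall e, 0 < e -> x < e) -> x <= 0.
Proof. by move=> H; rewrite leNgt; apply/negP => /H; rewrite ltxx. Qed.

Lemma cabs_eq_eps (z w : C) : (forall e, 0 < e -> cabs (z - w) < e) -> z = w.
Proof.
move=> H; apply/eqP; rewrite -subr_eq0 -cabs_eq0; apply/eqP/le_anti.
by rewrite cabs_ge0 andbT; apply: le0_eps.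
Qed.

Lemma cmean0 F : cmean F 0 = F 0.
Proof.
rewrite -[RHS](tmean_cst (F 0)); congr tmean; apply: funext => t.
by rewrite /circle_point !mul0r.
Qed.

(** The mean over circles centred at [0] is a continuous function of the
    radius which is constant on each side of the radius of the exceptional
    point, so a single point of mere continuity does not affect it. *)
Lemma mean_value F w : (forall z, ccont F z) ->
  (forall z, z != w -> exists d, hasder F z d) ->
  forall r, 0 <= r -> cmean F r = F 0.
Proof.
move=> cF dF.
have cst r1 r2 : 0 < r1 -> r1 < r2 -> ~~ (r1 <= cabs w <= r2) ->
    cmean F r1 = cmean F r2.
  move=> r10 r12 nw; apply: cmean_const => // z hz; apply: dF.
  by apply: contra nw => /eqP <-.
have lt_w r : 0 < r -> r < cabs w -> cmean F r = F 0.
  move=> r0 rw; rewrite -cmean0; apply: cabs_eq_eps => e e0.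
  have [del del0 Hd] := cmean_cont 0 cF e0.
  pose r1 := Num.min del r / 2.
  have m0 : 0 < Num.min del r by rewrite lt_min del0.
  have m1 : Num.min del r <= del by rewrite ge_min lexx.
  have m2 : Num.min del r <= r by rewrite ge_min lexx orbT.
  have r10 : 0 < r1 by rewrite divr_gt0.
  rewrite -(cst r1 r) //; first by apply: Hd; rewrite subr0 gtr0_norm // /r1; lra.
    by rewrite /r1; lra.
  by rewrite negb_and -!ltNge rw orbT.
have eq_w : cmean F (cabs w) = F 0.
  have [->|w0] := eqVneq w 0; first by rewrite cabs0 cmean0.
  have {}w0 : 0 < cabs w by rewrite cabs_gt0.
  apply: cabs_eq_eps => e e0; have [del del0 Hd] := cmean_cont (cabs w) cF e0.
  pose m := Num.min del (cabs w).
  have m0 : 0 < m by rewrite lt_min del0.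
  have m1 : m <= del by rewrite ge_min lexx.
  have m2 : m <= cabs w by rewrite ge_min lexx orbT.
  rewrite -(lt_w (cabs w - m / 2)); [|lra|lra].
  by rewrite cabsB; apply: Hd; rewrite addrAC subrr add0r normrN gtr0_norm; lra.
move=> r; rewrite le_eqVlt => /orP[/eqP <-|r0]; first exact: cmean0.
have [|wr] := ltP r (cabs w); first exact: lt_w.
move: wr; rewrite le_eqVlt => /orP[/eqP <- //|wr].
rewrite -eq_w; apply: cabs_eq_eps => e e0.
have [del del0 Hd] := cmean_cont (cabs w) cF e0.
pose m := Num.min del (r - cabs w).
have m0 : 0 < m by rewrite lt_min del0 subr_gt0.
have m1 : m <= del by rewrite ge_min lexx.
have m2 : m <= r - cabs w by rewrite ge_min lexx orbT.
have w0 := cabs_ge0 w.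
rewrite -(cst (cabs w + m / 2) r).
- by apply: Hd; rewrite addrAC subrr add0r gtr0_norm; lra.
- lra.
- lra.
- by rewrite negb_and -!ltNge; apply/orP; left; lra.
Qed.

Lemma tcontV g : tcont g -> (forall t, g t != 0) -> tcont (fun t => (g t)^-1).
Proof.
move=> cg g0; apply: (tcont_comp (F := fun z => z^-1)) => // t.
exact: hasder_ccont (hasderV (g0 t) (hasder_id _)).
Qed.

Lemma tcontX g n : tcont g -> tcont (fun t => g t ^+ n).
Proof.
move=> cg; elim: n => [|n IH].
  by under eq_fun do rewrite expr0; exact: tcont_cst.
by under eq_fun do rewrite exprS; exact: tcontM.
Qed.

Lemma tcont_sum (I : Type) (l : seq I) (g : I -> R -> C) :
  (forall i, tcont (g i)) -> tcont (fun t => \sum_(i <- l) g i t).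
Proof.
move=> cg; elim: l => [|i l IH].
  by under eq_fun do rewrite big_nil; exact: tcont_cst.
by under eq_fun do rewrite big_cons; exact: tcontD.
Qed.

Lemma tmean_sum (I : Type) (l : seq I) (g : I -> R -> C) :
  (forall i, tcont (g i)) ->
  tmean (fun t => \sum_(i <- l) g i t) = \sum_(i <- l) tmean (g i).
Proof.
move=> cg; elim: l => [|i l IH].
  by under eq_fun do rewrite big_nil; rewrite tmean_cst big_nil.
under eq_fun do rewrite big_cons.
by rewrite tmeanD ?big_cons ?IH //; exact: tcont_sum.
Qed.

Lemma conjcM z w : conjc (z * w) = (conjc z : C) * conjc w.
Proof.
case: z => a b; case: w => x y; apply/eqP; rewrite eq_complex /=.
by apply/andP; split; apply/eqP; ring.
Qed.

Lemma conjcX z n : conjc (z ^+ n) = (conjc z : C) ^+ n.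
Proof. by elim: n => [|n IH]; rewrite ?expr0 ?conjc1 // !exprS conjcM IH. Qed.

Lemma tmean_conj g : tcont g ->
  tmean (fun t => (conjc (g t) : C)) = conjc (tmean g).
Proof.
move=> /tcontP[c1 c2]; rewrite /tmean /cint.
have -> : (fun t => Re (conjc (g t))) = (fun t => Re (g t)).
  by apply: funext => t; case: (g t).
have -> : (fun t => Im (conjc (g t))) = (fun t => - 1 * Im (g t)).
  by apply: funext => t; case: (g t) => a b /=; rewrite mulN1r.
rewrite rintZ //; apply/eqP; rewrite eq_complex /=.
by apply/andP; split; apply/eqP; ring.
Qed.

Lemma tcont_conj g : tcont g -> tcont (fun t => (conjc (g t) : C)).
Proof.
move=> cg t e e0; have [del del0 Hd] := cg t e e0; exists del => // s /Hd.
by rewrite -raddfB cabs_conj.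
Qed.

Section Circle.
Variable r : R.
Hypothesis r_gt0 : 0 < r.
Let tz t : C := circle_point r t.

Let ctz : tcont tz. Proof. exact: tcont_circle. Qed.

Lemma circle_neq w t : cabs w < r -> circle_point r t - w != 0 :> C.
Proof.
move=> wr; rewrite subr_eq0; apply/eqP => zw; move: wr.
by rewrite -zw cabs_circle_point gtr0_norm // ltxx.
Qed.

Lemma circle_neq0 t : circle_point r t != 0 :> C.
Proof. by rewrite -[X in X != 0]subr0 circle_neq // cabs0. Qed.

Lemma cabs_circle_sub w t : cabs w < r ->
  cabs (circle_point r t - w)^-1 <= (r - cabs w)^-1.
Proof.
move=> wr; rewrite cabsV lef_pV2 ?posrE ?subr_gt0 ?cabs_gt0 ?circle_neq //.
by apply: le_trans (cabsBl _ _); rewrite cabs_circle_point gtr0_norm.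
Qed.

Lemma tcont_kernel w : cabs w < r -> tcont (fun t => tz t / (tz t - w)).
Proof.
move=> wr; apply: tcontM => //; apply: tcontV => [|t]; last exact: circle_neq.
by apply: tcontB => //; exact: tcont_cst.
Qed.

Lemma tcont_Vcircle n : tcont (fun t => (tz t ^+ n)^-1).
Proof.
by apply: tcontV => [|t]; [exact: tcontX|rewrite expf_neq0 // circle_neq0].
Qed.

Lemma tmean_circleX n : tmean (fun t => tz t ^+ n) = (n == 0%N)%:R.
Proof.
have := @mean_value (fun z => z ^+ n) 0 _ _ r (ltW r_gt0).
rewrite /cmean => -> => [|z|z _].
- by rewrite expr0n; case: n.
- exact: hasder_ccont (hasderX _ _).
- by eexists; exact: hasderX.
Qed.

Lemma circle_conj t : (conjc (tz t) : C) = (r ^+ 2)%:C%C / tz t.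
Proof.
apply: (mulfI (circle_neq0 t)); rewrite mulc_conj cabs_circle_point real_normK ?num_real //.
by rewrite mulrCA mulfV ?mulr1 // circle_neq0.
Qed.

Lemma tmean_Vcircle n : tmean (fun t => (tz t ^+ n)^-1) = (n == 0%N)%:R.
Proof.
have -> : (fun t => (tz t ^+ n)^-1) = (fun t => ((r ^+ 2)%:C%C ^+ n)^-1 * (conjc (tz t ^+ n) : C)).
  apply: funext => t; rewrite conjcX circle_conj expr_div_n mulKf //.
  by rewrite expf_neq0 // (inj_eq (@complexI R) _ 0) expf_neq0 // gt_eqF.
rewrite tmeanZ; last by apply: tcont_conj; exact: tcontX.
rewrite tmean_conj; last exact: tcontX.
rewrite tmean_circleX conjc_nat; case: n => [|n] /=; last by rewrite mulr0.
by rewrite expr0 invr1 mul1r.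
Qed.

Lemma kernel_expand w D t : cabs w < r -> tz t / (tz t - w) =
  \sum_(i < D) w ^+ i * (tz t ^+ i)^-1 + w ^+ D * (tz t ^+ D)^-1 * (tz t / (tz t - w)).
Proof.
move=> wr; elim: D => [|D IH]; first by rewrite big_ord0 !expr0 invr1 !mul1r add0r.
rewrite {1}IH big_ord_recr /= -addrA; congr (_ + _).
have h1 := circle_neq t wr; have h2 := circle_neq0 t.
rewrite -/(tz t) in h1 h2; rewrite !exprSr; field.
by rewrite h1 h2 expf_neq0.
Qed.

Lemma tmean_kernel_expand (u : R -> C) w D : cabs w < r -> tcont u ->
  tmean (fun t => u t * (tz t / (tz t - w))) =
  \sum_(i < D) w ^+ i * tmean (fun t => u t * (tz t ^+ i)^-1) +
  w ^+ D * tmean (fun t => u t * (tz t ^+ D)^-1 * (tz t / (tz t - w))).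
Proof.
move=> wr cu.
have c1 i : tcont (fun t => u t * (tz t ^+ i)^-1).
  by apply: tcontM => //; exact: tcont_Vcircle.
have c2 : tcont (fun t => u t * (tz t ^+ D)^-1 * (tz t / (tz t - w))).
  by apply: tcontM => //; exact: tcont_kernel.
under eq_bigr do rewrite -tmeanZ //.
rewrite -tmeanZ // -tmean_sum => [|i]; last exact: tcontZ.
rewrite -tmeanD; [|by apply: tcont_sum => i; exact: tcontZ|exact: tcontZ].
congr tmean; apply: funext => t; rewrite {1}(kernel_expand D t wr) mulrDr mulr_sumr.
by congr (_ + _); [apply: eq_bigr => i _|]; ring.
Qed.

Lemma tmean_kernel_rem (u : R -> C) w D M : cabs w < r -> tcont u ->
  (forall t, cabs (u t) <= M) ->
  cabs (w ^+ D * tmean (fun t => u t * (tz t ^+ D)^-1 * (tz t / (tz t - w)))) <=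
  2 * M * r / (r - cabs w) * (cabs w / r) ^+ D.
Proof.
move=> wr cu H.
have c2 : tcont (fun t => u t * (tz t ^+ D)^-1 * (tz t / (tz t - w))).
  apply: tcontM; last exact: tcont_kernel.
  by apply: tcontM => //; exact: tcont_Vcircle.
have M0 : 0 <= M by apply: le_trans (H 0); exact: cabs_ge0.
have B t : cabs (u t * (tz t ^+ D)^-1 * (tz t / (tz t - w))) <=
    M * (r ^+ D)^-1 * (r / (r - cabs w)).
  have tzr : cabs (tz t) = r by rewrite cabs_circle_point gtr0_norm.
  have h := cabs_circle_sub t wr.
  rewrite !cabsM (cabsV (tz t ^+ D)) cabsX tzr.
  apply: ler_pM; rewrite ?mulr_ge0 ?cabs_ge0 ?invr_ge0 ?exprn_ge0 ?(ltW r_gt0) //.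
    by rewrite ler_wpM2r ?invr_ge0 ?exprn_ge0 ?(ltW r_gt0).
  by rewrite ler_wpM2l // ltW.
rewrite cabsM cabsX; apply: le_trans (ler_wpM2l _ (cabs_tmean c2 B)) _.
  by rewrite exprn_ge0 // cabs_ge0.
by rewrite expr_div_n le_eqVlt; apply/orP; left; apply/eqP; ring.
Qed.

Lemma tmean_Vkernel n w : cabs w < r ->
  tmean (fun t => (tz t ^+ n)^-1 * (tz t / (tz t - w))) = (n == 0%N)%:R.
Proof.
move=> wr; apply: cabs_eq_eps => e e0.
have q1 : 0 <= cabs w / r < 1.
  by rewrite divr_ge0 ?cabs_ge0 ?(ltW r_gt0) //= ltr_pdivrMr // mul1r.
have [D HD] := geometric_small (2 * (r ^- n) * r / (r - cabs w)) q1 e0.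
have cu := tcont_Vcircle n.
rewrite (@tmean_kernel_expand _ _ D.+1 wr cu).
have -> : \sum_(i < D.+1) w ^+ i * tmean (fun t => (tz t ^+ n)^-1 * (tz t ^+ i)^-1) = (n == 0%N)%:R.
  have E (i : nat) : tmean (fun t => (tz t ^+ n)^-1 * (tz t ^+ i)^-1) = (n + i == 0)%N%:R.
    by rewrite -tmean_Vcircle; congr tmean; apply: funext => t; rewrite exprD invfM.
  rewrite big_ord_recl E addn0 expr0 mul1r big1 ?addr0 // => i _.
  by rewrite E addnS mulr0.
rewrite addrAC subrr add0r; apply: le_lt_trans HD.
have Mt t : cabs ((tz t ^+ n)^-1) <= r ^- n.
  by rewrite cabsV cabsX cabs_circle_point gtr0_norm.
apply: le_trans (tmean_kernel_rem D.+1 wr cu Mt) _.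
have /andP[q0 q1'] := q1.
rewrite exprS ler_wpM2l //; last by rewrite ler_piMl ?exprn_ge0 // ltW.
by rewrite !divr_ge0 ?mulr_ge0 ?invr_ge0 ?exprn_ge0 ?(ltW r_gt0) // subr_ge0 ltW.
Qed.

Theorem cauchy_formula f w : entire f -> cabs w < r ->
  tmean (fun t => f (tz t) * (tz t / (tz t - w))) = f w.
Proof.
move=> ef wr; have df := (entireP f).1 ef.
pose F z : C := if z == w then w * derive1 f w else z * ((f z - f w) / (z - w)).
have FE z : z != w -> F z = z * ((f z - f w) / (z - w)) by rewrite /F => /negPf ->.
have dF z : z != w -> exists d, hasder F z d.
  move=> zw; have zw0 : z - w != 0 by rewrite subr_eq0.
  have h1 := hasderB (df z) (hasder_cst (f w) z).
  have h2 := hasderV (F := fun u : C => u - w) zw0 (hasderB (hasder_id z) (hasder_cst w z)).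
  have h3 := hasderM (hasder_id z) (hasderM h1 h2).
  have zw1 : 0 < cabs (z - w) by rewrite cabs_gt0.
  eexists; apply: (hasder_near zw1 _ h3) => u xz.
  rewrite FE //; apply/eqP => xw; move: xz; rewrite xw cabsB ltxx //.
have cF z : ccont F z.
  have [->|/dF[d]] := eqVneq z w; last exact: hasder_ccont.
  move=> e e0; have w1 : 0 < cabs w + 1 by rewrite ltr_wpDl ?cabs_ge0.
  have e1 : 0 < e / 2 / (cabs w + 1) by rewrite !divr_gt0.
  have [d1 d10 H1] := df w _ e1.
  have [d2 d20 H2] : exists2 d2 : R, 0 < d2 & d2 * (1 + cabs (derive1 f w)) <= e / 2.
    exists (e / 2 / (1 + cabs (derive1 f w))).
      by rewrite !divr_gt0 // ltr_wpDr ?cabs_ge0.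
    by rewrite divfK // gt_eqF // ltr_wpDr ?cabs_ge0.
  exists (Num.min (Num.min d1 d2) 1); first by rewrite !lt_min d10 d20 ltr01.
  move=> x; rewrite !lt_min => /andP[/andP[x1 x2] x3].
  have [->|xw] := eqVneq x w; first by rewrite subrr cabs0.
  rewrite FE // /F eqxx.
  have x0 : 0 < cabs (x - w) by rewrite cabs_gt0 subr_eq0.
  have := H1 _ x1; rewrite subrKC -ler_pdivrMr // -cabsV -cabsM => {}H1.
  have -> : x * ((f x - f w) / (x - w)) - w * derive1 f w =
    x * ((f x - f w - derive1 f w * (x - w)) / (x - w)) + (x - w) * derive1 f w.
    by field; rewrite subr_eq0.
  apply: le_lt_trans (cabsD _ _) _; rewrite [e]splitr [X in X + _]cabsM [X in _ + X]cabsM.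
  apply: ler_ltD.
    have xw1 : cabs x <= cabs w + 1.
      by have := cabsBl x w; lra.
    apply: le_trans (ler_pM _ _ xw1 H1) _; rewrite ?cabs_ge0 //.
    by rewrite mulrC divfK // gt_eqF.
  apply: lt_le_trans H2; have d0 := cabs_ge0 (derive1 f w).
  have := ler_wpM2r d0 (ltW x2).
  have -> : d2 * (1 + cabs (derive1 f w)) = d2 + d2 * cabs (derive1 f w) by ring.
  lra.
have := mean_value cF dF (ltW r_gt0).
have -> : F 0 = 0.
  by rewrite /F; case: eqP => [<-|_]; rewrite mul0r.
have cK := tcont_kernel wr.
have cfz : tcont (fun t => f (tz t)).
  by apply: tcont_comp => // t; exact: entire_ccont.
have -> : cmean F r = tmean (fun t => f (tz t) * (tz t / (tz t - w))) - f w.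
  have K1 := tmean_Vkernel 0 wr.
  rewrite -[X in _ - X]mulr1 -[X in _ - _ * X]K1 -tmeanZ; last first.
    by under eq_fun do rewrite expr0 invr1 mul1r.
  rewrite -tmeanB; last first.
  - by apply: tcontZ; under eq_fun do rewrite expr0 invr1 mul1r.
  - exact: tcontM.
  congr tmean; apply: funext => t; rewrite FE -/(tz t); last first.
    by rewrite -subr_eq0 circle_neq.
  by rewrite expr0 invr1 mul1r; ring.
by move/eqP; rewrite subr_eq0 => /eqP.
Qed.

Lemma cauchy_bound f w M : entire f -> cabs w < r ->
  (forall z, cabs z = r -> cabs (f z) <= M) ->
  cabs (f w) <= 2 * M * r / (r - cabs w).
Proof.
move=> ef wr H; rewrite -(cauchy_formula ef wr).
have cfz : tcont (fun t => f (tz t)).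
  by apply: tcont_comp => // t; exact: entire_ccont.
have Ht t : cabs (f (tz t)) <= M by apply: H; rewrite cabs_circle_point gtr0_norm.
have := tmean_kernel_rem 0 wr cfz Ht.
rewrite !expr0 mul1r mulr1; congr (cabs (tmean _) <= _).
by apply: funext => t; rewrite expr0 invr1 mulr1.
Qed.

Definition taylor_coef f n : C := tmean (fun t => f (tz t) * (tz t ^+ n)^-1).

Lemma taylor_remainder f w M D : entire f -> cabs w < r ->
  (forall z, cabs z = r -> cabs (f z) <= M) ->
  cabs (f w - \sum_(i < D) taylor_coef f i * w ^+ i) <=
  2 * M * r / (r - cabs w) * (cabs w / r) ^+ D.
Proof.
move=> ef wr H; rewrite -(cauchy_formula ef wr).
have cfz : tcont (fun t => f (tz t)).
  by apply: tcont_comp => // t; exact: entire_ccont.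
have Ht t : cabs (f (tz t)) <= M by apply: H; rewrite cabs_circle_point gtr0_norm.
rewrite (tmean_kernel_expand D wr cfz).
have -> : \sum_(i < D) w ^+ i * tmean (fun t => f (tz t) * (tz t ^+ i)^-1) =
   \sum_(i < D) taylor_coef f i * w ^+ i.
  by apply: eq_bigr => i _; rewrite mulrC.
by rewrite addrAC subrr add0r; exact: tmean_kernel_rem.
Qed.

End Circle.
End Cauchy.

Section EntireFunctions.
Variable R : realType.
Notation C := (R[i]^o).
Implicit Types (F f : C -> C) (g : R -> C) (z w d k h : C).
Implicit Types (r s t x e M : R).

Section CircleIntegral.
Variable r : R.
Hypothesis r_gt0 : 0 < r.
Let tz t : C := circle_point r t.
Let ctz : tcont tz. Proof. exact: tcont_circle. Qed.
Variable u : R -> C.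
Hypothesis cu : tcont u.
Variable M : R.
Hypothesis uM : forall t, cabs (u t) <= M.

Let Phi n w := tmean (fun t => u t * ((tz t - w)^-1) ^+ n).

Let tcont_inv w : cabs w < r -> tcont (fun t => (tz t - w)^-1).
Proof.
move=> wr; apply: tcontV => [|t]; last exact: circle_neq.
by apply: tcontB => //; exact: tcont_cst.
Qed.

Let cPhi n w : cabs w < r -> tcont (fun t => u t * ((tz t - w)^-1) ^+ n).
Proof. by move=> wr; apply: tcontM => //; apply: tcontX; exact: tcont_inv. Qed.

Let M_ge0 : 0 <= M.
Proof. by apply: le_trans (uM 0); exact: cabs_ge0. Qed.

Let hasder_quadratic F w d (rho B : R) : 0 < rho -> 0 <= B ->
  (forall h, cabs h < rho -> cabs (F (w + h) - F w - d * h) <= B * cabs h ^+ 2) ->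
  hasder F w d.
Proof.
move=> rho0 B0 H e e0; have B1 : 0 < 1 + B by rewrite ltr_wpDr.
exists (Num.min rho (e / (1 + B))); first by rewrite lt_min rho0 divr_gt0.
move=> h; rewrite lt_min => /andP[h1 h2]; apply: le_trans (H h h1) _.
rewrite expr2 mulrA ler_wpM2r ?cabs_ge0 //.
move: h2; rewrite ltr_pdivlMr // => h2; apply: le_trans (ltW h2).
by rewrite mulrC ler_wpM2l ?cabs_ge0 // lerDr.
Qed.

Let inv_bound w h : cabs w < r -> cabs h < (r - cabs w) / 2 ->
  forall t, cabs (tz t - w - h)^-1 <= ((r - cabs w) / 2)^-1.
Proof.
move=> wr hw t; have hwr : cabs (w + h) < r by have := cabsD w h; lra.
rewrite -addrA -opprD; apply: le_trans (cabs_circle_sub r_gt0 t hwr) _.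
by rewrite lef_pV2 ?posrE; [|lra|lra]; have := cabsD w h; lra.
Qed.

Lemma hasder_circle1 w : cabs w < r -> hasder (Phi 1) w (Phi 2 w).
Proof.
move=> wr; pose rho := (r - cabs w) / 2.
have rho0 : 0 < rho by rewrite divr_gt0 // subr_gt0.
apply: (@hasder_quadratic _ _ _ rho (2 * (M * rho^-1 ^+ 3)) rho0).
  by rewrite ?mulr_ge0 ?exprn_ge0 ?invr_ge0 ?(ltW rho0).
move=> h hr; have hwr : cabs (w + h) < r by have := cabsD w h; rewrite /rho in hr; lra.
have b1 := inv_bound wr hr.
have z0 : cabs (0 : C) < rho by rewrite cabs0.
have b0 t : cabs (tz t - w)^-1 <= rho^-1 by have := inv_bound wr z0 t; rewrite subr0.
have -> : Phi 1 (w + h) - Phi 1 w - Phi 2 w * h =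
   h ^+ 2 * tmean (fun t => u t * ((tz t - w)^-1 ^+ 2 * (tz t - w - h)^-1)).
  have c3 : tcont (fun t => u t * ((tz t - w)^-1 ^+ 2 * (tz t - w - h)^-1)).
    apply: tcontM => //; apply: tcontM; first by apply: tcontX; exact: tcont_inv.
    by under eq_fun do rewrite -addrA -opprD; exact: tcont_inv.
  rewrite [Phi 2 w * h]mulrC /Phi -!tmeanZ -?tmeanB //; do ?[exact: cPhi|apply: tcontB|apply: tcontZ].
  congr tmean; apply: funext => t.
  have n1 := circle_neq r_gt0 t wr; have n2 := circle_neq r_gt0 t hwr.
  rewrite -/(tz t) in n1 n2; rewrite !expr1 opprD addrA in n2 *.
  by field; rewrite n1 n2.
rewrite cabsM cabsX mulrC ler_wpM2r ?exprn_ge0 ?cabs_ge0 //.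
apply: cabs_tmean => [|t].
  apply: tcontM => //; apply: tcontM; first by apply: tcontX; exact: tcont_inv.
  by under eq_fun do rewrite -addrA -opprD; exact: tcont_inv.
rewrite cabsM [cabs (_ / _)]cabsM [cabs (_ ^+ 2)]cabsX [rho^-1 ^+ 3]exprSr; have {}b0 := b0 t; have {}b1 := b1 t.
have rho1 : 0 <= rho^-1 by rewrite invr_ge0 ltW.
apply: ler_pM; [exact: cabs_ge0|by apply: mulr_ge0; [exact: exprn_ge0 (cabs_ge0 _)|exact: cabs_ge0]|by []|].
apply: ler_pM; [exact: exprn_ge0 (cabs_ge0 _)|exact: cabs_ge0| |by []].
by apply: lerXn2r; rewrite ?nnegrE ?cabs_ge0.
Qed.

Lemma hasder_circle2 w : cabs w < r -> exists d, hasder (Phi 2) w d.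
Proof.
move=> wr; pose rho := (r - cabs w) / 2.
have rho0 : 0 < rho by rewrite divr_gt0 // subr_gt0.
exists (2 * Phi 3 w).
apply: (@hasder_quadratic _ _ _ rho (2 * (M * (5 * rho^-1 ^+ 4))) rho0).
  by rewrite ?mulr_ge0 ?exprn_ge0 ?invr_ge0 ?(ltW rho0).
move=> h hr; have hwr : cabs (w + h) < r by have := cabsD w h; rewrite /rho in hr; lra.
have b1 := inv_bound wr hr.
have z0 : cabs (0 : C) < rho by rewrite cabs0.
have b0 t : cabs (tz t - w)^-1 <= rho^-1 by have := inv_bound wr z0 t; rewrite subr0.
pose Q t : C := (3 - 2 * h * (tz t - w)^-1) * ((tz t - w)^-1 * (tz t - w - h)^-1) ^+ 2.
have cQ : tcont Q.
  apply: tcontM.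
    by apply: tcontB; [exact: tcont_cst|apply: tcontZ; exact: tcont_inv].
  apply: tcontX; apply: tcontM; first exact: tcont_inv.
  by under eq_fun do rewrite -addrA -opprD; exact: tcont_inv.
have cuQ : tcont (fun t => u t * Q t) by exact: tcontM.
have -> : Phi 2 (w + h) - Phi 2 w - 2 * Phi 3 w * h = h ^+ 2 * tmean (fun t => u t * Q t).
  rewrite [2 * Phi 3 w * h]mulrAC /Phi -!tmeanZ -?tmeanB //; do ?[exact: cPhi|apply: tcontB|apply: tcontZ].
  congr tmean; apply: funext => t; rewrite /Q.
  have n1 := circle_neq r_gt0 t wr; have n2 := circle_neq r_gt0 t hwr.
  rewrite -/(tz t) in n1 n2; rewrite opprD addrA in n2 *.
  by field; rewrite n1 n2.
rewrite cabsM cabsX mulrC ler_wpM2r ?exprn_ge0 ?cabs_ge0 //.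
apply: cabs_tmean => // t.
have {}b0 := b0 t; have {}b1 := b1 t; rewrite -/rho in b1.
rewrite cabsM; apply: ler_pM; rewrite ?cabs_ge0 //.
rewrite /Q cabsM cabsX (cabsM _ (tz t - w - h)^-1).
have rho1 : 0 <= rho^-1 by rewrite invr_ge0 ltW.
apply: ler_pM; [exact: cabs_ge0|by apply: exprn_ge0; apply: mulr_ge0; exact: cabs_ge0| |].
  apply: le_trans (cabsD _ _) _; rewrite cabsN !cabsM.
  have -> : cabs (3 : C) = 3 by rewrite -[3 : C](rmorph_nat (real_complex R) 3) cabs_real normr_nat.
  have -> : cabs (2 : C) = 2 by rewrite -[2 : C](rmorph_nat (real_complex R) 2) cabs_real normr_nat.
  have : cabs h * cabs (tz t - w)^-1 <= rho * rho^-1.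
    by rewrite ler_pM ?cabs_ge0 // ltW.
  rewrite divff ?gt_eqF //; lra.
rewrite -[4%N]/(2 * 2)%N exprM; apply: lerXn2r; rewrite ?nnegrE ?mulr_ge0 ?cabs_ge0 ?exprn_ge0 ?invr_ge0 ?(ltW rho0) //.
by rewrite expr2 ler_pM ?cabs_ge0.
Qed.

End CircleIntegral.

Lemma tcont_entire f r : entire f -> tcont (fun t => f (circle_point r t)).
Proof.
by move=> ef; apply: tcont_comp; [exact: tcont_circle|move=> t; exact: entire_ccont].
Qed.

Lemma circle_bound f r : entire f ->
  exists2 M : R, 0 < M & forall z, cabs z <= r -> cabs (f z) <= M.
Proof. by move=> ef; apply: disc_bounded; exact: entire_ccont. Qed.

Lemma derive1_circle f r w : entire f -> 0 < r -> cabs w < r -> derive1 f w =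
  tmean (fun t => f (circle_point r t) * circle_point r t *
    ((circle_point r t - w)^-1) ^+ 2).
Proof.
move=> ef r0 wr; have [M M0 HM] := circle_bound r ef.
have cu : tcont (fun t => f (circle_point r t) * circle_point r t).
  by apply: tcontM; [exact: tcont_entire|exact: tcont_circle].
have uM t : cabs (f (circle_point r t) * circle_point r t) <= M * r.
  have tzr : cabs (circle_point r t : C) = r by rewrite cabs_circle_point gtr0_norm.
  by rewrite cabsM tzr ler_wpM2r ?(ltW r0) // HM // tzr.
apply: hasder_derive1.
have w0 : 0 < r - cabs w by rewrite subr_gt0.
apply: (hasder_near w0 _ (hasder_circle1 r0 cu uM wr)) => v vw /=.
rewrite -(@cauchy_formula _ r r0 f v ef); last first.
  by have := cabsBl v w; lra.
by congr tmean; apply: funext => t; rewrite expr1 mulrA.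
Qed.

Theorem entire_derive1 f : entire f -> entire (derive1 f).
Proof.
move=> ef w; pose r := cabs w + 1.
have r0 : 0 < r by rewrite ltr_wpDl ?cabs_ge0.
have wr : cabs w < r by rewrite ltrDl.
have [M M0 HM] := circle_bound r ef.
have cu : tcont (fun t => f (circle_point r t) * circle_point r t).
  by apply: tcontM; [exact: tcont_entire|exact: tcont_circle].
have uM t : cabs (f (circle_point r t) * circle_point r t) <= M * r.
  have tzr : cabs (circle_point r t : C) = r by rewrite cabs_circle_point gtr0_norm.
  by rewrite cabsM tzr ler_wpM2r ?(ltW r0) // HM // tzr.
have [d Hd] := hasder_circle2 r0 cu uM wr.
apply: (@hasder_derivable _ _ _ d); apply: (hasder_near ltr01 _ Hd) => v vw /=.
by rewrite (@derive1_circle f r v) //; have := cabsBl v w; rewrite /r; lra.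
Qed.

Lemma entire_derive1n f n : entire f -> entire (derive1n n f).
Proof.
move=> ef; elim: n => [|n IH]; first by rewrite derive1n0.
by rewrite derive1nS; exact: entire_derive1.
Qed.

Lemma entire_shift f z : entire f -> entire (fun w => f (z + w)).
Proof.
move=> /entireP H w; exact: hasder_derivable (hasder_shift (H (z + w))).
Qed.

Lemma cauchy_estimate1 f z s M : entire f -> 0 < s ->
  (forall w, cabs (w - z) = s -> cabs (f w) <= M) ->
  cabs (derive1 f z) <= 2 * M / s.
Proof.
move=> ef s0 H; have efz := entire_shift (z := z) ef.
have -> : derive1 f z = derive1 (fun w => f (z + w)) 0.
  by rewrite (hasder_derive1 (hasder_shift ((entireP f).1 ef (z + 0)))) addr0.
rewrite (@derive1_circle _ s) ?cabs0 // -mulrA.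
apply: cabs_tmean => [|t].
  apply: tcontM; first by apply: tcontM; [exact: (tcont_entire s efz)|exact: tcont_circle].
  apply: tcontX; apply: tcontV => [|t]; last by rewrite subr0 circle_neq0.
  by apply: tcontB; [exact: tcont_circle|exact: tcont_cst].
have tzs : cabs (circle_point s t : C) = s by rewrite cabs_circle_point gtr0_norm.
rewrite (cabsM _ ((circle_point s t - 0)^-1 ^+ 2)) (cabsM (f _)) cabsX cabsV subr0 tzs -mulrA.
have -> : s * s^-1 ^+ 2 = s^-1 by rewrite expr2 mulVKf // gt_eqF.
by rewrite ler_wpM2r ?invr_ge0 ?(ltW s0) // H // addrAC subrr add0r.
Qed.

Lemma cauchy_estimate f z s M n : entire f -> 0 < s ->
  (forall w, cabs (w - z) <= s -> cabs (f w) <= M) ->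
  cabs (derive1n n f z) <= (2 * n%:R / s) ^+ n * M.
Proof.
move=> ef s0 H; case: n => [|n].
  by rewrite expr0 mul1r; apply: H; rewrite subrr cabs0 ltW.
have n0 : 0 < n.+1%:R :> R by rewrite ltr0n.
have main j : (j <= n.+1)%N -> forall w, cabs (w - z) <= s - j%:R * (s / n.+1%:R) ->
    cabs (derive1n j f w) <= (2 * n.+1%:R / s) ^+ j * M.
  elim: j => [_ w|j IH jn w hw].
    by rewrite mul0r subr0 expr0 mul1r; exact: H.
  have sn : 0 < s / n.+1%:R by rewrite divr_gt0.
  rewrite derive1nS.
  have B v : cabs (v - w) = s / n.+1%:R ->
      cabs (derive1n j f v) <= (2 * n.+1%:R / s) ^+ j * M.
    move=> hv; apply: IH; first exact: ltnW.
    have -> : v - z = (v - w) + (w - z) by rewrite addrA subrK.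
    apply: le_trans (cabsD _ _) _; rewrite hv.
    move: hw; rewrite -[j.+1%:R]natr1 [(_ + 1) * _]mulrDl mul1r.
    by move: (s / _) => q; lra.
  apply: le_trans (cauchy_estimate1 (entire_derive1n ef) sn B) _.
  rewrite le_eqVlt; apply/orP; left; apply/eqP; rewrite exprS; field.
  by rewrite !gt_eqF // ltr0n.
apply: main => //; rewrite subrr cabs0 mulrC divfK ?subrr // gt_eqF //.
Qed.

Lemma taylor_coef_indep f r1 r2 n : entire f -> 0 < r1 -> r1 < r2 ->
  taylor_coef r1 f n = taylor_coef r2 f n.
Proof.
move=> ef r10 r12; have r20 : 0 < r2 by apply: lt_trans r12.
have [M M0 HM] := circle_bound r2 ef.
have HM' z : cabs z = r2 -> cabs (f z) <= M by move=> zr; apply: HM; rewrite zr.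
apply: cabs_eq_eps => e e0.
have q1 : 0 <= r1 / r2 < 1 by rewrite divr_ge0 ?ltW //= ltr_pdivrMr // mul1r.
pose A := 2 * M * r2 / (r2 - r1).
have A0 : 0 <= A by rewrite !mulr_ge0 ?invr_ge0 ?subr_ge0 ?ltW.
have [D HD] := geometric_small (2 * (A * r1 ^- n)) q1 e0.
pose D' := (D + n.+1)%N.
pose S w : C := \sum_(i < D') taylor_coef r2 f i * w ^+ i.
pose tz t : C := circle_point r1 t.
have ctz : tcont tz by exact: tcont_circle.
have cS : tcont (fun t => S (tz t)).
  by apply: tcont_sum => i; apply: tcontZ; exact: tcontX.
have cV := tcont_Vcircle r10 n.
have cf := tcont_entire r1 ef.
have -> : taylor_coef r2 f n = tmean (fun t => S (tz t) * (tz t ^+ n)^-1).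
  have -> : (fun t => S (tz t) * (tz t ^+ n)^-1) =
      (fun t => \sum_(i < D') taylor_coef r2 f i * (tz t ^+ i * (tz t ^+ n)^-1)).
    by apply: funext => t; rewrite mulr_suml; apply: eq_bigr => i _; rewrite mulrA.
  have cin (i : nat) : tcont (fun t => tz t ^+ i * (tz t ^+ n)^-1).
    by apply: tcontM => //; exact: tcontX.
  have nD : (n < D')%N by rewrite /D' ltn_addl.
  rewrite tmean_sum => [|i]; last exact: tcontZ.
  have E (i : nat) : tmean (fun t => tz t ^+ i * (tz t ^+ n)^-1) = (i == n)%:R.
    have [ni|] := leqP n i.
      have -> : (i == n) = (i - n == 0)%N by rewrite subn_eq0 eqn_leq ni andbT.
      rewrite -(tmean_circleX r10 (i - n)); congr tmean; apply: funext => t.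
      by rewrite -{1}(subnK ni) exprD mulfK // expf_neq0 // circle_neq0.
    move=> in'; have -> : (i == n) = (n - i == 0)%N by rewrite subn_eq0 eqn_leq ltnW.
    rewrite -(tmean_Vcircle r10 (n - i)); congr tmean; apply: funext => t.
    rewrite -{1}(subnK (ltnW in')) exprD invfM mulrCA mulfV ?mulr1 //.
    by rewrite expf_neq0 // circle_neq0.
  under eq_bigr do rewrite tmeanZ // E.
  rewrite (bigD1 (Ordinal nD)) //= eqxx mulr1 big1 ?addr0 // => i.
  by rewrite -val_eqE /= => /negPf ->; rewrite mulr0.
rewrite /taylor_coef -tmeanB; [|exact: tcontM|exact: tcontM].
apply: le_lt_trans HD.
rewrite -mulrA; apply: cabs_tmean => [|t].
  by apply: tcontB; apply: tcontM.
rewrite -mulrBl cabsM [X in _ <= X]mulrAC.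
have tzr : cabs (tz t) = r1 by rewrite cabs_circle_point gtr0_norm.
have -> : cabs (circle_point r1 t ^+ n)^-1 = r1 ^- n by rewrite cabsV cabsX tzr.
rewrite ler_wpM2r ?invr_ge0 ?exprn_ge0 ?(ltW r10) //.
have := @taylor_remainder _ r2 r20 f (tz t) M D' ef.
rewrite tzr => /(_ r12 HM') h; apply: le_trans h _.
rewrite -/A ler_wpM2l // /D' exprD ler_piMr ?exprn_ge0 //; first by case/andP: q1.
by case/andP: q1 => ? ?; rewrite exprn_ile1 // ltW.
Qed.

(** The Taylor coefficient by Cauchy's integral over the unit circle; by
    [taylor_coefE] the radius is immaterial. *)
Definition coef f n : C := taylor_coef 1 f n.

Lemma taylor_coefE f r n : entire f -> 0 < r -> taylor_coef r f n = coef f n.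
Proof.
move=> ef r0; have [r1|r1|->//] := ltgtP r 1; first exact: taylor_coef_indep.
by rewrite /coef (@taylor_coef_indep f 1 r).
Qed.

Lemma taylor_approx f r w M D : entire f -> 0 < r -> cabs w < r ->
  (forall z, cabs z = r -> cabs (f z) <= M) ->
  cabs (f w - \sum_(i < D) coef f i * w ^+ i) <=
  2 * M * r / (r - cabs w) * (cabs w / r) ^+ D.
Proof.
move=> ef r0 wr H; under eq_bigr do rewrite -(taylor_coefE _ ef r0).
exact: taylor_remainder.
Qed.

Lemma coef_eq0 f : entire f -> (forall n, coef f n = 0) -> forall z, f z = 0.
Proof.
move=> ef c0 w; apply: cabs_eq_eps => e e0.
pose r := cabs w + 1; have w0 := cabs_ge0 w.
have r0 : 0 < r by rewrite ltr_wpDl.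
have wr : cabs w < r by rewrite ltrDl.
have [M M0 HM] := circle_bound r ef.
have HM' z : cabs z = r -> cabs (f z) <= M by move=> zr; apply: HM; rewrite zr.
have q1 : 0 <= cabs w / r < 1 by rewrite divr_ge0 ?(ltW r0) //= ltr_pdivrMr // mul1r.
have [D HD] := geometric_small (2 * M * r / (r - cabs w)) q1 e0.
apply: le_lt_trans HD; have := taylor_approx D ef r0 wr HM'.
by rewrite big1 // => i _; rewrite c0 mul0r.
Qed.

Theorem liouville f M : entire f -> (forall z, cabs (f z) <= M) ->
  forall z, f z = coef f 0.
Proof.
move=> ef H w; apply: cabs_eq_eps => e e0; have w0 := cabs_ge0 w.
have M0 : 0 <= M by apply: le_trans (H 0); exact: cabs_ge0.
pose r := cabs w + 1 + 2 * M * cabs w / e.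
have x0 : 0 <= 2 * M * cabs w / e by rewrite !mulr_ge0 // invr_ge0 ltW.
have r0 : 0 < r by rewrite /r; lra.
have wr : cabs w < r by rewrite /r; lra.
have := taylor_approx 1 ef r0 wr (fun z _ => H z).
rewrite big_ord_recl big_ord0 addr0 expr0 mulr1 expr1 => h; apply: le_lt_trans h _.
have -> : 2 * M * r / (r - cabs w) * (cabs w / r) = 2 * M * cabs w / (r - cabs w).
  by field; rewrite !gt_eqF // subr_gt0.
rewrite ltr_pdivrMr ?subr_gt0 // -ltr_pdivrMl // mulrC /r; lra.
Qed.

(** An entire function that is not identically zero is, uniformly on discs, a
    limit of polynomials with zeros at the origin of constant order and a
    constant lowest coefficient. Complete factorization of these polynomials
    replaces the theory of zeros of entire functions. *)
Lemma factored_approx f : entire f -> (exists z, f z != 0) ->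
  exists k : nat, exists2 c0 : C, c0 != 0 &
  forall r e, 0 < r -> 0 < e -> exists c : C, exists2 l : seq C,
    c * \prod_(a <- l) (0 - a) = c0 &
    forall w, cabs w <= r -> cabs (f w - w ^+ k * (c * \prod_(a <- l) (w - a))) <= e.
Proof.
move=> ef [z0 fz0].
have [k [ck0 Hk]] : exists k : nat, coef f k != 0 /\ forall i, (i < k)%N -> coef f i = 0.
  have ex : exists k : nat, coef f k != 0.
    apply: contrapT => nex; move: fz0; rewrite coef_eq0 ?eqxx // => n.
    by apply/eqP; apply: contrapT => /negP cn; apply: nex; exists n.
  exists (ex_minn ex); case: ex_minnP => m cm mm; split => // i im.
  by apply/eqP; apply: contraLR im => /mm; rewrite leqNgt.
exists k; exists (coef f k) => // r e r0 e0.
pose r2 := r + 1; have r20 : 0 < r2 by rewrite addr_gt0.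
have [M M0 HM] := circle_bound r2 ef.
have HM' z : cabs z = r2 -> cabs (f z) <= M by move=> zr; apply: HM; rewrite zr.
have q1 : 0 <= r / r2 < 1.
  by rewrite divr_ge0 ?ltW //= ltr_pdivrMr // mul1r ltrDl.
pose A := 2 * M * r2 / (r2 - r).
have rr2 : r2 - r = 1 by rewrite /r2 addrAC subrr add0r.
have A0 : 0 <= A by rewrite !mulr_ge0 ?invr_ge0 ?rr2 ?(ltW M0) ?(ltW r20).
have [D HD] := geometric_small A q1 e0.
pose p : {poly R[i]} := \poly_(i < D.+1) (coef f (i + k)%N : R[i]).
have [l Hl] := @closed_field_poly_normal _ p.
have pE w : p.[w] = lead_coef p * \prod_(a <- l) (w - a).
  by rewrite {1}Hl hornerZ horner_prod; congr (_ * _); apply: eq_bigr => a _;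
    rewrite hornerXsubC.
exists (lead_coef p); exists l.
  rewrite -pE horner_poly big_ord_recl expr0 mulr1 big1 ?addr0 ?add0n // => i _.
  by rewrite expr0n mulr0.
move=> w wr; rewrite -pE horner_poly mulr_sumr.
have -> : \sum_(i < D.+1) w ^+ k * (coef f (i + k)%N * w ^+ i) =
    \sum_(i < D.+1 + k) coef f i * w ^+ i.
  rewrite [in RHS]addnC big_split_ord /= [X in X + _]big1 ?add0r => [|i _]; last first.
    by rewrite Hk ?mul0r.
  by apply: eq_bigr => i _; rewrite exprD [in RHS]addnC mulrCA.
have wr2 : cabs w < r2 by apply: le_lt_trans wr _; rewrite ltrDl.
apply: le_trans (taylor_approx _ ef r20 wr2 HM') _; apply: le_trans _ (ltW HD).
have w0 := cabs_ge0 w.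
apply: ler_pM.
- by rewrite !mulr_ge0 ?invr_ge0 ?subr_ge0 // ltW.
- by rewrite exprn_ge0 // divr_ge0 // ltW.
- rewrite /A ler_wpM2l //; first by rewrite !mulr_ge0 // ltW.
  have h2 : r2 - r <= r2 - cabs w by rewrite lerD2l lerN2.
  have p1 : 0 < r2 - r by rewrite rr2.
  by rewrite lef_pV2 // posrE (lt_le_trans p1).
case/andP: q1 => q0 q1.
have h : cabs w / r2 <= r / r2 by rewrite ler_wpM2r // invr_ge0 ltW.
have h0 : 0 <= cabs w / r2 by rewrite divr_ge0 // ltW.
rewrite addSnnS exprD; apply: le_trans (_ : (cabs w / r2) ^+ D <= _).
  rewrite ler_piMr ?exprn_ge0 // exprn_ile1 //.
  by apply: le_trans h (ltW q1).
by apply: lerXn2r; rewrite ?nnegrE.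
Qed.

End EntireFunctions.

(** * Poisson's formula and Harnack's inequality for zero-free polynomials *)

Section RealMean.
Variable R : realType.
Notation C := (R[i]^o).
Implicit Types (v u : R -> R) (g : R -> C) (M t r x : R).

Definition rmean v : R := (2 * pi)^-1 * rint 0 (2 * pi) v.

Lemma circle_meanE (u : C -> R) r :
  circle_mean u r = rmean (fun t => u (circle_point r t)).
Proof. by []. Qed.

Let tp0 : 0 < 2 * pi :> R := twopi_gt0 R.

Lemma cont_cst M : continuous (fun _ : R => M).
Proof. by move=> t; exact: cvg_cst. Qed.

Lemma rmeanD v u : continuous v -> continuous u ->
  rmean (fun t => v t + u t) = rmean v + rmean u.
Proof. by move=> cv cu; rewrite /rmean rintD // mulrDr. Qed.

Lemma rmeanB v u : continuous v -> continuous u ->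
  rmean (fun t => v t - u t) = rmean v - rmean u.
Proof. by move=> cv cu; rewrite /rmean rintB // mulrBr. Qed.

Lemma rmeanZ M v : continuous v -> rmean (fun t => M * v t) = M * rmean v.
Proof. by move=> cv; rewrite /rmean rintZ // mulrCA. Qed.

Lemma rmean_cst M : rmean (fun=> M) = M.
Proof.
by rewrite /rmean rint_cst ?(ltW tp0) // subr0 mulrCA mulVf ?mulr1 // gt_eqF.
Qed.

Lemma ler_rmean v u : continuous v -> continuous u ->
  (forall t, v t <= u t) -> rmean v <= rmean u.
Proof.
move=> cv cu H; rewrite ler_pM2l ?invr_gt0 //.
by apply: ler_rint => // t _; exact: H.
Qed.

Lemma rmean_ge0 v : (forall t, 0 <= v t) -> 0 <= rmean v.
Proof.
move=> H; rewrite mulr_ge0 ?invr_ge0 ?(ltW tp0) //.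
by apply: Rintegral_ge0 => t _; exact: H.
Qed.

Lemma Re_tmean g : Re (tmean g) = rmean (fun t => Re (g t)).
Proof. by rewrite /tmean /= mul0r subr0. Qed.

Lemma cont_Re g : tcont g -> continuous (fun t => Re (g t)).
Proof. by case/tcontP. Qed.

Lemma cont_cabs g : tcont g -> continuous (fun t => cabs (g t)).
Proof.
move=> cg t; apply/cvgrPdist_lt => e e0; have [del del0 Hd] := cg t e e0.
apply/(@nbhs_ballP _ R); exists del => //= s; rewrite /ball /= distrC => /Hd.
apply: le_lt_trans; rewrite ler_norml; apply/andP; split.
  by rewrite lerNl opprB cabsBl.
by rewrite cabsB cabsBl.
Qed.

Lemma cont_ln v : continuous v -> (forall t, 0 < v t) ->
  continuous (fun t => ln (v t)).
Proof.
move=> cv v0 t; apply: (@continuous_comp R R R v (@ln R)); first exact: cv.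
exact: continuous_ln.
Qed.

Lemma cont_ln_cabs g : tcont g -> (forall t, g t != 0) ->
  continuous (fun t => ln (cabs (g t))).
Proof.
by move=> cg g0; apply: cont_ln => [|t]; [exact: cont_cabs|rewrite cabs_gt0].
Qed.

End RealMean.

Section LogSeries.
Variable R : realType.
Notation C := (R[i]^o).
Implicit Types (x z : C) (t q : R).

Lemma is_derive_Re (F : C -> C) t (d : C) : hasder F t%:C%C d ->
  is_derive t (1 : R) (fun s : R => Re (F s%:C%C)) (Re d).
Proof.
move=> H.
have L : (fun h : R => h^-1 *: (Re (F ((h *: (1 : R) + t)%:C%C)) - Re (F t%:C%C))) @ 0^'
   --> (Re d : R).
  apply/cvgrPdist_le => e e0; have [del del0 Hd] := H e e0.
  apply/(@nbhs_ballP _ R); exists del => //= h.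
  rewrite /ball /= sub0r normrN => hd h0.
  have := Hd (h%:C%C); rewrite cabs_real => /(_ hd).
  rewrite -rmorphD /= [_ *: 1]mulr1 [h + t]addrC => {}Hd.
  have -> : Re d - h^-1 *: (Re (F (t + h)%:C%C) - Re (F t%:C%C)) =
     - Re (F (t + h)%:C%C - F t%:C%C - d * h%:C%C) / h.
    rewrite -[_ *: _]/(_ * _); case: (F _) (F _) (d) => [a1 a2] [b1 b2] [d1 d2] /=.
    by rewrite !mulr0 !subr0; field.
  rewrite normrM normrN normfV ler_pdivrMr ?normr_gt0 //.
  by apply: le_trans Hd; exact: Re_le_cabs.
split; first by apply: cvgP L.
exact/cvg_lim.
Qed.

Lemma Re_div (x z : C) : Re (x / z) = (cabs z ^+ 2)^-1 * Re (x * conjc z).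
Proof. by rewrite sqr_cabs; case: z => a b; case: x => c d /=; ring. Qed.

Definition logsum D x : C := \sum_(k < D) x ^+ k.+1 / k.+1%:R.

Lemma hasder_logsum D x z : z * x != 1 ->
  hasder (fun u => logsum D (u * x)) z (x * (1 - (z * x) ^+ D) / (1 - z * x)).
Proof.
move=> zx; have zx0 : 1 - z * x != 0 by rewrite subr_eq0 eq_sym.
elim: D => [|D IH].
  have -> : (fun u => logsum 0 (u * x)) = (fun=> 0).
    by apply: funext => u; rewrite /logsum big_ord0.
  by rewrite expr0 subrr mulr0 mul0r; exact: hasder_cst.
have h1 := hasderM (hasderX z D.+1) (hasder_cst (x ^+ D.+1 / D.+1%:R) z).
have := hasderD IH h1; congr hasder.
  by apply: funext => u; rewrite /logsum big_ord_recr /= exprMn mulrA.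
rewrite mulr0 addr0 /= !exprMn !exprS.
have n0 : D.+1%:R != 0 :> C by rewrite pnatr_eq0.
by field; rewrite zx0 nat1r.
Qed.

(** Taylor expansion of [ln |1 - x|], by the mean value theorem on the ray
    from [0] to [x]. *)
Lemma ln_cabs_series D x q : cabs x <= q -> q < 1 ->
  `|ln (cabs (1 - x)) + Re (logsum D x)| <= q ^+ D.+1 / (1 - q).
Proof.
move=> xq q1; have q0 : 0 <= q by apply: le_trans xq; exact: cabs_ge0.
have q1' : 0 < 1 - q by rewrite subr_gt0.
pose y t : C := t%:C%C * x.
have yq t : 0 <= t <= 1 -> cabs (y t) <= q.
  move=> /andP[t0 t1]; rewrite cabsM cabs_real ger0_norm //.
  by apply: le_trans xq; rewrite ler_piMl ?cabs_ge0.
have y1 t : 0 <= t <= 1 -> 1 - q <= cabs (1 - y t).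
  move=> /yq h; have := cabsBl 1 (y t); rewrite cabs1; lra.
have yn1 t : 0 <= t <= 1 -> 1 - y t != 0.
  by move=> /y1 h; rewrite -cabs_gt0; apply: lt_le_trans h.
pose N t : R := cabs (1 - y t) ^+ 2.
have N0 t : 0 <= t <= 1 -> 0 < N t by move=> /yn1 h; rewrite exprn_gt0 // cabs_gt0.
pose dN t : R := Re (- 2 * x * conjc (1 - y t)).
have hN t : is_derive t (1 : R) N (dN t).
  pose P z : C := 1 - 2 * (Re x)%:C%C * z + (cabs x ^+ 2)%:C%C * z ^+ 2.
  have -> : N = (fun s => Re (P s%:C%C)).
    apply: funext => s; rewrite /N /P !sqr_cabs /y; case: (x) => a b /=; ring.
  have := is_derive_Re (hasderD (hasderB (hasder_cst 1 t%:C%C)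
    (hasderM (hasder_cst (2 * (Re x)%:C%C) t%:C%C) (hasder_id _)))
    (hasderM (hasder_cst (cabs x ^+ 2)%:C%C t%:C%C) (hasderX t%:C%C 2))).
  move=> H; apply: is_derive_eq; rewrite /dN sqr_cabs /y; case: (x) => a b /=; ring.
pose psi t := ln (N t) + 2 * Re (logsum D (y t)).
pose dpsi t := (N t)^-1 * dN t + 2 * Re (x * (1 - (y t) ^+ D) / (1 - y t)).
have hpsi t : 0 <= t <= 1 -> is_derive t (1 : R) psi (dpsi t).
  move=> t01; apply: is_deriveD.
    have h1 := is_derive1_ln (N0 t t01).
    exact: (is_derive1_comp h1 (hN t)).
  have yt : y t != 1 by have := yn1 t t01; rewrite subr_eq0 eq_sym.
  have := is_derive_Re (hasderM (hasder_cst 2 t%:C%C) (hasder_logsum D yt)).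
  rewrite mul0r add0r => H.
  have -> : (fun s => 2 * Re (logsum D (y s))) = (fun s => Re (2 * logsum D (s%:C%C * x))).
    by apply: funext => s; rewrite /y; case: (logsum _ _) => a b /=; ring.
  have -> : 2 * Re (x * (1 - y t ^+ D) / (1 - y t)) = Re (2 * (x * (1 - (t%:C%C * x) ^+ D) / (1 - t%:C%C * x))).
    by rewrite -/(y t); case: (_ / _) => a b /=; ring.
  exact: H.
have [||c c01 Hc] := @MVT_segment R psi dpsi 0 1 ler01.
- by move=> t; rewrite in_itv /= => /andP[t0 t1]; apply: hpsi; rewrite !ltW.
- apply: derivable_within_continuous => t; rewrite in_itv /= => t01.
  by have [] := hpsi t t01.
rewrite in_itv /= in c01.
have psi0 : psi 0 = 0.
  rewrite /psi /N /y mul0r subr0 cabs1 expr1n ln1 add0r /logsum big1 ?mulr0 //.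
  by move=> k _; rewrite exprS !mul0r.
have psi1 : psi 1 = 2 * (ln (cabs (1 - x)) + Re (logsum D x)).
  have x1 : 1 - x != 0 by have := yn1 1; rewrite /y mul1r; apply; rewrite ler01 lexx.
  by rewrite /psi /N /y mul1r lnXn ?cabs_gt0 // mulr2n; ring.
have E : dpsi c = - 2 * Re (x * y c ^+ D / (1 - y c)).
  have h := yn1 c c01; rewrite /dpsi /dN /N.
  have -> : (cabs (1 - y c) ^+ 2)^-1 * Re (- 2 * x * conjc (1 - y c)) =
      - 2 * Re (x / (1 - y c)).
    rewrite Re_div; case: (1 - y c) => a b; case: (x) => a' b' /=; ring.
  have -> : x * (1 - y c ^+ D) / (1 - y c) = x / (1 - y c) - x * y c ^+ D / (1 - y c).
    by rewrite mulrBr mulr1 mulrBl.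
  by rewrite raddfB /=; ring.
have : `|psi 1| <= 2 * (q ^+ D.+1 / (1 - q)).
  move: Hc; rewrite psi0 !subr0 mulr1 => ->; rewrite E normrM normrN normr_nat.
  rewrite ler_pM2l //; apply: le_trans (Re_le_cabs _) _.
  rewrite cabsM cabsM cabsX cabsV exprS.
  have h0 := y1 c c01.
  apply: ler_pM; rewrite ?mulr_ge0 ?exprn_ge0 ?invr_ge0 ?cabs_ge0 //.
    apply: ler_pM; rewrite ?exprn_ge0 ?cabs_ge0 //.
    by apply: lerXn2r; rewrite ?nnegrE ?cabs_ge0 // yq.
  by rewrite lef_pV2 ?posrE // (lt_le_trans q1').
by rewrite psi1 normrM normr_nat ler_pM2l.
Qed.

End LogSeries.

Section Poisson.
Variable R : realType.
Notation C := (R[i]^o).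
Implicit Types (z w a b c : C) (t M : R).

Section Kernel.
Variables (r : R) (w : C).
Hypothesis wr : cabs w < r.
Let r_gt0 : 0 < r. Proof. by apply: le_lt_trans wr; exact: cabs_ge0. Qed.
Let tz t : C := circle_point r t.
Let ctz : tcont tz. Proof. exact: tcont_circle. Qed.
Let tzr t : cabs (tz t) = r. Proof. by rewrite cabs_circle_point gtr0_norm. Qed.

Definition pker t : R := (r ^+ 2 - cabs w ^+ 2) / cabs (tz t - w) ^+ 2.

Let cK : tcont (fun t => tz t / (tz t - w)).
Proof. exact: tcont_kernel. Qed.

Let c2K1 : tcont (fun t => 2 * (tz t / (tz t - w)) - 1).
Proof. by apply: tcontB; [exact: tcontZ|exact: tcont_cst]. Qed.

Lemma pkerE t : pker t = Re (2 * (tz t / (tz t - w)) - 1).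
Proof.
have n0 := circle_neq r_gt0 t wr; rewrite -/(tz t) in n0.
have -> : 2 * (tz t / (tz t - w)) - 1 = (tz t + w) / (tz t - w) by field.
rewrite Re_div /pker mulrC; congr (_ * _).
rewrite -(tzr t) !sqr_cabs; case: (tz t) (w) => [x y] [u v] /=; ring.
Qed.

Lemma cont_pker : continuous pker.
Proof.
have -> : pker = (fun t => Re (2 * (tz t / (tz t - w)) - 1)).
  by apply: funext => t; exact: pkerE.
exact: cont_Re.
Qed.

Let rw0 : 0 < r - cabs w. Proof. by rewrite subr_gt0. Qed.
Let rw1 : 0 < r + cabs w. Proof. by have := cabs_ge0 w; have := r_gt0; lra. Qed.

Lemma pker_ge t : (r - cabs w) / (r + cabs w) <= pker t.
Proof.
have n0 := circle_neq r_gt0 t wr; rewrite -/(tz t) -cabs_gt0 in n0.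
rewrite /pker ler_pdivlMr ?exprn_gt0 // mulrAC ler_pdivrMr //.
have -> : (r ^+ 2 - cabs w ^+ 2) * (r + cabs w) = (r - cabs w) * (r + cabs w) ^+ 2 by ring.
rewrite ler_pM2l //; apply: lerXn2r; rewrite ?nnegrE ?cabs_ge0 ?(ltW rw1) //.
by apply: le_trans (cabsD _ _) _; rewrite cabsN tzr.
Qed.

Lemma pker_gt0 t : 0 < pker t.
Proof. by apply: lt_le_trans (pker_ge t); rewrite divr_gt0. Qed.

Lemma pker_le t : pker t <= (r + cabs w) / (r - cabs w).
Proof.
have n0 := circle_neq r_gt0 t wr; rewrite -/(tz t) -cabs_gt0 in n0.
rewrite /pker ler_pdivrMr ?exprn_gt0 // mulrAC ler_pdivlMr //.
have -> : (r ^+ 2 - cabs w ^+ 2) * (r - cabs w) = (r + cabs w) * (r - cabs w) ^+ 2 by ring.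
rewrite ler_pM2l //; apply: lerXn2r; rewrite ?nnegrE ?cabs_ge0 ?(ltW rw0) //.
by have := cabsBl (tz t) w; rewrite tzr.
Qed.

(** The conjugate of a polynomial is, on the circle, a polynomial in the inverse
    of the variable; the Cauchy kernel sees only its constant term. *)
Lemma poisson_poly D (k : nat -> C) :
  let F z := \sum_(j < D) k j * z ^+ j in
  Re (F w) = rmean (fun t => Re (F (tz t)) * pker t).
Proof.
move=> F.
have cX j : tcont (fun t => k j * tz t ^+ j) by apply: tcontZ; exact: tcontX.
have cF : tcont (fun t => F (tz t)) by apply: tcont_sum.
have cFc : tcont (fun t => (conjc (F (tz t)) : C)) by exact: tcont_conj.
have m1 : tmean (fun t => F (tz t) * (tz t / (tz t - w))) = F w.
  under eq_fun do rewrite mulr_suml.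
  rewrite tmean_sum => [|j]; last exact: tcontM.
  apply: eq_bigr => j _.
  have ej : entire (fun z => z ^+ j : C) by move=> z; exact: hasder_derivable (hasderX _ _).
  rewrite -(cauchy_formula r_gt0 ej wr) -tmeanZ; last first.
    by apply: tcontM => //; exact: tcontX.
  by congr tmean; apply: funext => t; rewrite [RHS]mulrA.
have m2 : tmean (fun t => F (tz t)) = F 0.
  rewrite tmean_sum //; apply: eq_bigr => j _.
  by rewrite tmeanZ; [rewrite tmean_circleX // expr0n|exact: tcontX].
have m3 : tmean (fun t => (conjc (F (tz t)) : C) * (tz t / (tz t - w))) = conjc (F 0).
  have -> : (fun t => (conjc (F (tz t)) : C) * (tz t / (tz t - w))) =
     (fun t => \sum_(j < D) ((conjc (k j) : C) * (r ^+ 2)%:C%C ^+ j) *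
        ((tz t ^+ j)^-1 * (tz t / (tz t - w)))).
    apply: funext => t; rewrite raddf_sum mulr_suml; apply: eq_bigr => j _ /=.
    by rewrite conjcM conjcX circle_conj // expr_div_n !mulrA.
  have cVK j : tcont (fun t => (tz t ^+ j)^-1 * (tz t / (tz t - w))).
    by apply: tcontM => //; exact: tcont_Vcircle.
  rewrite tmean_sum => [|j]; last exact: tcontZ.
  rewrite raddf_sum /=; apply: eq_bigr => j _.
  rewrite tmeanZ // tmean_Vkernel // conjcM conjcX conjc0 expr0n -mulrA.
  by case: (j : nat) => [|j']; rewrite ?mulr0 // expr0 mul1r.
have E t : (2 * Re (F (tz t)) * pker t) =
   Re ((F (tz t) + conjc (F (tz t))) * (2 * (tz t / (tz t - w)) - 1)).
  by rewrite pkerE addcJ; case: (F (tz t)) (2 * _ - 1) => [x y] [u v] /=; ring.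
have c1 : continuous (fun t => Re (F (tz t)) * pker t).
  by apply: contM; [exact: cont_Re|exact: cont_pker].
apply: (@mulfI _ 2) => //; rewrite -rmeanZ //.
under eq_fun do rewrite mulrA E.
rewrite -Re_tmean.
have -> : (fun t => (F (tz t) + conjc (F (tz t))) * (2 * (tz t / (tz t - w)) - 1)) =
  (fun t => 2 * (F (tz t) * (tz t / (tz t - w)) + (conjc (F (tz t)) : C) * (tz t / (tz t - w)))
     - (F (tz t) + conjc (F (tz t)))).
  by apply: funext => t; ring.
rewrite tmeanB; [|by apply: tcontZ; apply: tcontD; exact: tcontM|exact: tcontD].
rewrite tmeanZ; last by apply: tcontD; exact: tcontM.
rewrite !tmeanD //; [|exact: tcontM|exact: tcontM].
rewrite m1 m2 m3 tmean_conj // m2.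
by case: (F w) (F 0) => [x y] [u v] /=; ring.
Qed.

Lemma rmean_pker : rmean pker = 1.
Proof.
have := poisson_poly 1 (fun=> 1); rewrite /= big_ord1 expr0 mulr1 /= => ->.
by congr rmean; apply: funext => t; rewrite big_ord1 expr0 mulr1 mul1r.
Qed.

Lemma poisson_approx (u : C -> R) : continuous (fun t => u (tz t)) ->
  (forall e, 0 < e -> exists D (k : nat -> C), forall z, cabs z <= r ->
    `|u z - Re (\sum_(j < D) k j * z ^+ j)| <= e) ->
  u w = rmean (fun t => u (tz t) * pker t).
Proof.
move=> cu H; apply/eqP; rewrite -subr_eq0 -normr_eq0; apply/eqP/le_anti.
rewrite normr_ge0 andbT; apply: le0_eps => e e0.
have e3 : 0 < e / 3 by rewrite divr_gt0.
have [D [k Hk]] := H _ e3; pose F z := \sum_(j < D) k j * z ^+ j.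
have cF : continuous (fun t => Re (F (tz t))).
  by apply: cont_Re; apply: tcont_sum => j; apply: tcontZ; exact: tcontX.
have cP := cont_pker.
have h1 : `|u w - Re (F w)| <= e / 3 by apply: Hk; exact: ltW.
have h2 : `|rmean (fun t => u (tz t) * pker t) - Re (F w)| <= e / 3.
  rewrite /F poisson_poly -rmeanB; [|exact: contM|exact: contM].
  have cd : continuous (fun t => u (tz t) * pker t - Re (F (tz t)) * pker t).
    by apply: contB; exact: contM.
  have ce : continuous (fun t => e / 3 * pker t).
    by apply: contM => //; exact: cont_cst.
  have ce' : continuous (fun t => - (e / 3) * pker t).
    by apply: contM => //; exact: cont_cst.
  have B t : `|u (tz t) * pker t - Re (F (tz t)) * pker t| <= e / 3 * pker t.
    have p0 := pker_gt0 t; rewrite -mulrBl normrM (gtr0_norm p0).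
    apply: (ler_wpM2r (ltW p0)); apply: Hk.
    by rewrite tzr.
  have up : rmean (fun t => u (tz t) * pker t - Re (F (tz t)) * pker t) <= e / 3.
    have -> : e / 3 = rmean (fun t => e / 3 * pker t) by rewrite rmeanZ // rmean_pker mulr1.
    apply: ler_rmean => // t.
    by have := B t; rewrite ler_norml => /andP[].
  have lo : - (e / 3) <= rmean (fun t => u (tz t) * pker t - Re (F (tz t)) * pker t).
    have -> : - (e / 3) = rmean (fun t => - (e / 3) * pker t) by rewrite rmeanZ // rmean_pker mulr1.
    apply: ler_rmean => // t.
    by have := B t; rewrite ler_norml mulNr => /andP[].
  by rewrite ler_norml lo up.
have -> : u w - rmean (fun t => u (tz t) * pker t) =
  (u w - Re (F w)) - (rmean (fun t => u (tz t) * pker t) - Re (F w)) by ring.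
apply: le_lt_trans (ler_normB _ _) _; lra.
Qed.

(** For [cabs b] larger than the radius, [ln |1 - x / b|] is a uniform limit of
    real parts of polynomials, to which the formula for polynomials applies. *)
Lemma poisson_ln_linear b : r < cabs b ->
  ln (cabs (w - b)) = rmean (fun t => ln (cabs (tz t - b)) * pker t).
Proof.
move=> rb; have b0 : 0 < cabs b by apply: lt_trans rb.
have bn0 : b != 0 by rewrite -cabs_gt0.
have zb z : cabs z <= r -> z - b != 0.
  by rewrite subr_eq0; apply: contraTneq => ->; rewrite -ltNge.
pose q := r / cabs b; have q0 : 0 <= q by rewrite divr_ge0 ?(ltW r_gt0) ?(ltW b0).
have q1 : q < 1 by rewrite ltr_pdivrMr // mul1r.
apply: (@poisson_approx (fun z => ln (cabs (z - b)))).
  apply: cont_ln_cabs; first by apply: tcontB => //; exact: tcont_cst.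
  by move=> t; apply: zb; rewrite tzr.
move=> e e0; have q01 : 0 <= q < 1 by rewrite q0 q1.
have [D HD] := geometric_small (1 - q)^-1 q01 e0.
pose k (j : nat) : C := if j is i.+1 then - (b ^+ i.+1 * i.+1%:R)^-1 else (ln (cabs b))%:C%C.
exists D.+1, k => z zr.
have -> : \sum_(j < D.+1) k j * z ^+ j = (ln (cabs b))%:C%C - logsum D (z / b).
  rewrite big_ord_recl /= expr0 mulr1; congr (_ + _).
  rewrite /logsum -sumrN; apply: eq_bigr => j _.
  by rewrite /k /= /bump /= add1n expr_div_n invfM mulNr; congr (- _); ring.
have xq : cabs (z / b) <= q by rewrite cabsM cabsV ler_wpM2r // invr_ge0 ltW.
have := ln_cabs_series D xq q1.
have -> : cabs (1 - z / b) = cabs (z - b) / cabs b.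
  by rewrite -cabsV -cabsM cabsB -[in LHS](divff bn0) mulrBl.
rewrite ln_div ?posrE ?cabs_gt0 //; last exact: zb.
rewrite raddfB /= => h.
have -> : ln (cabs (z - b)) - ((ln (cabs b)) - Re (logsum D (z / b))) =
  ln (cabs (z - b)) - ln (cabs b) + Re (logsum D (z / b)) by ring.
apply: le_trans h _; apply: le_trans (ltW HD); rewrite mulrC ler_wpM2l ?invr_ge0 ?subr_ge0 ?(ltW q1) //.
by rewrite exprS ler_piMl ?exprn_ge0 // ltW.
Qed.

Lemma poisson_ln c (l : seq C) : c != 0 -> (forall a, a \in l -> r < cabs a) ->
  let Q z := c * \prod_(a <- l) (z - a) in
  ln (cabs (Q w)) = rmean (fun t => ln (cabs (Q (tz t))) * pker t) /\
  continuous (fun t => ln (cabs (Q (tz t)))).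
Proof.
move=> c0 Hl Q; rewrite {}/Q.
have cP := cont_pker.
elim: l Hl => [|a l IH] Hl.
  have E t : ln (cabs (c * \prod_(a <- [::]) (tz t - a))) = ln (cabs c).
    by rewrite big_nil mulr1.
  split; last by rewrite (funext E); exact: cont_cst.
  rewrite big_nil mulr1; under eq_fun do rewrite E.
  by rewrite rmeanZ // rmean_pker mulr1.
have [|IH1 IH2] := IH; first by move=> x xl; apply: Hl; rewrite inE xl orbT.
have ra : r < cabs a by apply: Hl; rewrite mem_head.
have ne z x : cabs z <= r -> r < cabs x -> 0 < cabs (z - x).
  move=> zr rx; rewrite cabs_gt0 subr_eq0; apply: contraTneq zr => ->.
  by rewrite -ltNge.
have E z : cabs z <= r -> ln (cabs (c * \prod_(x <- a :: l) (z - x))) =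
    ln (cabs (z - a)) + ln (cabs (c * \prod_(x <- l) (z - x))).
  move=> zr; have p1 := ne z a zr ra.
  have p2 : 0 < cabs (c * \prod_(x <- l) (z - x)).
    rewrite cabs_gt0 mulf_neq0 // prodf_seq_neq0; apply/allP => x xl /=.
    by rewrite -cabs_gt0 ne // Hl // inE xl orbT.
  have -> : c * \prod_(x <- a :: l) (z - x) = (z - a) * (c * \prod_(x <- l) (z - x)).
    by rewrite big_cons mulrCA.
  by rewrite cabsM lnM ?posrE.
have c1 : continuous (fun t => ln (cabs (tz t - a))).
  apply: cont_ln_cabs; first by apply: tcontB => //; exact: tcont_cst.
  by move=> t; rewrite -cabs_gt0 ne // tzr.
have Et t : ln (cabs (c * \prod_(x <- a :: l) (tz t - x))) =
    ln (cabs (tz t - a)) + ln (cabs (c * \prod_(x <- l) (tz t - x))).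
  by apply: E; rewrite tzr.
split; last by rewrite (funext Et); exact: contD.
rewrite E ?(ltW wr) //; under [X in _ = rmean X]eq_fun do rewrite Et mulrDl.
rewrite rmeanD; [|exact: contM|exact: contM].
by rewrite -IH1 -poisson_ln_linear.
Qed.

End Kernel.
End Poisson.

Section Harnack.
Variable R : realType.
Notation C := (R[i]^o).
Implicit Types (z w a b c : C) (l : seq C) (t r e N : R).

Theorem harnack c l z0 rho N : c != 0 -> 0 < rho ->
  (forall a, a \in l -> rho < cabs (a - z0)) ->
  let Q z := c * \prod_(a <- l) (z - a) in
  (forall z, cabs (z - z0) = rho -> cabs (Q z) <= expR N) ->
  forall w, cabs w < rho ->
  N - ln (cabs (Q (z0 + w))) <=
    (rho + cabs w) / (rho - cabs w) * (N - ln (cabs (Q z0))) /\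
  (rho - cabs w) / (rho + cabs w) * (N - ln (cabs (Q z0))) <=
    N - ln (cabs (Q (z0 + w))).
Proof.
move=> c0 rho0 Hl Q HN w wr.
pose l' := [seq a - z0 | a <- l].
have l'P a : a \in l' -> rho < cabs a by case/mapP => x /Hl h ->.
pose Q' z := c * \prod_(a <- l') (z - a).
have QE z : Q' z = Q (z0 + z).
  rewrite /Q' /Q big_map; congr (_ * _); apply: eq_bigr => a _.
  by rewrite opprB addrA [z + z0]addrC.
have r0 : cabs (0 : C) < rho by rewrite cabs0.
have [P1 cQ] := poisson_ln wr c0 l'P.
have [P0 _] := poisson_ln r0 c0 l'P.
have cw := cont_pker wr.
pose v t := N - ln (cabs (Q' (circle_point rho t))).
have cv : continuous v by apply: contB => //; exact: cont_cst.
have v0 t : 0 <= v t.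
  rewrite subr_ge0 -ler_expR lnK.
    rewrite QE; apply: HN; rewrite addrAC subrr add0r cabs_circle_point gtr0_norm //.
  rewrite posrE cabs_gt0 mulf_neq0 // prodf_seq_neq0; apply/allP => a /l'P ra /=.
  rewrite subr_eq0; apply: contraTneq ra => <-.
  by rewrite cabs_circle_point gtr0_norm // ltxx.
have Ew : N - ln (cabs (Q (z0 + w))) = rmean (fun t => v t * pker rho w t).
  rewrite -QE P1 -[N in LHS]mulr1 -(rmean_pker wr) -rmeanZ // -rmeanB //.
  - by congr rmean; apply: funext => t; rewrite -mulrBl.
  - by apply: contM => //; exact: cont_cst.
  - exact: contM.
have E0 : N - ln (cabs (Q z0)) = rmean v.
  have -> : Q z0 = Q' 0 by rewrite QE addr0.
  rewrite P0 -[N in LHS]rmean_cst -rmeanB //.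
  - congr rmean; apply: funext => t; congr (_ - _).
    rewrite /pker cabs0 expr0n subr0 subr0 cabs_circle_point gtr0_norm // divff ?mulr1 //.
    by rewrite expf_neq0 // gt_eqF.
  - exact: cont_cst.
  - by apply: contM => //; exact: cont_pker.
rewrite Ew E0 -!rmeanZ //; split; apply: ler_rmean; try by [exact: contM|apply: contM => //; exact: cont_cst].
  by move=> t; rewrite [leRHS]mulrC ler_wpM2l // pker_le.
by move=> t; rewrite [leLHS]mulrC ler_wpM2l // pker_ge.
Qed.

(** The sign of the last product tells that reflecting the zero [a] in the
    circle of radius [r] increases the factor inside and keeps its modulus on
    the circle. *)
Lemma reflected_factor_sqr r a z :
  cabs ((r ^+ 2)%:C%C - conjc a * z) ^+ 2 =
  (r * cabs (z - a)) ^+ 2 + (r ^+ 2 - cabs z ^+ 2) * (r ^+ 2 - cabs a ^+ 2).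
Proof. by rewrite exprMn !sqr_cabs; case: z a => [x y] [u v] /=; ring. Qed.

Lemma reflected_factorE r a z : r != 0 -> a != 0 ->
  ((r ^+ 2)%:C%C - conjc a * z) / r%:C%C =
  - conjc a / r%:C%C * (z - (r ^+ 2)%:C%C / conjc a).
Proof.
move=> r0 a0; have ca0 : conjc a != 0 :> C by rewrite conjc_eq0.
have rn : r%:C%C != 0 :> C by rewrite -cabs_gt0 cabs_real normr_gt0.
by field; rewrite ca0 rn.
Qed.

(** A zero inside the disc is reflected in the circle; a zero on the circle is
    pushed slightly outwards. *)
Lemma zerofree_factor a r e : 0 < r -> 0 < e ->
  exists k : C, exists2 l : seq C, k != 0 /\ (forall b, b \in l -> r < cabs b) &
    (forall z, cabs z <= r -> cabs (z - a) <= cabs (k * \prod_(b <- l) (z - b))) /\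
    (forall z, cabs z = r -> cabs (k * \prod_(b <- l) (z - b)) <= cabs (z - a) + e).
Proof.
move=> r0 e0; have [ra|ra|ra] := ltgtP r (cabs a).
- exists 1, [:: a]; first by split; [exact: oner_neq0|move=> b; rewrite inE => /eqP ->].
  by split=> z _; rewrite big_seq1 mul1r // lerDl ltW.
- have [a0|a0] := eqVneq a 0.
    exists r%:C%C, [::].
      by split => //; rewrite -cabs_gt0 cabs_real gtr0_norm.
    by split=> z zr; rewrite big_nil mulr1 cabs_real gtr0_norm // a0 subr0 // zr lerDl ltW.
  have ca0 : conjc a != 0 :> C by rewrite conjc_eq0.
  pose b : C := (r ^+ 2)%:C%C / conjc a.
  have E z : - conjc a / r%:C%C * (z - b) = ((r ^+ 2)%:C%C - conjc a * z) / r%:C%C.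
    by rewrite reflected_factorE // gt_eqF.
  have cabsE' z : cabs (- conjc a / r%:C%C * \prod_(b <- [:: b]) (z - b)) =
      cabs ((r ^+ 2)%:C%C - conjc a * z) / r.
    by rewrite big_seq1 E cabsM cabsV cabs_real gtr0_norm.
  have a1 : 0 <= r ^+ 2 - cabs a ^+ 2.
    by rewrite subr_ge0; apply: lerXn2r; rewrite ?nnegrE ?cabs_ge0 ?ltW.
  exists (- conjc a / r%:C%C), [:: b].
    split; first by rewrite mulf_neq0 ?oppr_eq0 ?invr_neq0 // -cabs_gt0 cabs_real gtr0_norm.
    move=> b'; rewrite inE => /eqP ->.
    rewrite /b cabsM cabsV cabs_conj cabs_real ger0_norm ?exprn_ge0 ?(ltW r0) //.
    rewrite ltr_pdivlMr ?cabs_gt0 // expr2 ltr_pM2l //.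
  split=> z zr; rewrite cabsE'.
    rewrite ler_pdivlMr // mulrC.
    rewrite -(@ler_pXn2r _ 2) ?nnegrE ?cabs_ge0 ?mulr_ge0 ?cabs_ge0 ?(ltW r0) //.
    rewrite reflected_factor_sqr lerDl mulr_ge0 // subr_ge0.
    by apply: lerXn2r; rewrite ?nnegrE ?cabs_ge0 ?(ltW r0).
  rewrite ler_pdivrMr //; apply: le_trans (_ : r * cabs (z - a) <= _).
    rewrite -(@ler_pXn2r _ 2) ?nnegrE ?cabs_ge0 ?mulr_ge0 ?cabs_ge0 ?(ltW r0) //.
    by rewrite reflected_factor_sqr zr subrr mul0r addr0.
  by rewrite mulrC ler_wpM2r ?(ltW r0) // lerDl ltW.
pose d := e / r; have d0 : 0 < d by rewrite divr_gt0.
exists 1, [:: (1 + d)%:C%C * a].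
  split; first exact: oner_neq0.
  move=> b; rewrite inE => /eqP ->; rewrite cabsM cabs_real -ra gtr0_norm ?ltr_wpDr ?ltW //.
  by rewrite ltr_pMl // ltrDl.
split=> z zr; rewrite big_seq1 mul1r.
  rewrite -(@ler_pXn2r _ 2) ?nnegrE ?cabs_ge0 //.
  have H : Re z * Re a + Im z * Im a <= r ^+ 2.
    have h1 := sqr_cabs z; have h2 := sqr_cabs a; rewrite -ra in h2.
    have h3 : cabs z ^+ 2 <= r ^+ 2 by apply: lerXn2r; rewrite ?nnegrE ?cabs_ge0 ?(ltW r0).
    have h4 := sqr_ge0 (Re z - Re a); have h5 := sqr_ge0 (Im z - Im a).
    rewrite sqrrB in h4; rewrite sqrrB in h5; lra.
  have h2 := sqr_cabs a; rewrite -ra in h2.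
  have E : cabs (z - (1 + d)%:C%C * a) ^+ 2 = cabs (z - a) ^+ 2 +
      2 * d * (r ^+ 2 - (Re z * Re a + Im z * Im a)) + d ^+ 2 * r ^+ 2.
    by rewrite h2 !sqr_cabs; case: (z) (a) => [x y] [u v] /=; ring.
  rewrite E -addrA lerDl; apply: addr_ge0; last by apply: mulr_ge0; exact: sqr_ge0.
  by apply: mulr_ge0; [rewrite mulr_ge0 ?(ltW d0)|rewrite subr_ge0].
have -> : z - (1 + d)%:C%C * a = (z - a) - d%:C%C * a by rewrite rmorphD /=; ring.
apply: le_trans (cabsD _ _) _; rewrite cabsN cabsM cabs_real -ra gtr0_norm //.
by rewrite /d divfK // gt_eqF.
Qed.

Lemma prod_circle_bound c l r : exists2 B : R, 0 <= B &
  forall z, cabs z = r -> cabs (c * \prod_(a <- l) (z - a)) <= B.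
Proof.
exists (cabs c * \prod_(a <- l) (`|r| + cabs a)).
  by rewrite mulr_ge0 ?cabs_ge0 // prodr_ge0 // => a _; rewrite addr_ge0 ?cabs_ge0.
move=> z zr; rewrite cabsM ler_wpM2l ?cabs_ge0 // cabs_prod.
apply: ler_prod => a _; rewrite cabs_ge0 /=.
by apply: le_trans (cabsD _ _) _; rewrite cabsN zr lerD2r ler_norm.
Qed.

Lemma zerofree_majorant c l r e : c != 0 -> 0 < r -> 0 < e ->
  exists c' : C, exists2 l' : seq C, c' != 0 /\ (forall b, b \in l' -> r < cabs b) &
    (forall z, cabs z <= r ->
      cabs (c * \prod_(a <- l) (z - a)) <= cabs (c' * \prod_(b <- l') (z - b))) /\
    (forall z, cabs z = r ->
      cabs (c' * \prod_(b <- l') (z - b)) <= cabs (c * \prod_(a <- l) (z - a)) + e).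
Proof.
move=> c0 r0; elim: l e => [|a l IH] e e0.
  exists c, [::]; first by split.
  by split=> z _; rewrite !big_nil // lerDl ltW.
have [B B0 HB] := prod_circle_bound c l r.
pose S := r + cabs a + B + 1.
have S1 : 1 <= S by rewrite /S; have := cabs_ge0 a; have := r0; lra.
have S0 : 0 < S by apply: lt_le_trans S1.
pose e1 := Num.min 1 (e / S).
have e10 : 0 < e1 by rewrite lt_min ltr01 divr_gt0.
have e11 : e1 <= 1 by rewrite ge_min lexx.
have e1S : e1 * S <= e by rewrite -ler_pdivlMr // ge_min lexx orbT.
have [c1 [l1 [c10 Hl1] [H1 H1']]] := IH _ e10.
have [k [l2 [k0 Hl2] [H2 H2']]] := zerofree_factor a r0 e10.
have E z : k * c1 * \prod_(b <- l2 ++ l1) (z - b) =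
   (k * \prod_(b <- l2) (z - b)) * (c1 * \prod_(b <- l1) (z - b)).
  by rewrite big_cat /=; ring.
have E' z : c * \prod_(b <- a :: l) (z - b) = (z - a) * (c * \prod_(b <- l) (z - b)).
  by rewrite big_cons /=; ring.
exists (k * c1), (l2 ++ l1).
  split; first by rewrite mulf_neq0.
  by move=> b; rewrite mem_cat => /orP[/Hl2|/Hl1].
split=> z zr; rewrite E E' !cabsM.
  by rewrite -!cabsM cabsM [leRHS]cabsM; apply: ler_pM; rewrite ?cabs_ge0 ?H1 ?H2.
rewrite -[X in X * _ <= _]cabsM -[X in _ * X <= _]cabsM -[X in _ <= _ * X + _]cabsM.
set X := cabs (z - a); set Y := cabs (c * _).
have X0 : 0 <= X by exact: cabs_ge0. have Y0 : 0 <= Y by exact: cabs_ge0.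
apply: le_trans (ler_pM (cabs_ge0 _) (cabs_ge0 _) (H2' z zr) (H1' z zr)) _.
rewrite -/X -/Y.
have XS : X <= r + cabs a by apply: le_trans (cabsD _ _) _; rewrite cabsN zr.
have YB : Y <= B by exact: HB.
have -> : (X + e1) * (Y + e1) = X * Y + e1 * (X + Y + e1) by ring.
rewrite lerD2l; apply: le_trans e1S; rewrite ler_wpM2l ?(ltW e10) // /S; lra.
Qed.

(** Poisson's formula for the logarithm of a zero-free majorant bounds an
    entire function inside a disc by a mean over its boundary. *)
Theorem log_max_bound (f : C -> C) r (u : R -> R) : entire f -> 0 < r ->
  continuous u -> (forall t, cabs (f (circle_point r t)) + 2 <= expR (u t)) ->
  forall z, cabs z < r ->
  cabs (f z) <= 2 * expR ((r + cabs z) / (r - cabs z) * rmean u).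
Proof.
move=> ef r0 cu Hu z zr.
have u0 t : 0 <= u t.
  rewrite -ler_expR expR0; apply: le_trans (Hu t).
  by have := cabs_ge0 (f (circle_point r t)); lra.
have K0 : 0 <= (r + cabs z) / (r - cabs z).
  by have := cabs_ge0 z => z0; apply: divr_ge0; lra.
have m0 : 0 <= (r + cabs z) / (r - cabs z) * rmean u by rewrite mulr_ge0 // rmean_ge0.
have e1 : 1 <= expR ((r + cabs z) / (r - cabs z) * rmean u) by rewrite -expR0 ler_expR.
have [fn|fz0] := pselect (exists z, f z != 0); last first.
  have -> : f z = 0 by apply/eqP; apply: contrapT => /negP h; apply: fz0; exists z.
  by rewrite cabs0 mulr_ge0 // expR_ge0.
have [k [c0 c00 H]] := factored_approx ef fn.
have [c [l Hc Hf]] := H r 1 r0 ltr01.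
have cn : c != 0 by apply: contraNneq c00 => c0'; rewrite -Hc c0' mul0r.
have E w : w ^+ k * (c * \prod_(a <- l) (w - a)) = c * \prod_(a <- nseq k 0 ++ l) (w - a).
  by rewrite big_cat big_nseq iter_mulr_1 subr0 mulrCA.
have [c' [l' [c'0 Hl'] [M1 M2]]] := zerofree_majorant (nseq k 0 ++ l) cn r0 ltr01.
have [P cQ] := poisson_ln zr c'0 Hl'.
have cp := cont_pker zr.
set Q := cabs (c' * \prod_(a <- l') (z - a)) in P.
have Q0 w : cabs w <= r -> 0 < cabs (c' * \prod_(a <- l') (w - a)).
  move=> wr; rewrite cabs_gt0 mulf_neq0 // prodf_seq_neq0; apply/allP => a /Hl' ra /=.
  by rewrite subr_eq0; apply: contraTneq wr => ->; rewrite -ltNge.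
have tzr t : cabs (circle_point r t : C) = r by rewrite cabs_circle_point gtr0_norm.
have QB : Q <= expR ((r + cabs z) / (r - cabs z) * rmean u).
  rewrite -[Q]lnK ?posrE ?Q0 ?(ltW zr) // ler_expR P -rmeanZ //.
  apply: ler_rmean; [exact: contM|by apply: contM => //; exact: cont_cst|move=> t].
  rewrite mulrC; apply: le_trans (ler_wpM2l (ltW (pker_gt0 zr t)) (_ : _ <= u t)) _.
    rewrite -ler_expR lnK ?posrE ?Q0 ?tzr //.
    apply: le_trans (Hu t); apply: le_trans (M2 _ (tzr t)) _; rewrite -E.
    have := Hf (circle_point r t); rewrite tzr => /(_ (lexx _)) h.
    have := cabsBl (circle_point r t ^+ k * (c * \prod_(a <- l) (circle_point r t - a))) (f (circle_point r t)).
    rewrite cabsB; lra.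
  by rewrite ler_wpM2r // pker_le.
have := Hf z (ltW zr); have := M1 z (ltW zr); rewrite -E -/Q => h1 h2.
have := cabsBl (f z) (z ^+ k * (c * \prod_(a <- l) (z - a))); lra.
Qed.

End Harnack.

(** * Radii that avoid the zeros *)

Section RadialAverage.
Variable R : realType.
Implicit Types (r L x d lam A : R).
Local Notation mu := (@lebesgue_measure R).

Let near (b : R * R * R) : set R := `[b.1.2 - b.2, b.1.2 + b.2]%classic.

(** Markov's inequality for a weighted count of intervals, encoded as triples
    of a weight, a centre and a half-width. *)
Lemma weighted_intervals_markov (s : seq (R * R * R)) A lam : 0 < lam ->
  (forall b, b \in s -> 0 <= b.1.1 /\ 0 <= b.2) ->
  \sum_(b <- s) b.1.1 * (2 * b.2) <= A ->
  exists Bad : set R, [/\ measurable Bad, (mu Bad <= (A / lam)%:E)%E &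
    forall r, ~ Bad r ->
      \sum_(b <- s) b.1.1 * (`|r - b.1.2| <= b.2)%R%:R < lam].
Proof.
move=> lam0 Hs HA.
pose f r := \sum_(b <- s) b.1.1 * \1_(near b) r : R.
have fE r : f r = \sum_(b <- s) b.1.1 * (`|r - b.1.2| <= b.2)%R%:R.
  apply: eq_bigr => b _; rewrite indicE; congr (_ * _%:R).
  by rewrite mem_setE in_itv /= -ler_distlC distrC.
have mnear b0 : measurable (near b0) by exact: measurable_itv.
have mf : measurable_fun setT f.
  apply: measurable_sum => b0; apply: measurable_funM; first exact: measurable_cst.
  exact: (measurable_indic (mnear _)).
have f0 r : 0 <= f r.
  rewrite /f big_seq sumr_ge0 // => b0 /Hs[w0 _]; by rewrite mulr_ge0 // indicE ler0n.
have mBad : measurable [set r | lam <= f r].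
  have -> : [set r | lam <= f r] = setT `&` f @^-1` `[lam, +oo[%classic.
    by apply/seteqP; split => r /=; rewrite in_itv /= andbT // => -[].
  by apply: mf => //; exact: measurable_itv.
have intf : (\int[mu]_x `|(f x)%:E| <= A%:E)%E.
  under eq_integral do rewrite gee0_abs ?lee_fin //.
  suff : forall s', {subset s' <= s} ->
      (\int[mu]_x (\sum_(b <- s') b.1.1 * \1_(near b) x)%:E =
       (\sum_(b <- s') b.1.1 * (2 * b.2))%:E)%E.
    by move=> -> //; rewrite lee_fin.
  elim=> [_|b s' IH sub].
    by under eq_integral do rewrite big_nil; rewrite integral0 big_nil.
  have sub' : {subset s' <= s} by move=> x xs; apply: sub; rewrite inE xs orbT.
  have [w0 h0] : 0 <= b.1.1 /\ 0 <= b.2 by apply: Hs; apply: sub; rewrite mem_head.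
  under eq_integral do rewrite big_cons EFinD.
  rewrite ge0_integralD //=.
  - rewrite IH // (@integralZl_indic _ _ _ mu _ measurableT (fun=> near b)); [|by rewrite ltNge w0|exact: mnear].
    have -> : (\int[mu]_x (\1_(near b) x)%:E = mu (near b))%E.
      by rewrite integral_indic; do ?[exact: measurableT|exact: mnear|rewrite setIT].
    rewrite lebesgue_measure_itv /= lte_fin [in RHS]big_cons [in RHS]EFinD [in RHS]EFinM.
    congr (_ * _ + _)%E; move: h0; rewrite le_eqVlt => /orP[/eqP <-|h0].
      by rewrite subr0 addr0 ltxx mulr0.
    rewrite ifT; last lra.
    by rewrite -EFinB; congr EFin; ring.
  - by move=> x _; rewrite lee_fin mulr_ge0 // indicE ler0n.
  - apply/measurable_EFinP; apply: measurable_funM; first exact: measurable_cst.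
    exact: (measurable_indic (mnear _)).
  - move=> x _; rewrite lee_fin big_seq sumr_ge0 // => b' /sub'/Hs[w0' _].
    by rewrite mulr_ge0 // indicE ler0n.
  - apply/measurable_EFinP; apply: measurable_sum => b1.
    by apply: measurable_funM; [exact: measurable_cst|exact: (measurable_indic (mnear _))].
exists [set r | lam <= f r]; split => //; last by move=> r /negP; rewrite -ltNge -fE.
have := @le_integral_comp_abse _ _ R mu setT measurableT (EFin \o f) lam id.
have -> : [set: R] `&` [set x | (lam%:E <= `|(EFin \o f) x|)%E] = [set r | lam <= f r].
  by rewrite setTI; apply/seteqP; split => r /=; rewrite lee_fin ger0_norm.
move=> H; have {}H := le_trans (H _ _ _ _ lam0) intf.
have : (lam%:E * mu [set r | (lam <= f r)%R] <= A%:E)%E.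
  by apply: H => //; exact/measurable_EFinP.
have m0 : (0 <= mu [set r | (lam <= f r)%R])%E by exact: measure_ge0.
case: (mu _) m0 => [x| |] // _.
  by rewrite -EFinM !lee_fin ler_pdivlMr // mulrC.
by rewrite gt0_muley ?lte_fin // leye_eq.
Qed.

(** A sum of indicators with values doubling as the distance [d] is divided by
    four: it bounds the logarithm of [L / d] and its integral over [d] is at
    most a multiple of [L]. *)
Definition dyadic_weight L d (I : nat) : R :=
  \sum_(i < I) 2 ^+ i * (d <= L / 4 ^+ i)%R%:R.

Lemma dyadic_weight_ge0 L d I : 0 <= dyadic_weight L d I.
Proof. by apply: sumr_ge0 => i _; rewrite mulr_ge0 ?exprn_ge0. Qed.

Lemma ln_le_dyadic L d I : 0 < L -> L / 4 ^+ I < d ->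
  ln (1 + 6 * L / d) <= 10 * (1 + dyadic_weight L d I).
Proof.
move=> L0; elim: I => [|I IH] h.
  rewrite expr0 divr1 in h; have d0 : 0 < d by apply: lt_trans h.
  rewrite /dyadic_weight big_ord0 addr0 mulr1.
  have h1 : 6 * L / d <= 6.
    by rewrite ler_pdivrMr // ler_pM2l // ltW.
  have h0 : 0 < 6 * L / d by rewrite divr_gt0 // mulr_gt0.
  by apply: le_trans (le_ln1Dx _) _; [lra|lra].
rewrite /dyadic_weight big_ord_recr /= -/(dyadic_weight L d I).
have [dI|Id] := leP d (L / 4 ^+ I); last first.
  by rewrite mulr0 addr0; exact: IH.
have w0 := dyadic_weight_ge0 L d I.
have q0 : 0 < (4 : R) ^+ I by rewrite exprn_gt0.
have p0 : 0 < (2 : R) ^+ I by rewrite exprn_gt0.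
have p1 : 1 <= (2 : R) ^+ I by rewrite exprn_ege1 // ler1n.
have d0 : 0 < d by apply: lt_trans h; rewrite divr_gt0 // exprn_gt0.
have E4 : (4 : R) ^+ I = 2 ^+ I * 2 ^+ I by rewrite -exprMn -natrM.
have h1 : 6 * L / d <= 24 * 4 ^+ I.
  rewrite ler_pdivrMr //; move: h; rewrite exprS ltr_pdivrMr ?mulr_gt0 //.
  have -> : 24 * 4 ^+ I * d = 6 * (d * (4 * 4 ^+ I)) by ring.
  by move=> h; rewrite ler_pM2l // ltW.
have h0 : 0 < 6 * L / d by rewrite divr_gt0 // mulr_gt0.
have h2 : 1 + 6 * L / d <= (5 * 2 ^+ I) ^+ 2.
  have q1 : 1 <= (4 : R) ^+ I by rewrite exprn_ege1 // ler1n.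
  have -> : (5 * 2 ^+ I) ^+ 2 = 25 * 4 ^+ I :> R by rewrite E4; ring.
  lra.
have pos : 0 < 1 + 6 * L / d by lra.
have pos5 : 0 < 5 * 2 ^+ I :> R by lra.
apply: le_trans (_ : ln ((5 * 2 ^+ I) ^+ 2) <= _).
  by rewrite ler_ln // posrE exprn_gt0.
rewrite lnXn // mulr1 mulr2n; have := ln_sublinear pos5; lra.
Qed.

(** Markov's inequality for the sum of the dyadic weights of all the radii. The
    weight of a single radius is then bounded as well, which gives the
    separation. The linear dependence of the sum on the number of radii is
    essential: a bound radius by radius would cost a further logarithm. *)
Theorem radial_avoidance (rho : seq R) L lam : 0 < L -> 0 < lam ->
  let p := (size rho)%:R in
  exists Bad : set R, [/\ measurable Bad, (mu Bad <= (4 * L / lam)%:E)%E &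
    forall r, ~ Bad r ->
      (forall x, x \in rho -> L / (1 + 2 * lam * p) ^+ 2 < `|r - x|) /\
      \sum_(x <- rho) ln (1 + 6 * L / `|r - x|) <= 10 * (1 + lam) * p].
Proof.
move=> L0 lam0 p.
have [p0|p1] := posnP (size rho).
  move/size0nil: (p0) => ->; exists set0; split => //.
    by rewrite measure0 lee_fin divr_ge0 ?mulr_ge0 ?ltW.
  by move=> r _; split => //; rewrite big_nil mulr_ge0 // ?ler0n // mulr_ge0 //; lra.
have {}p1 : 1 <= p by rewrite ler1n.
have p0 : 0 < p by apply: lt_le_trans p1.
have lp0 : 0 < lam * p by rewrite mulr_gt0.
have exI : exists I, lam * p <= 2 ^+ I.
  exists (Num.bound (lam * p)); apply: le_trans (ltW (archi_boundP (ltW lp0))) _.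
  by rewrite -natrX ler_nat ltnW // ltn_expl.
have [I [hI1 hI2]] : exists I : nat, lam * p <= 2 ^+ I /\ 2 ^+ I <= 1 + 2 * lam * p :> R.
  exists (ex_minn exI); case: ex_minnP => I hI min; split => //.
  case: I hI min => [|I] hI min.
    by rewrite expr0 lerDl -mulrA mulr_ge0 // ltW.
  have : 2 ^+ I < lam * p by rewrite ltNge; apply/negP => /min; rewrite ltnn.
  by rewrite exprS -mulrA; lra.
pose s := [seq ((2 ^+ i, x), L / 4 ^+ i) | x <- rho, i <- index_iota 0 I.+1] : seq (R * R * R).
have tot : \sum_(b <- s) b.1.1 * (2 * b.2) <= 4 * L * p.
  rewrite /s big_allpairs_dep.
  have -> : 4 * L * p = \sum_(x <- rho) 4 * L by rewrite big_const_seq count_predT iter_addr_0 mulr_natr.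
  apply: ler_sum => x _.
  rewrite big_mkord (eq_bigr (fun i : 'I_I.+1 => 2 ^+ i * (2 * (L / 4 ^+ i)))) //.
  have -> : \sum_(i < I.+1) 2 ^+ i * (2 * (L / 4 ^+ i)) = 4 * L - 4 * L / 2 ^+ I.+1.
    elim: (I.+1) => [|J IH]; first by rewrite big_ord0 expr0 divr1 subrr.
    rewrite big_ord_recr IH /= exprS.
    have -> : (4 : R) ^+ J = 2 ^+ J * 2 ^+ J by rewrite -exprMn -natrM.
    by field; rewrite expf_neq0.
  by rewrite gerBl divr_ge0 ?mulr_ge0 ?exprn_ge0 // ltW.
have [|Bad [mBad BadL HBad]] := @weighted_intervals_markov s (4 * L * p) (lam * p) lp0 _ tot.
  by move=> b /allpairsP[[x i] [_ _ ->]] /=; rewrite exprn_ge0 // divr_ge0 ?exprn_ge0 // ltW.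
exists Bad; split => //.
  apply: le_trans BadL _; rewrite lee_fin le_eqVlt; apply/orP; left; apply/eqP.
  by field; rewrite !gt_eqF.
move=> r /HBad; rewrite /s big_allpairs_dep.
rewrite (eq_bigr (fun x => dyadic_weight L `|r - x| I.+1)) => [|x _]; last by rewrite big_mkord.
move=> H.
have far x : x \in rho -> L / 4 ^+ I < `|r - x|.
  move=> xr; rewrite ltNge; apply/negP => h; move: H; rewrite ltNge => /negP[].
  rewrite (big_rem x) //=; apply: le_trans hI1 _.
  apply: le_trans (_ : dyadic_weight L `|r - x| I.+1 <= _).
    rewrite /dyadic_weight big_ord_recr /= h mulr1 lerDr.
    exact: dyadic_weight_ge0.
  by rewrite lerDl sumr_ge0 // => y _; exact: dyadic_weight_ge0.
have q0 : 0 < (4 : R) ^+ I by rewrite exprn_gt0.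
have P0 : 0 < 1 + 2 * lam * p by rewrite -mulrA; lra.
split=> [x xr|].
  apply: le_lt_trans (far x xr); rewrite ler_pM2l // lef_pV2 ?posrE ?exprn_gt0 //.
  have -> : (4 : R) ^+ I = (2 ^+ I) ^+ 2 by rewrite expr2 -exprMn -natrM.
  by apply: lerXn2r; rewrite ?nnegrE ?exprn_ge0 // ltW.
apply: le_trans (_ : \sum_(x <- rho) 10 * (1 + dyadic_weight L `|r - x| I.+1) <= _).
  rewrite !big_seq; apply: ler_sum => x xr; apply: ln_le_dyadic => //.
  apply: le_lt_trans (far x xr); rewrite ler_pM2l // lef_pV2 ?posrE ?exprn_gt0 //.
  by rewrite exprS ler_peMl ?exprn_ge0 // ler1n.
rewrite -mulr_sumr big_split /= big_const_seq count_predT iter_addr_0.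
rewrite -mulrA ler_pM2l // mulrDl mul1r; apply: lerD => //.
exact: ltW.
Qed.

End RadialAverage.

(** * Lower bounds and local doubling away from the zeros *)

Section PolynomialEstimates.
Variable R : realType.
Notation C := (R[i]^o).
Implicit Types (z w a b c : C) (l : seq C) (r s t e x : R).
Local Notation mu := (@lebesgue_measure R).

Lemma entire_prod c l : entire (fun z => c * \prod_(a <- l) (z - a)).
Proof.
elim: l c => [|a l IH] c z.
  apply: (@hasder_derivable _ _ _ 0).
  have -> : (fun z => c * \prod_(a <- [::]) (z - a)) = (fun=> c).
    by apply: funext => w; rewrite big_nil mulr1.
  exact: hasder_cst.
have -> : (fun z => c * \prod_(a0 <- a :: l) (z - a0)) =
    (fun z => (z - a) * (c * \prod_(a0 <- l) (z - a0))).
  by apply: funext => w; rewrite big_cons mulrCA.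
have h := hasderM (hasderB (hasder_id z) (hasder_cst a z)) ((entireP _).1 (IH c) z).
exact: hasder_derivable h.
Qed.

Lemma prod_exp_ln (I : eqType) (s : seq I) (F : I -> R) :
  (forall i, i \in s -> 0 < F i) ->
  \prod_(i <- s) F i = expR (\sum_(i <- s) ln (F i)).
Proof.
elim: s => [|i s IH] H; first by rewrite !big_nil expR0.
rewrite !big_cons expRD IH => [|j js]; last by apply: H; rewrite inE js orbT.
by rewrite lnK // posrE H // mem_head.
Qed.

Lemma prod_cst (I : Type) (s : seq I) x : \prod_(i <- s) x = x ^+ size s.
Proof. by rewrite big_const_seq count_predT iter_mulr_1. Qed.

Lemma ler_prod_seq (I : eqType) (s : seq I) (F G : I -> R) :
  (forall i, i \in s -> 0 <= F i <= G i) ->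
  \prod_(i <- s) F i <= \prod_(i <- s) G i.
Proof.
by move=> H; rewrite !big_seq; apply: ler_prod => i; exact: H.
Qed.

(** The Blaschke factor of a zero [a], compared with the distance of [a] to
    the circle through [z]: outside the window of width [L] its contribution
    is bounded, whatever the ratio of the radius to [L]. *)
Lemma blaschke_bound rho L a z : 0 < L -> 4 * L <= rho ->
  rho - 3 * L <= cabs z <= rho - 2 * L -> cabs a <= rho - L ->
  0 < `|cabs z - cabs a| ->
  cabs ((rho ^+ 2)%:C%C - conjc a * z) <=
  rho * cabs (z - a) * (1 + 6 * L / `|cabs z - cabs a|).
Proof.
move=> L0 LR /andP[z1 z2] aR; set d := `|_| => d0.
have R0 : 0 < rho by lra.
have x0 : 0 <= 6 * L / d by rewrite divr_ge0 ?mulr_ge0 // ltW.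
have a0 := cabs_ge0 a; have z0 := cabs_ge0 z.
have dz : d <= cabs (z - a).
  rewrite ler_norml; apply/andP; split; last exact: cabsBl.
  by rewrite lerNl opprB cabsB; exact: cabsBl.
rewrite -(@ler_pXn2r _ 2) ?nnegrE ?cabs_ge0 ?mulr_ge0 ?cabs_ge0 ?(ltW R0) ?addr_ge0 //.
rewrite reflected_factor_sqr.
set m := cabs (z - a) in dz *.
have h1 : rho ^+ 2 - cabs z ^+ 2 <= 6 * L * rho.
  have -> : rho ^+ 2 - cabs z ^+ 2 = (rho - cabs z) * (rho + cabs z) by ring.
  have -> : 6 * L * rho = (3 * L) * (2 * rho) by ring.
  by apply: ler_pM; lra.
have dm : rho - cabs a <= 3 * L + d.
  by have := ler_norm (cabs z - cabs a); rewrite -/d; lra.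
have h2 : rho ^+ 2 - cabs a ^+ 2 <= 2 * rho * (3 * L + d).
  have -> : rho ^+ 2 - cabs a ^+ 2 = (rho - cabs a) * (rho + cabs a) by ring.
  by rewrite [leRHS]mulrC; apply: ler_pM; lra.
have h3 : 0 <= rho ^+ 2 - cabs z ^+ 2.
  have -> : rho ^+ 2 - cabs z ^+ 2 = (rho - cabs z) * (rho + cabs z) by ring.
  by apply: mulr_ge0; lra.
have h4 : 0 <= rho ^+ 2 - cabs a ^+ 2.
  have -> : rho ^+ 2 - cabs a ^+ 2 = (rho - cabs a) * (rho + cabs a) by ring.
  by apply: mulr_ge0; lra.
apply: le_trans (lerD (lexx _) (ler_pM h3 h4 h1 h2)) _.
have -> : (rho * m * (1 + 6 * L / d)) ^+ 2 =
  (rho * m) ^+ 2 + rho ^+ 2 * (m / d) ^+ 2 * (12 * L * (3 * L + d)).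
  by field; rewrite gt_eqF.
rewrite lerD2l.
have -> : 6 * L * rho * (2 * rho * (3 * L + d)) = rho ^+ 2 * 1 * (12 * L * (3 * L + d)) by ring.
apply: ler_wpM2r.
  by apply: mulr_ge0; [rewrite mulr_ge0 // ltW|lra].
rewrite ler_wpM2l ?sqr_ge0 // -[leLHS](expr1n _ 2).
apply: lerXn2r; rewrite ?nnegrE ?divr_ge0 ?cabs_ge0 ?(ltW d0) //.
by rewrite ler_pdivlMr // mul1r.
Qed.

(** Shifting the argument by [s] changes [|z - a| / |rho^2 - conj(a) z|] by a
    factor close to [1] when [s] is small against the distance to [a]. *)
Lemma blaschke_shift rho L a z w s del : 0 < L -> L < rho ->
  cabs a <= rho - L -> cabs w <= rho - L -> cabs (w - z) <= s -> 0 < del -> del <= cabs (z - a) ->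
  cabs (w - a) * cabs ((rho ^+ 2)%:C%C - conjc a * z) <=
  cabs (z - a) * cabs ((rho ^+ 2)%:C%C - conjc a * w) * ((1 + s / del) * (1 + s / L)).
Proof.
move=> L0 LR aR wR ws del0 dz; set q := (rho ^+ 2)%:C%C.
have R0 : 0 < rho by lra.
have s0 : 0 <= s by apply: le_trans ws; exact: cabs_ge0.
have h1 : cabs (w - a) <= cabs (z - a) * (1 + s / del).
  have -> : w - a = (w - z) + (z - a) by rewrite addrA subrK.
  apply: le_trans (cabsD _ _) _; rewrite mulrDr mulr1 addrC lerD2l.
  apply: le_trans ws _; rewrite mulrCA ler_peMr //.
  by rewrite ler_pdivlMr // mul1r.
have qw : rho * L <= cabs (q - conjc a * w).
  apply: le_trans (cabsBl _ _); rewrite cabsM cabs_conj cabs_real ger0_norm ?sqr_ge0 //.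
  have : cabs a * cabs w <= (rho - L) * (rho - L) by apply: ler_pM; rewrite ?cabs_ge0.
  have : 0 <= L * (rho - L) by rewrite mulr_ge0 //; lra.
  have -> : (rho - L) * (rho - L) = rho ^+ 2 - rho * L - L * (rho - L) by ring.
  lra.
have h2 : cabs (q - conjc a * z) <= cabs (q - conjc a * w) * (1 + s / L).
  have -> : q - conjc a * z = (q - conjc a * w) + conjc a * (w - z) by ring.
  apply: le_trans (cabsD _ _) _; rewrite [leRHS]mulrDr mulr1 lerD2l cabsM cabs_conj.
  apply: le_trans (_ : rho * s <= _).
    by apply: ler_pM; rewrite ?cabs_ge0 //; lra.
  have -> : rho * s = rho * L * (s / L) by field; rewrite gt_eqF.
  by rewrite ler_wpM2r // divr_ge0 // ltW.
apply: le_trans (ler_pM (cabs_ge0 _) (cabs_ge0 _) h1 h2) _.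
by rewrite le_eqVlt; apply/orP; left; apply/eqP; ring.
Qed.

Lemma shift_radius (L lam p Y : R) : 0 < L -> 0 < lam -> 0 <= p -> p <= Y ->
  let s := L / (8 * (1 + lam) ^+ 2 * (1 + Y) ^+ 3) in
  [/\ 0 < s, s <= L / 8, 4 * s * Y <= L &
      p * (2 * (s / (L / (1 + 2 * lam * p) ^+ 2))) <= 1].
Proof.
move=> L0 lam0 p0 pY s.
have lam1 : 1 <= 1 + lam by lra.
have Y0 : 0 <= Y by apply: le_trans pY.
have Y1 : 1 <= 1 + Y by lra.
have l0 : 0 < 1 + lam by lra.
have y0 : 0 < 1 + Y by lra.
have A1 : 1 <= (1 + lam) ^+ 2 by rewrite exprn_ege1.
have B1 : 1 <= (1 + Y) ^+ 2 by rewrite exprn_ege1.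
have C1 : 1 <= (1 + Y) ^+ 3 by rewrite exprn_ege1.
have den0 : 0 < 8 * (1 + lam) ^+ 2 * (1 + Y) ^+ 3.
  by rewrite !mulr_gt0 ?exprn_gt0.
have den8 : 8 <= 8 * (1 + lam) ^+ 2 * (1 + Y) ^+ 3.
  by rewrite -mulrA ler_peMr // mulr_ege1.
have lp : 0 <= lam * p by rewrite mulr_ge0 // ltW.
have D0 : 0 < 1 + 2 * lam * p by rewrite -mulrA; lra.
split.
- by rewrite divr_gt0.
- by rewrite /s ler_wpM2l ?(ltW L0) // lef_pV2 ?posrE.
- have -> : 4 * s * Y = 4 * Y * L / (8 * (1 + lam) ^+ 2 * (1 + Y) ^+ 3) by rewrite /s; ring.
  rewrite ler_pdivrMr // mulrC ler_wpM2l ?(ltW L0) //.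
  have h : 1 * (1 + Y) <= (1 + lam) ^+ 2 * (1 + Y) ^+ 3.
    by apply: ler_pM => //; [lra|rewrite exprS ler_peMr // ltW].
  by rewrite -mulrA; lra.
have -> : p * (2 * (s / (L / (1 + 2 * lam * p) ^+ 2))) =
    2 * p * (1 + 2 * lam * p) ^+ 2 / (8 * (1 + lam) ^+ 2 * (1 + Y) ^+ 3).
  by rewrite /s; field; rewrite !gt_eqF ?exprn_gt0.
rewrite ler_pdivrMr // mul1r.
have q1 : 1 + 2 * lam * p <= 2 * ((1 + lam) * (1 + Y)).
  have h1 : lam * p <= lam * Y by rewrite ler_wpM2l // ltW.
  have -> : 2 * ((1 + lam) * (1 + Y)) = 2 + 2 * lam + 2 * Y + 2 * (lam * Y) by ring.
  by rewrite -mulrA; lra.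
have q2 : (1 + 2 * lam * p) ^+ 2 <= (2 * ((1 + lam) * (1 + Y))) ^+ 2.
  by apply: lerXn2r; rewrite ?nnegrE ?mulr_ge0 ?(ltW D0) ?(ltW l0) ?(ltW y0).
have -> : 8 * (1 + lam) ^+ 2 * (1 + Y) ^+ 3 = 2 * (1 + Y) * (2 * ((1 + lam) * (1 + Y))) ^+ 2 by ring.
by apply: ler_pM => //; [lra|exact: sqr_ge0|lra].
Qed.

(** Harnack's inequality on a disc of radius [L] makes a zero-free polynomial
    nearly constant on a much smaller concentric disc. *)
Lemma harnack_local c l z (L N U s : R) : c != 0 -> 0 < L ->
  (forall b, b \in l -> L < cabs (b - z)) ->
  let Q u := c * \prod_(b <- l) (u - b) in
  (forall u, cabs (u - z) = L -> cabs (Q u) <= expR N) ->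
  0 < cabs (Q z) -> cabs (Q z) <= expR N -> N - ln (cabs (Q z)) <= U ->
  0 <= s -> 2 * s * U <= L ->
  forall w, cabs (w - z) <= s -> cabs (w - z) < L ->
  cabs (Q w) <= expR 1 * cabs (Q z).
Proof.
move=> c0 L0 Hl Q HN Qz0 QzN QzU s0 sU w ws wL.
have [_ H2] := harnack c0 L0 Hl HN wL.
rewrite subrKC -/(Q w) -/(Q z) in H2.
have U0 : 0 <= N - ln (cabs (Q z)) by rewrite subr_ge0 -ler_expR lnK ?posrE.
have Qw0 : 0 < cabs (Q w).
  rewrite cabs_gt0 mulf_neq0 // prodf_seq_neq0; apply/allP => b bl /=.
  rewrite subr_eq0; apply/eqP => wb; move: wL; rewrite wb => h.
  by have := lt_trans h (Hl b bl); rewrite ltxx.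
rewrite -[leLHS]lnK ?posrE // -[cabs (Q z)]lnK ?posrE // -expRD ler_expR.
have h0 := cabs_ge0 (w - z).
move: (cabs (w - z)) (ln (cabs (Q w))) (ln (cabs (Q z))) h0 ws wL H2 U0 QzU => h qw qz.
move=> {HN Hl Qz0 QzN Qw0} h0 hs hL H2 u0 uU.
have [u uE] : exists u, u = N - qz by exists (N - qz).
rewrite -uE in H2 u0 uU.
have Lh : 0 < L + h by lra.
have E2 : 2 * h * u <= L + h.
  apply: le_trans (_ : 2 * s * U <= _); last lra.
  by apply: ler_pM => //; lra.
have : (L - h) / (L + h) * u = u - (2 * h * u) / (L + h) by field; rewrite gt_eqF.
have : (2 * h * u) / (L + h) <= 1 by rewrite ler_pdivrMr // mul1r.
lra.
Qed.

(** Reflecting the zeros in the disc of radius [rho - L] leaves a zero-free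
    polynomial, to which Harnack's inequality applies, times Blaschke factors.
    There are at most a multiple of [Y] such zeros, by comparing the value at
    the origin with the maximum on the circle, and [radial_avoidance] for their
    moduli bounds the product of the factors. *)
Theorem poly_estimates c l rho L N lam : 0 < L -> 4 * L <= rho -> 0 < lam ->
  let P z := c * \prod_(a <- l) (z - a) in P 0 != 0 ->
  (forall z, cabs z = rho -> cabs (P z) <= expR N) ->
  let N' := N + ln (2 * rho / L) in let X := N' - ln (cabs (P 0)) in
  let Y := rho / L * X in
  0 <= X /\
  exists Bad : set R, [/\ measurable Bad, (mu Bad <= (4 * L / lam)%:E)%E &
    forall z, ~ Bad (cabs z) -> rho - 3 * L <= cabs z <= rho - 2 * L ->
      [/\ P z != 0, N' - 12 * (1 + lam) * Y <= ln (cabs (P z)) &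
      forall w, cabs (w - z) <= L / (8 * (1 + lam) ^+ 2 * (1 + Y) ^+ 3) ->
        cabs (P w) <= expR 2 * cabs (P z)]].
Proof.
move=> L0 LR lam0 P P0 PN N' X Y.
have R0 : 0 < rho by lra.
pose R1 := rho - L; have R10 : 0 < R1 by rewrite /R1; lra.
pose inn a := cabs a <= R1.
pose nr := [seq a <- l | inn a]; pose fr := [seq a <- l | ~~ inn a].
have nrP a : a \in nr -> cabs a <= R1 by rewrite mem_filter => /andP[].
have frP a : a \in fr -> R1 < cabs a by rewrite mem_filter /inn -ltNge => /andP[].
have PE z : P z = c * \prod_(a <- fr) (z - a) * \prod_(a <- nr) (z - a).
  by rewrite /P (bigID inn) /= /fr /nr !big_filter; ring.
have nr0 a : a \in nr -> a != 0.
  move=> an; apply: contraNneq P0 => a0; rewrite PE mulf_eq0; apply/orP; right.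
  by rewrite (big_rem a) //= a0 subr0 mul0r.
have cn0 : c != 0 by apply: contraNneq P0; rewrite /P => ->; rewrite mul0r.
pose beta a z : C := ((rho ^+ 2)%:C%C - conjc a * z) / rho%:C%C.
have cR : rho%:C%C != 0 :> C by rewrite -cabs_gt0 cabs_real gtr0_norm.
pose Q z := c * \prod_(a <- fr) (z - a) * \prod_(a <- nr) beta a z.
pose c' := c * \prod_(a <- nr) (- conjc a / rho%:C%C).
pose l' := fr ++ [seq (rho ^+ 2)%:C%C / conjc a | a <- nr].
have QE z : Q z = c' * \prod_(b <- l') (z - b).
  rewrite /Q /c' /l' big_cat big_map /= -!mulrA; congr (_ * _).
  rewrite [RHS]mulrCA; congr (_ * _); rewrite -big_split /= !big_seq.
  apply: eq_bigr => a an; have a0 := nr0 a an.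
  by rewrite /beta reflected_factorE // (gt_eqF R0).
have c'0 : c' != 0.
  rewrite mulf_neq0 // prodf_seq_neq0; apply/allP => a /nr0 a0 /=.
  by rewrite mulf_neq0 ?invr_eq0 // oppr_eq0 conjc_eq0.
have l'P b : b \in l' -> R1 < cabs b.
  rewrite mem_cat => /orP[/frP //|/mapP[a an ->]].
  have a0 : 0 < cabs a by rewrite cabs_gt0; exact: nr0.
  rewrite cabsM cabsV cabs_conj cabs_real ger0_norm ?sqr_ge0 // ltr_pdivlMr //.
  have := nrP a an => h; apply: le_lt_trans (_ : R1 * R1 < _).
    by rewrite ler_wpM2l // ltW.
  by rewrite -expr2 ltrXn2r ?nnegrE ?ltW // /R1; lra.
have eQ : entire Q by have -> : Q = (fun z => c' * \prod_(b <- l') (z - b)) by [apply: funext|]; exact: entire_prod.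
pose F z := cabs (c * \prod_(a <- fr) (z - a)).
pose pz z := \prod_(a <- nr) cabs (z - a).
pose bz z := \prod_(a <- nr) cabs (beta a z).
have aP z : cabs (P z) = F z * pz z by rewrite PE cabsM cabs_prod.
have aQ z : cabs (Q z) = F z * bz z by rewrite /Q cabsM cabs_prod.
have F0 z : 0 <= F z by exact: cabs_ge0.
have abeta a z : cabs (beta a z) = cabs ((rho ^+ 2)%:C%C - conjc a * z) / rho.
  by rewrite cabsM cabsV cabs_real gtr0_norm.
have QN z : cabs z = rho -> cabs (Q z) <= expR N.
  move=> zR; rewrite aQ; have -> : bz z = pz z; last by rewrite -aP PN.
  apply: eq_bigr => a _; rewrite abeta.
  have -> : cabs ((rho ^+ 2)%:C%C - conjc a * z) = rho * cabs (z - a).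
    apply/eqP; rewrite -(@eqrXn2 _ 2) ?cabs_ge0 ?mulr_ge0 ?cabs_ge0 ?(ltW R0) //.
    by rewrite reflected_factor_sqr zR subrr mul0r addr0.
  by rewrite mulrAC divff ?mul1r // gt_eqF.
have x20 : 0 < 2 * rho / L by rewrite divr_gt0 // mulr_gt0.
have QN' z : cabs z <= R1 -> cabs (Q z) <= expR N'.
  move=> zR; have zR' : cabs z < rho by apply: le_lt_trans zR _; rewrite /R1; lra.
  apply: le_trans (cauchy_bound R0 eQ zR' QN) _.
  rewrite /N' expRD lnK ?posrE //.
  have -> : expR N * (2 * rho / L) = 2 * expR N * rho * L^-1 by ring.
  apply: ler_wpM2l; first by rewrite !mulr_ge0 ?expR_ge0 ?(ltW R0).
  rewrite lef_pV2 ?posrE ?subr_gt0 //; rewrite /R1 in zR; lra.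
have Qn0 z : cabs z <= R1 -> 0 < cabs (Q z).
  move=> zR; rewrite cabs_gt0 QE mulf_neq0 // prodf_seq_neq0; apply/allP => b /l'P bR /=.
  by rewrite subr_eq0; apply: contraTneq zR => ->; rewrite -ltNge.
pose p : R := (size nr)%:R.
have p0 : 0 <= p by exact: ler0n.
have aP0 : 0 < cabs (P 0) by rewrite cabs_gt0.
have LRx : 0 < rho / L by rewrite divr_gt0.
have Q00 : cabs (0 : C) <= R1 by rewrite cabs0 ltW.
have bz0 : bz 0 = rho ^+ size nr.
  rewrite /bz -prod_cst ; apply: eq_bigr => a _.
  by rewrite abeta mulr0 subr0 cabs_real ger0_norm ?sqr_ge0 // expr2 mulfK // gt_eqF.
have count : p * (L / rho) <= X.
  have pz0 : pz 0 <= R1 ^+ size nr.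
    rewrite /pz -prod_cst; apply: ler_prod_seq => a /nrP aR.
    by rewrite cabs_ge0 sub0r cabsN.
  have h : cabs (P 0) <= expR N' * (R1 / rho) ^+ size nr.
    rewrite expr_div_n mulrA ler_pdivlMr ?exprn_gt0 // -bz0 mulrC aP mulrA [_ * F 0]mulrC -aQ.
    by apply: ler_pM; rewrite ?cabs_ge0 ?QN' // prodr_ge0 // => a _; exact: cabs_ge0.
  have R1R : R1 / rho = 1 - L / rho by rewrite /R1 mulrBl divff // gt_eqF.
  have h' : (R1 / rho) ^+ size nr <= expR (- (p * (L / rho))).
    have -> : expR (- (p * (L / rho))) = expR (- (L / rho)) ^+ size nr.
      by rewrite -expRM_natl mulrN.
    apply: lerXn2r; rewrite ?nnegrE ?expR_ge0 ?divr_ge0 ?(ltW R10) ?(ltW R0) //.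
    by rewrite R1R; exact: expR_ge1Dx.
  have : cabs (P 0) <= expR (N' - p * (L / rho)).
    by apply: le_trans h _; rewrite expRD ler_wpM2l ?expR_ge0.
  by rewrite -[cabs (P 0)]lnK ?posrE // ler_expR /X; lra.
have X0 : 0 <= X by apply: le_trans count; rewrite mulr_ge0 // divr_ge0 ?ltW.
have Y0 : 0 <= Y by rewrite mulr_ge0 // ltW.
have pY : p <= Y.
  rewrite /Y; have -> : p = rho / L * (p * (L / rho)) by field; rewrite !gt_eqF.
  by rewrite ler_wpM2l // ltW.
split => //.
have [Bad [mBad BadL HBad]] := radial_avoidance [seq cabs a | a <- nr] L0 lam0.
exists Bad; split => // z /HBad; rewrite size_map big_map -/p => -[far sm] zI.
have /andP[z1 z2] := zI.
have zR1 : cabs z < R1 by move: L0 z2; rewrite /R1; clear; lra.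
pose del := L / (1 + 2 * lam * p) ^+ 2.
have lp0 : 0 <= 2 * lam * p by rewrite !mulr_ge0 // ltW.
have del0 : 0 < del by rewrite divr_gt0 // exprn_gt0 // ltr_wpDr.
have dist a : a \in nr -> del < `|cabs z - cabs a|.
  by move=> an; apply: far; rewrite map_f.
have distz a : a \in nr -> del < cabs (z - a).
  move=> /dist h; apply: lt_le_trans h _.
  rewrite ler_norml; apply/andP; split; last exact: cabsBl.
  by rewrite lerNl opprB cabsB; exact: cabsBl.
have Pz0 : P z != 0.
  rewrite PE mulf_neq0 //; last first.
    rewrite prodf_seq_neq0; apply/allP => a /distz h /=.
    by rewrite -cabs_gt0; apply: lt_trans h.
  rewrite mulf_neq0 // prodf_seq_neq0; apply/allP => a /frP h /=.
  by rewrite subr_eq0; apply: contraTneq zR1 => ->; rewrite -leNgt ltW.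
have aPz : 0 < cabs (P z) by rewrite cabs_gt0.
have Q0P0 : cabs (P 0) <= cabs (Q 0).
  rewrite aP aQ bz0 ler_wpM2l // -prod_cst; apply: ler_prod_seq => a /nrP aR.
  by rewrite cabs_ge0 sub0r cabsN /=; move: L0 aR; rewrite /R1; clear; lra.
have uz : N' - ln (cabs (Q z)) <= 2 * Y.
  have H0 b : b \in l' -> R1 < cabs (b - 0) by rewrite subr0; exact: l'P.
  have [|H1 _] := harnack c'0 R10 H0 (N := N') _ zR1.
    by move=> x; rewrite subr0 => xR; rewrite -QE QN' ?xR.
  rewrite add0r -!QE in H1; apply: le_trans H1 _.
  have -> : 2 * Y = 2 * rho / L * X by rewrite /Y; ring.
  have X1 : N' - ln (cabs (Q 0)) <= X.
    by rewrite /X lerD2l lerN2 ler_ln // posrE Qn0.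
  have X2 : 0 <= N' - ln (cabs (Q 0)).
    by rewrite subr_ge0 -ler_expR lnK ?posrE ?Qn0 // QN'.
  have z0 := cabs_ge0 z.
  have zz : 0 < R1 - cabs z by rewrite subr_gt0.
  apply: ler_pM => //; first by apply: divr_ge0; [rewrite addr_ge0 // ltW|exact: ltW].
  apply: ler_pM; rewrite ?invr_ge0 ?(ltW zz) //.
  - by rewrite addr_ge0 // ltW.
  - by move: L0 z2; rewrite /R1; clear; lra.
  - by rewrite lef_pV2 ?posrE //; move: L0 z2; rewrite /R1; clear; lra.
split => //.
  have QP : cabs (Q z) <= cabs (P z) * expR (10 * (1 + lam) * p).
    rewrite aQ aP -mulrA ler_wpM2l //.
    apply: le_trans (_ : pz z * \prod_(a <- nr) (1 + 6 * L / `|cabs z - cabs a|) <= _).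
      rewrite /pz -big_split /=; apply: ler_prod_seq => a an; rewrite cabs_ge0 /=.
      rewrite abeta ler_pdivrMr // [leRHS]mulrC mulrA.
      apply: blaschke_bound => //; first exact: nrP.
      exact: lt_trans (dist a an).
    rewrite ler_wpM2l ?prodr_ge0 //; first by move=> a _; exact: cabs_ge0.
    rewrite prod_exp_ln ?ler_expR // => a an.
    rewrite ltr_wpDr // divr_ge0 ?mulr_ge0 //; first exact: ltW.
  have := ler_ln (Qn0 z (ltW zR1)) (mulr_gt0 aPz (expR_gt0 (10 * (1 + lam) * p))).
  rewrite QP lnM ?posrE ?expR_gt0 // expRK => h.
  have pY' : 10 * (1 + lam) * p <= 10 * (1 + lam) * Y.
    by rewrite ler_wpM2l // mulr_ge0 // addr_ge0 // ltW.
  have -> : 12 * (1 + lam) * Y = 10 * (1 + lam) * Y + 2 * Y + 2 * (lam * Y) by ring.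
  have : 0 <= lam * Y by rewrite mulr_ge0 // ltW.
  by move: h uz pY'; clear; lra.
set s := L / _ => w ws.
have [s0 sL YY sdel] := shift_radius L0 lam0 p0 pY.
rewrite -/s -/del in s0 sL YY sdel.
have wR1 : cabs w <= R1.
  have : cabs w <= cabs z + cabs (w - z) by rewrite -{1}(subrKC z w) cabsD.
  by move: L0 ws sL z2; rewrite /R1; clear; lra.
have Qw : cabs (Q w) <= expR 1 * cabs (Q z).
  have HL b : b \in l' -> L < cabs (b - z).
    by move=> /l'P; have := cabsBl b z; move: z2; rewrite /R1; clear; lra.
  have HN (u : C) : cabs (u - z) = L -> cabs (c' * \prod_(b <- l') (u - b)) <= expR N'.
    move=> uL; rewrite -QE; apply: QN'.
    have : cabs u <= cabs z + cabs (u - z) by rewrite -{1}(subrKC z u) cabsD.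
    by rewrite uL; move: L0 z2; rewrite /R1; clear; lra.
  rewrite !QE; apply: (harnack_local (N := N') (U := 2 * Y) (s := s) c'0 L0 HL HN).
  - by rewrite -QE; exact: Qn0 (ltW zR1).
  - by rewrite -QE; exact: QN' (ltW zR1).
  - by rewrite -QE.
  - exact: ltW.
  - by have -> : 2 * s * (2 * Y) = 4 * s * Y by ring.
  - exact: ws.
  - by apply: (le_lt_trans ws); apply: (le_lt_trans sL); rewrite ltr_pdivrMr // ltr_pMr // ltr1n.
pose K := (1 + s / del) * (1 + s / L).
have K0 : 0 <= K by rewrite mulr_ge0 // addr_ge0 // divr_ge0 // ltW.
have prodK : pz w * bz z <= pz z * bz w * K ^+ size nr.
  rewrite -prod_cst /pz /bz -!big_split /=; apply: ler_prod_seq => a an.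
  rewrite mulr_ge0 ?cabs_ge0 //= !abeta.
  have h := blaschke_shift L0 (_ : L < rho) (nrP a an) wR1 ws del0 (ltW (distz a an)).
  have Rv : 0 <= rho^-1 by rewrite invr_ge0 ltW.
  have -> : cabs (w - a) * (cabs ((rho ^+ 2)%:C%C - conjc a * z) / rho) =
    (cabs (w - a) * cabs ((rho ^+ 2)%:C%C - conjc a * z)) / rho by ring.
  have -> : cabs (z - a) * (cabs ((rho ^+ 2)%:C%C - conjc a * w) / rho) * K =
    (cabs (z - a) * cabs ((rho ^+ 2)%:C%C - conjc a * w) * K) / rho by ring.
  by apply: ler_wpM2r => //; apply: h; move: L0 LR; clear; lra.
have Ke : K ^+ size nr <= expR 1.
  have k1 : K <= expR (s / del + s / L).
    have h0 x : 0 < x -> 0 <= 1 + s / x by move=> x0; rewrite addr_ge0 // divr_ge0 // ltW.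
    by rewrite expRD; apply: ler_pM; [exact: h0|exact: h0|exact: expR_ge1Dx|exact: expR_ge1Dx].
  apply: le_trans (_ : expR (s / del + s / L) ^+ size nr <= _).
    by apply: lerXn2r; rewrite ?nnegrE ?expR_ge0.
  rewrite -expRM_natl ler_expR -/p.
  have delL : del <= L.
    rewrite /del ler_pdivrMr ?exprn_gt0 ?ltr_wpDr //.
    by rewrite ler_peMr ?(ltW L0) // exprn_ege1 // lerDl.
  have h1 : s / L <= s / del by rewrite ler_wpM2l ?(ltW s0) // lef_pV2 ?posrE.
  apply: le_trans (_ : p * (2 * (s / del)) <= _).
    by rewrite ler_wpM2l //; move: h1; clear; lra.
  exact: sdel.
have bn0 u : cabs u <= R1 -> 0 < bz u.
  move=> /Qn0; rewrite aQ => h.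
  rewrite lt_neqAle eq_sym; apply/andP; split; last by apply: prodr_ge0 => a _; exact: cabs_ge0.
  by apply: contraTneq h => ->; rewrite mulr0 ltxx.
have bw := bn0 w wR1; have bzz := bn0 z (ltW zR1).
rewrite -(ler_pM2r bzz) -(ler_pM2r bw).
have pzz : 0 <= pz z by apply: prodr_ge0 => a _; exact: cabs_ge0.
have -> : cabs (P w) * bz z * bz w = cabs (Q w) * (pz w * bz z) by rewrite aP aQ; ring.
apply: le_trans (ler_pM (cabs_ge0 _) _ Qw prodK) _.
  by rewrite mulr_ge0 ?(ltW bzz) // prodr_ge0 // => a _; exact: cabs_ge0.
have -> : expR 1 * cabs (Q z) * (pz z * bz w * K ^+ size nr) =
  expR 1 * (cabs (P z) * bz z * bz w) * K ^+ size nr by rewrite aP aQ; ring.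
have -> : expR 2 * cabs (P z) * bz z * bz w =
  expR 1 * (cabs (P z) * bz z * bz w) * expR 1.
  by rewrite -[2%R]/(1 + 1)%R expRD; ring.
by rewrite ler_wpM2l // !mulr_ge0 ?expR_ge0 ?cabs_ge0 // ltW.
Qed.

End PolynomialEstimates.

Section EntireEstimates.
Variable R : realType.
Notation C := (R[i]^o).
Implicit Types (z w c : C) (r s x : R).
Local Notation mu := (@lebesgue_measure R).

Lemma norm_ln_bound x : 0 < x -> - ln x <= `|ln x|.
Proof. by move=> _; rewrite -normrN ler_norm. Qed.

Lemma ln2_le1 : ln 2 <= 1 :> R.
Proof. by have := @le_ln1Dx R 1; rewrite -[1 + 1]/2%:R; apply; lra. Qed.

Lemma expRD1 (x : R) : 0 <= x -> expR x + 1 <= expR (x + 1).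
Proof.
move=> x0; have e1 : 1 <= expR x by rewrite -expR0 ler_expR.
have e2 : 2 <= expR 1 :> R by have := expR_ge1Dx (1 : R); lra.
rewrite expRD; apply: le_trans (_ : expR x * 2 <= _); first lra.
by rewrite ler_wpM2l // expR_ge0.
Qed.

Lemma exprD_expR (r s : R) k : 1 <= r -> 0 <= s -> k%:R * s <= 1 ->
  (r + s) ^+ k <= r ^+ k * expR 1.
Proof.
move=> r1 s0 ks; have r0 : 0 < r by apply: lt_le_trans r1.
apply: le_trans (_ : (r * expR s) ^+ k <= _).
  apply: lerXn2r; rewrite ?nnegrE ?mulr_ge0 ?expR_ge0 ?addr_ge0 ?(ltW r0) //.
  apply: le_trans (_ : r * (1 + s) <= _); last by rewrite ler_wpM2l ?(ltW r0) ?expR_ge1Dx.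
  by rewrite mulrDr mulr1 lerD2l ler_peMl.
by rewrite exprMn ler_wpM2l ?exprn_ge0 ?(ltW r0) // -expRM_natl ler_expR.
Qed.

(** The polynomials of [factored_approx] have a fixed lowest coefficient, so the
    constants of [poly_estimates] do not depend on the degree of approximation.
    The lower bound is linear in [Z]: for the coefficient [A_0] it will
    determine the final order of magnitude. In the derivatives a power of [Z] is
    harmless, since only its logarithm will count; they come from Cauchy's
    estimate on a disc where the polynomial grows by a bounded factor. *)
Theorem entire_radial_estimates (g : C -> C) (n : nat) (eta : R) :
  entire g -> (exists z, g z != 0) -> 0 < eta ->
  exists2 K : R, 1 <= K & forall rho L N : R, 0 < L -> 4 <= rho -> 4 * L <= rho ->
    0 <= N -> 1 <= L * (N + 1) -> ln (rho / L) <= N -> (forall z, cabs z <= rho -> cabs (g z) <= expR N) ->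
    let Z := rho / L * (N + 1) in
    exists Bad : set R, [/\ measurable Bad, (mu Bad <= (eta * L)%:E)%E &
      forall z, ~ Bad (cabs z) -> rho - 3 * L <= cabs z <= rho - 2 * L ->
        [/\ g z != 0, - (K * Z) <= ln (cabs (g z)) &
        forall j, (j <= n)%N ->
          cabs (derive1n j g z) <= (K * Z ^+ 4) ^+ j * cabs (g z)]].
Proof.
move=> eg gn0 eta0.
have [k [c0 c00 Happ]] := factored_approx eg gn0.
pose lam := 4 / eta; have lam0 : 0 < lam by rewrite divr_gt0.
pose A := 3 + `|ln (cabs c0)|.
have A3 : 3 <= A by rewrite lerDl.
pose E3 : R := 2 * expR 3 + 1.
have E30 : 1 <= E3 by rewrite lerDr mulr_ge0 // expR_ge0.
pose K1 := 12 * (1 + lam) * A + 1.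
have K10 : 1 <= K1 by rewrite lerDr !mulr_ge0 // addr_ge0 // ltW.
pose K2 := 8 * (1 + lam) ^+ 2 * (1 + k%:R) * (1 + A) ^+ 3.
have lam1 : 1 <= 1 + lam by rewrite lerDl ltW.
have k1 : 1 <= 1 + k%:R :> R by rewrite lerDl.
have A1 : 1 <= 1 + A by rewrite lerDl (le_trans _ A3).
have K20 : 1 <= K2.
  by rewrite /K2 !mulr_ege1 // ?exprn_ege1 // ler1n.
pose K3 := 2 * n.+1%:R * E3 * K2.
have E31 : 0 <= E3 := le_trans ler01 E30.
have K21 : 0 <= K2 := le_trans ler01 K20.
have K11 : 0 <= K1 := le_trans ler01 K10.
have K30 : 0 <= K3 by apply: mulr_ge0 => //; apply: mulr_ge0 => //; apply: mulr_ge0.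
exists (K1 + K3); first by apply: le_trans K10 _; rewrite lerDl.
move=> rho L N L0 R4 LR N0 LN lnN gN Z.
have R0 : 0 < rho by move: R4; clear; lra.
have RL : 4 <= rho / L by rewrite ler_pdivlMr.
have Z1 : 1 <= Z.
  by rewrite /Z mulr_ege1 ?lerDr // (le_trans _ RL) // ler1n.
have Z0 : 0 < Z by apply: lt_le_trans Z1.
pose m := expR (- (12 * (1 + lam) * (A * Z))).
have m0 : 0 < m by exact: expR_gt0.
pose e := Num.min 1 (m / 2).
have e0 : 0 < e by rewrite lt_min ltr01 divr_gt0.
have e1 : e <= 1 by rewrite ge_min lexx.
have em : e <= m / 2 by rewrite ge_min lexx orbT.
have [c [l Hc Hf]] := Happ rho e R0 e0.
pose P z := c * \prod_(a <- l) (z - a).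
have P0 : P 0 = c0 by [].
have Pn0 : P 0 != 0 by rewrite P0.
have rho1 : 1 <= rho by move: R4; clear; lra.
have PN z : cabs z = rho -> cabs (P z) <= expR (N + 1).
  move=> zR; have zR' : cabs z <= rho by rewrite zR.
  apply: le_trans (_ : cabs (z ^+ k * P z) <= _).
    by rewrite (cabsM (z ^+ k)) cabsX zR ler_peMl ?cabs_ge0 // exprn_ege1.
  apply: le_trans _ (expRD1 N0).
  have := cabsBl (z ^+ k * P z) (g z); rewrite cabsB.
  by have := Hf z zR'; have := gN z zR'; rewrite -/(P z); move: e1; clear; lra.
have [X0 [Bad [mBad BadL HBad]]] := poly_estimates L0 LR lam0 Pn0 PN.
move: X0 HBad; rewrite -/(P 0) P0.
set N' := N + 1 + ln (2 * rho / L); set X := N' - _; set Y := rho / L * X.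
move=> X0 HBad.
have RL0 : 0 < rho / L by apply: lt_le_trans RL.
have lnRL : 0 <= ln (rho / L) by rewrite ln_ge0 // (le_trans _ RL) // ler1n.
have N'E : N' = N + 1 + ln 2 + ln (rho / L).
  by rewrite /N' -mulrA lnM ?posrE // addrA.
have ln20 : 0 <= ln 2 :> R by rewrite ln_ge0 // ler1n.
have N'0 : 0 <= N' by rewrite N'E; move: N0 ln20 lnRL; clear; lra.
have XA : X <= A * (N + 1).
  have h1 := ln2_le1; have h2 := @norm_ln_bound (cabs c0).
  rewrite cabs_gt0 in h2; have {}h2 := h2 c00.
  have h3 : 0 <= `|ln (cabs c0)| * N by rewrite mulr_ge0.
  rewrite /X N'E /A mulrDr mulr1 mulrDl; move: h1 h2 h3 lnN N0; clear; lra.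
have YZ : Y <= A * Z.
  have -> : A * Z = rho / L * (A * (N + 1)) by rewrite /Z; ring.
  by rewrite ler_wpM2l // ltW.
have Y0 : 0 <= Y by rewrite mulr_ge0 // ltW.
exists Bad; split => //.
  by apply: le_trans BadL _; rewrite lee_fin /lam invf_div le_eqVlt; apply/orP; left;
    apply/eqP; field.
move=> z nB zI; have [Pz0 lnP near] := HBad z nB zI.
have z1 : 1 <= cabs z by case/andP: zI => + _; move: LR R4; clear; lra.
have aPz : 0 < cabs (P z) by rewrite cabs_gt0.
have Pm : m <= cabs (P z).
  rewrite -[cabs (P z)]lnK ?posrE // ler_expR; apply: le_trans lnP.
  have h : 12 * (1 + lam) * Y <= 12 * (1 + lam) * (A * Z).
    by rewrite ler_wpM2l // mulr_ge0 // (le_trans ler01 lam1).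
  by move: h N'0; clear; lra.
pose G w := w ^+ k * P w.
have Gm : m <= cabs (G z).
  by apply: le_trans Pm _; rewrite /G (cabsM (z ^+ k)) cabsX ler_peMl ?cabs_ge0 // exprn_ege1.
have zR : cabs z <= rho by case/andP: zI => _; move: L0; clear; lra.
have gG w : cabs w <= rho -> cabs (g w) <= cabs (G w) + e.
  by move=> /Hf; have := cabsBl (g w) (G w); rewrite -/(P w) -/(G w); clear; lra.
have Gg : cabs (G z) <= cabs (g z) + e.
  by have := Hf z zR; have := cabsBl (G z) (g z); rewrite cabsB -/(P z) -/(G z); clear; lra.
have gm : m / 2 <= cabs (g z) by move: Gm Gg em; clear; lra.
have G2g : cabs (G z) <= 2 * cabs (g z) by move: Gg em gm; clear; lra.
have gz0 : 0 < cabs (g z) by apply: lt_le_trans gm; rewrite divr_gt0.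
split.
- by rewrite -cabs_gt0.
- apply: le_trans (_ : ln (m / 2) <= _); last by rewrite ler_ln ?posrE ?divr_gt0.
  rewrite ln_div ?posrE // expRK.
  have h1 := ln2_le1.
  have h2 : 0 <= K3 * Z by rewrite mulr_ge0 // ltW.
  have -> : (K1 + K3) * Z = 12 * (1 + lam) * (A * Z) + Z + K3 * Z by rewrite /K1; ring.
  by move: h1 h2 Z1; clear; lra.
(* within the radius of the local bound of [poly_estimates], as 1 / L <= Z *)
move=> j jn; pose s := (K2 * Z ^+ 4)^-1.
have ZL : L^-1 <= Z.
  apply: le_trans (_ : N + 1 <= _); first by rewrite -[L^-1]mul1r ler_pdivrMr // mulrC.
  by rewrite /Z ler_peMl ?addr_ge0 // (le_trans _ RL) // ler1n.
have Z40 : 1 <= Z ^+ 4 by rewrite exprn_ege1.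
have KZ : 1 <= K2 * Z ^+ 4 by rewrite mulr_ege1.
have KZ' : 0 < K2 * Z ^+ 4 by exact: lt_le_trans KZ.
have s0 : 0 < s by rewrite invr_gt0.
have ks : k%:R * s <= 1.
  rewrite /s ler_pdivrMr ?mul1r //.
  apply: le_trans (_ : (1 + k%:R) * 1 <= _); first by rewrite mulr1 lerDr.
  have -> : K2 * Z ^+ 4 = (1 + k%:R) * (8 * (1 + lam) ^+ 2 * (1 + A) ^+ 3 * Z ^+ 4) by rewrite /K2; ring.
  apply: ler_wpM2l; first exact: le_trans ler01 k1.
  have h8 : 1 <= 8 :> R by rewrite ler1n.
  have h1 : 1 <= (1 + lam) ^+ 2 by rewrite exprn_ege1.
  have h2 : 1 <= (1 + A) ^+ 3 by rewrite exprn_ege1.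
  by apply: mulr_ege1 => //; apply: mulr_ege1 => //; apply: mulr_ege1.
pose d := 8 * (1 + lam) ^+ 2 * (1 + Y) ^+ 3.
have d1 : 1 <= d.
  have h8 : 1 <= 8 :> R by rewrite ler1n.
  have h1 : 1 <= (1 + lam) ^+ 2 by rewrite exprn_ege1.
  have h2 : 1 <= (1 + Y) ^+ 3 by rewrite exprn_ege1 // lerDl.
  by apply: mulr_ege1 => //; apply: mulr_ege1.
have d0 : 0 < d by apply: lt_le_trans d1.
have sY : s <= L / d.
  rewrite -[L / d]invf_div lef_pV2 ?posrE ?divr_gt0 //.
  have -> : K2 * Z ^+ 4 = 8 * (1 + lam) ^+ 2 * ((1 + k%:R) * ((1 + A) * Z) ^+ 3) * Z by rewrite /K2; ring.
  apply: ler_pM => //; rewrite ?invr_ge0 ?(ltW L0) ?(ltW d0) //.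
  have Y1 : 0 <= 1 + Y by rewrite addr_ge0.
  have YA : 1 + Y <= (1 + A) * Z by rewrite mulrDl mul1r lerD.
  have YA0 : 0 <= (1 + A) * Z := le_trans Y1 YA.
  apply: ler_wpM2l; first by apply: mulr_ge0 => //; apply: sqr_ge0.
  apply: le_trans (_ : ((1 + A) * Z) ^+ 3 <= _).
    by apply: lerXn2r.
  by apply: ler_peMl => //; apply: exprn_ge0.
have s1 : s <= L.
  by apply: le_trans sY _; rewrite ler_pdivrMr // ler_peMr // ltW.
have bound w : cabs (w - z) <= s -> cabs (g w) <= E3 * cabs (g z).
  move=> ws; have wz : cabs w <= cabs z + s.
    have : cabs w <= cabs z + cabs (w - z) by rewrite -{1}(subrKC z w) cabsD.
    by move: ws; clear; lra.
  have wR : cabs w <= rho by case/andP: zI => _; move: wz s1 L0; clear; lra.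
  have Gw : cabs (G w) <= expR 3 * cabs (G z).
    rewrite /G (cabsM (w ^+ k)) (cabsM (z ^+ k)) !cabsX.
    have h1 : cabs w ^+ k <= cabs z ^+ k * expR 1.
      apply: le_trans (_ : (cabs z + s) ^+ k <= _).
        by apply: lerXn2r; rewrite ?nnegrE ?cabs_ge0 // addr_ge0 ?cabs_ge0 // ltW.
      by apply: exprD_expR => //; exact: ltW.
    have h2 := near w (le_trans ws sY).
    apply: le_trans (ler_pM _ (cabs_ge0 _) h1 h2) _; first by rewrite exprn_ge0 // cabs_ge0.
    have -> : expR 3 = expR 1 * expR 2 :> R by rewrite -expRD; congr expR; ring.
    by rewrite le_eqVlt; apply/orP; left; apply/eqP; ring.
  apply: le_trans (gG w wR) _; rewrite /E3 mulrDl mul1r; apply: lerD.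
    apply: le_trans Gw _; rewrite [2 * _]mulrC -mulrA ler_wpM2l ?expR_ge0 //.
  by apply: le_trans em gm.
case: j jn => [|j] jn; first by rewrite derive1n0 expr0 mul1r.
apply: le_trans (cauchy_estimate j.+1 eg s0 bound) _.
rewrite mulrA ler_wpM2r ?cabs_ge0 //.
have E3j : E3 <= E3 ^+ j.+1 by rewrite exprS ler_peMr // exprn_ege1.
have T0 : 0 <= 2 * j.+1%:R / s by rewrite divr_ge0 ?mulr_ge0 // ltW.
apply: le_trans (ler_wpM2l (exprn_ge0 _ T0) E3j) _; rewrite -exprMn.
have T1 : 0 <= 2 * j.+1%:R / s * E3 by rewrite mulr_ge0.
have KZ0 : 0 <= K2 * Z ^+ 4 by exact: ltW.
have T2 : 2 * j.+1%:R / s * E3 <= K3 * Z ^+ 4.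
  have -> : 2 * j.+1%:R / s * E3 = 2 * E3 * (K2 * Z ^+ 4) * j.+1%:R by rewrite /s invrK; ring.
  have -> : K3 * Z ^+ 4 = 2 * E3 * (K2 * Z ^+ 4) * n.+1%:R by rewrite /K3; ring.
  by apply: ler_wpM2l; [apply: mulr_ge0 => //; apply: mulr_ge0|rewrite ler_nat ltnW].
have T3 : 2 * j.+1%:R / s * E3 <= (K1 + K3) * Z ^+ 4.
  by apply: le_trans T2 _; rewrite mulrDl lerDr mulr_ge0 // (le_trans ler01 Z40).
by apply: lerXn2r; rewrite ?nnegrE // (le_trans T1).
Qed.

End EntireEstimates.

(** * Cancellation of an operator along a chain of Wronskian reductions *)

Section WronskianReduction.
Variable R : realType.
Notation C := (R[i]^o).
Implicit Types (z w c : C) (r s x : R) (f g y : C -> C).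

Lemma is_derive_slope (v : R -> R) x (d : R) :
  (forall e, 0 < e -> exists2 del : R, 0 < del &
     forall h, `|h| < del -> `|v (x + h) - v x - d * h| <= e * `|h|) ->
  is_derive x 1 v d.
Proof.
move=> H.
have L : (fun h : R => h^-1 *: (v (h *: (1 : R) + x) - v x)) @ 0^' --> (d : R).
  apply/cvgrPdist_le => e e0; have [del del0 Hd] := H e e0.
  near=> h.
  have h0 : h != 0 by near: h; exact: nbhs_dnbhs_neq.
  have hd : `|h| < del.
    near: h; apply: dnbhs0_lt => //.
  have := Hd h hd; rewrite [_ *: 1]mulr1 [h + x]addrC => h1.
  rewrite -[d - _]opprK normrN opprB.
  have -> : h^-1 *: (v (x + h) - v x) - d = (v (x + h) - v x - d * h) / h.
    by rewrite [_ *: _]mulrC; field.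
  by rewrite normrM normfV ler_pdivrMr ?normr_gt0.
by split; [apply: cvgP L|exact: cvg_lim L].
Unshelve. all: by end_near. Qed.

(** Along a segment the real function [Re (conj D * q)], with [D] the increment of
    [q], has derivative zero; its increment is [|D|^2]. *)
Lemma zero_derivative_disc (q : C -> C) (z : C) (rho : R) :
  (forall w, cabs (w - z) < rho -> hasder q w 0) ->
  forall w, cabs (w - z) < rho -> q w = q z.
Proof.
move=> H w wz; pose v := w - z; pose D := q w - q z.
have D0 : cabs D = 0; last by apply/eqP; rewrite -subr_eq0 -cabs_eq0 D0.
pose u (t : R) : R := Re ((conjc D : C) * q (z + t%:C%C * v)).
have du (t : R) : `|t| <= 1 -> is_derive t 1 u 0.
  move=> t1; apply: is_derive_slope => e e0.
  have v1 : 0 < 1 + cabs v by rewrite ltr_wpDr ?cabs_ge0.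
  have D1 : 0 < 1 + cabs D by rewrite ltr_wpDr ?cabs_ge0.
  have zt : cabs (z + t%:C%C * v - z) < rho.
    rewrite addrC addKr cabsM cabs_real; apply: le_lt_trans wz.
    by rewrite -[leRHS]mul1r ler_wpM2r ?cabs_ge0.
  have e1 : 0 < e / ((1 + cabs v) * (1 + cabs D)) by rewrite divr_gt0 // mulr_gt0.
  have [del del0 Hd] := H _ zt _ e1.
  exists (del / (1 + cabs v)); first by rewrite divr_gt0.
  move=> h; rewrite ltr_pdivlMr // => hd.
  have hv : cabs (h%:C%C * v) <= `|h| * (1 + cabs v).
    by rewrite cabsM cabs_real ler_wpM2l // lerDr.
  have := Hd (h%:C%C * v) (le_lt_trans hv hd).
  rewrite !mul0r !subr0 => h1; rewrite /u -raddfB /=.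
  apply: le_trans (Re_le_cabs _) _; rewrite -mulrBr cabsM cabs_conj.
  have -> : z + (t + h)%:C%C * v = z + t%:C%C * v + h%:C%C * v :> C.
    by rewrite rmorphD /= mulrDl addrA.
  apply: le_trans (ler_pM (cabs_ge0 _) (cabs_ge0 _) (_ : _ <= 1 + cabs D) h1) _.
    by rewrite lerDr.
  apply: le_trans (ler_wpM2l (ltW D1) (ler_wpM2l (ltW e1) hv)) _.
  rewrite le_eqVlt; apply/orP; left; apply/eqP; field.
  by rewrite !gt_eqF.
have cu : {within `[0, 1], continuous u}.
  apply: derivable_within_continuous => t; rewrite in_itv /= => /andP[t0 t1].
  by have [] := du t; rewrite ?ger0_norm.
have [|x _] := MVT ltr01 _ cu (df := fun=> 0).
  by move=> t; rewrite in_itv /= => /andP[t0 t1]; apply: du; rewrite ger0_norm ltW.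
rewrite mul0r /u rmorph1 rmorph0 mul1r mul0r addr0 /v subrKC -raddfB /= -mulrBr -/D.
rewrite mulrC mulc_conj /= => /eqP.
by rewrite sqrf_eq0 => /eqP.
Qed.

Lemma ccont_neq0 f z : ccont f z -> f z != 0 ->
  exists2 rho : R, 0 < rho & forall w, cabs (w - z) < rho -> f w != 0.
Proof.
move=> cf fz; have f0 : 0 < cabs (f z) by rewrite cabs_gt0.
have [rho rho0 H] := cf _ f0; exists rho => // w /H h.
by apply: contraTneq h => ->; rewrite sub0r cabsN ltxx.
Qed.

Lemma entire_identity f z (rho : R) : entire f -> 0 < rho ->
  (forall w, cabs (w - z) < rho -> f w = 0) -> forall w, f w = 0.
Proof.
move=> ef rho0 H w; have ez := entire_shift (z := z) ef.
have r0 : 0 < rho / 2 by rewrite divr_gt0.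
suff /(_ (w - z)) : forall v, f (z + v) = 0 by rewrite subrKC.
apply: (coef_eq0 ez) => k; rewrite -(taylor_coefE k ez r0) /taylor_coef.
have -> : (fun t => f (z + circle_point (rho / 2) t) *
    (circle_point (rho / 2) t ^+ k)^-1) = fun=> 0.
  apply/funext => t; rewrite H ?mul0r // addrC addKr cabs_circle_point gtr0_norm //.
  by move: rho0; clear; lra.
by rewrite tmean_cst.
Qed.

Lemma entire_mul_neq0 f g : entire f -> entire g ->
  (exists z, f z != 0) -> (exists z, g z != 0) -> exists z, f z * g z != 0.
Proof.
move=> ef eg [z fz] gn0; apply: contrapT => /forallNP fg.
have [rho rho0 fn0] := ccont_neq0 (entire_ccont ef z) fz.
have g0 := @entire_identity g z rho eg rho0.
have [w] := gn0; rewrite g0 ?eqxx // => v vz.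
have /negP := fg v; rewrite negbK mulf_eq0 => /orP[/eqP fv|/eqP //].
by have := fn0 v vz; rewrite fv eqxx.
Qed.

Lemma entireD f g : entire f -> entire g -> entire (fun z => f z + g z).
Proof.
by move=> /entireP ef /entireP eg z; exact: hasder_derivable (hasderD (ef z) (eg z)).
Qed.

Lemma entireB f g : entire f -> entire g -> entire (fun z => f z - g z).
Proof.
by move=> /entireP ef /entireP eg z; exact: hasder_derivable (hasderB (ef z) (eg z)).
Qed.

Lemma entireM f g : entire f -> entire g -> entire (fun z => f z * g z).
Proof.
by move=> /entireP ef /entireP eg z; exact: hasder_derivable (hasderM (ef z) (eg z)).
Qed.

Lemma entire_cst (c : C) : entire (fun=> c).
Proof. by move=> z; exact: hasder_derivable (hasder_cst c z). Qed.

Lemma entire_lincomb n (a : nat -> C) (G : nat -> C -> C) :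
  (forall i, entire (G i)) -> entire (fun z => \sum_(k < n) a k * G k z).
Proof.
move=> eG; elim: n => [|n IH].
  have -> : (fun z => \sum_(k < 0) a k * G k z) = fun=> 0.
    by apply/funext => z; rewrite big_ord0.
  exact: entire_cst.
have -> : (fun z => \sum_(k < n.+1) a k * G k z) =
    fun z => \sum_(k < n) a k * G k z + a n * G n z.
  by apply/funext => z; rewrite big_ord_recr.
by apply: entireD IH _; apply: entireM => //; exact: entire_cst.
Qed.

Lemma derive1D f g : entire f -> entire g ->
  derive1 (fun z => f z + g z) = fun z => derive1 f z + derive1 g z.
Proof.
move=> /entireP ef /entireP eg; apply/funext => z.
exact: hasder_derive1 (hasderD (ef z) (eg z)).
Qed.

Lemma derive1B f g : entire f -> entire g ->
  derive1 (fun z => f z - g z) = fun z => derive1 f z - derive1 g z.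
Proof.
move=> /entireP ef /entireP eg; apply/funext => z.
exact: hasder_derive1 (hasderB (ef z) (eg z)).
Qed.

Lemma derive1M f g : entire f -> entire g ->
  derive1 (fun z => f z * g z) = fun z => derive1 f z * g z + f z * derive1 g z.
Proof.
move=> /entireP ef /entireP eg; apply/funext => z.
exact: hasder_derive1 (hasderM (ef z) (eg z)).
Qed.

Lemma derive1_entire_cst (c : C) : derive1 (fun=> c : C) = fun=> 0 :> C.
Proof. by apply/funext => z; exact: hasder_derive1 (hasder_cst c z). Qed.

Lemma derive1n_cst k (c : C) : derive1n k.+1 (fun=> c : C) = fun=> 0 :> C.
Proof.
elim: k => [|k IH]; first by rewrite derive1n1 derive1_entire_cst.
by rewrite derive1nS IH derive1_entire_cst.
Qed.

Lemma derive1nD k f g : entire f -> entire g ->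
  derive1n k (fun z => f z + g z) = fun z => derive1n k f z + derive1n k g z.
Proof.
move=> ef eg; elim: k => [|k IH]; first by rewrite !derive1n0.
by rewrite derive1nS IH derive1D; [rewrite -!derive1nS|exact: entire_derive1n..].
Qed.

Lemma derive1nB k f g : entire f -> entire g ->
  derive1n k (fun z => f z - g z) = fun z => derive1n k f z - derive1n k g z.
Proof.
move=> ef eg; elim: k => [|k IH]; first by rewrite !derive1n0.
by rewrite derive1nS IH derive1B; [rewrite -!derive1nS|exact: entire_derive1n..].
Qed.

Lemma derive1_lincomb n (a : nat -> C) (G : nat -> C -> C) z :
  (forall i, entire (G i)) -> derive1 (fun z => \sum_(k < n) a k * G k z) z =
  \sum_(k < n) a k * derive1 (G k) z.
Proof.
move=> eG; elim: n => [|n IH].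
  have -> : (fun z => \sum_(k < 0) a k * G k z) = fun=> 0.
    by apply/funext => w; rewrite big_ord0.
  by rewrite derive1_entire_cst big_ord0.
have -> : (fun z => \sum_(k < n.+1) a k * G k z) =
    fun z => \sum_(k < n) a k * G k z + a n * G n z.
  by apply/funext => w; rewrite big_ord_recr.
rewrite derive1D; [|exact: entire_lincomb|by apply: entireM => //; exact: entire_cst].
rewrite IH big_ord_recr (derive1M (@entire_cst (a n)) (eG n)).
by rewrite derive1_entire_cst mul0r add0r.
Qed.

Lemma leibniz n f g z : entire f -> entire g ->
  derive1n n (fun z => f z * g z) z =
  \sum_(j < n.+1) 'C(n, j)%:R * derive1n (n - j) f z * derive1n j g z.
Proof.
elim: n f g => [|n IH] f g ef eg.
  by rewrite big_ord_recl big_ord0 !derive1n0 bin0 mul1r addr0.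
have ef' := entire_derive1 ef; have eg' := entire_derive1 eg.
rewrite derive1Sn derive1M // derive1nD; [|exact: entireM..].
rewrite IH // IH // [RHS]big_ord_recl /= ?subn0 ?bin0 mul1r.
rewrite big_ord_recl /= ?subn0 ?bin0 mul1r -derive1Sn -addrA; congr (_ + _).
rewrite [in RHS](eq_bigr (fun j : 'I_n.+1 =>
  'C(n, j.+1)%:R * derive1n (n - j) f z * derive1n j.+1 g z +
  'C(n, j)%:R * derive1n (n - j) f z * derive1n j.+1 g z)); last first.
  by move=> j _; rewrite /bump /= !add1n subSS binS natrD !mulrDl.
rewrite big_split /=; congr (_ + _); last first.
  by apply: eq_bigr => j _; rewrite -derive1Sn.
rewrite big_ord_recr /= bin_small // !mul0r addr0.
apply: eq_bigr => j _; rewrite /bump /= add1n -derive1Sn; congr (_ * derive1n _ f z * _).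
by rewrite -subSn // ltn_ord.
Qed.

End WronskianReduction.

Section Heads.
Variable R : realType.
Notation C := (R[i]^o).
Implicit Types (z w c : C) (r s x : R) (f g y : C -> C) (G : nat -> C -> C).

Definition wr f g : C -> C := fun z => f z * derive1 g z - derive1 f z * g z.

(** Reduction of order: the first function is removed and each other one is
    replaced by its Wronskian with it. Families are indexed by all of [nat], so
    that this is a mere shift of indices. *)
Definition wr_step G : nat -> C -> C := fun i => wr (G 0%N) (G i.+1).

Definition head G (j : nat) : C -> C := iter j wr_step G 0%N.

Definition independent (n : nat) G : Prop :=
  forall a : nat -> C, (forall z, \sum_(k < n) a k * G k z = 0) ->
  forall k, (k < n)%N -> a k = 0.

Lemma quotient_rule_num (F : fieldType) (a b a' b' : F) : b != 0 ->
  a' * b^-1 + a * (- b' / b ^+ 2) = (b * a' - b' * a) / b ^+ 2.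
Proof. by move=> b0; field. Qed.

Lemma headS G j : head G j.+1 = head (wr_step G) j.
Proof. by rewrite /head iterSr. Qed.

Lemma entire_wr f g : entire f -> entire g -> entire (wr f g).
Proof.
move=> ef eg.
exact: entireB (entireM ef (entire_derive1 eg)) (entireM (entire_derive1 ef) eg).
Qed.

Lemma entire_wr_step G : (forall i, entire (G i)) -> forall i, entire (wr_step G i).
Proof. by move=> eG i; exact: entire_wr. Qed.

Lemma entire_head G j : (forall i, entire (G i)) -> entire (head G j).
Proof.
elim: j G => [|j IH] G eG; first exact: eG.
by rewrite headS; apply: IH; exact: entire_wr_step.
Qed.

(** Where the first function does not vanish the quotient has derivative
    zero. *)
Lemma wr_proportional f g : entire f -> entire g -> (exists z, f z != 0) ->
  (forall z, wr f g z = 0) -> exists c, forall z, g z = c * f z.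
Proof.
move=> ef eg [z fz] W0.
have [rho rho0 fn0] := ccont_neq0 (entire_ccont ef z) fz.
pose q w := g w * (f w)^-1; exists (q z) => w.
have /entireP df := ef; have /entireP dg := eg.
have qc v : cabs (v - z) < rho -> q v = q z.
  apply: zero_derivative_disc => {}v vz; have fv := fn0 v vz.
  have -> : 0 = derive1 g v * (f v)^-1 + g v * (- derive1 f v / f v ^+ 2) :> C.
    have -> : derive1 g v * (f v)^-1 + g v * (- derive1 f v / f v ^+ 2) =
      wr f g v / f v ^+ 2 by rewrite /wr quotient_rule_num.
    by rewrite W0 mul0r.
  exact: hasderM (dg v) (hasderV fv (df v)).
have ek : entire (fun w => g w - q z * f w).
  exact: entireB eg (entireM (@entire_cst R (q z)) ef).
apply/eqP; rewrite -subr_eq0; apply/eqP.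
apply: (entire_identity ek rho0 (z := z)) => v vz.
by rewrite -(qc v vz) /q mulfVK ?subrr // fn0.
Qed.

Lemma independent_neq0 n G : independent n.+1 G -> exists z, G 0%N z != 0.
Proof.
move=> iG; apply: contrapT => /forallNP G0.
have /eqP : 1 = 0 :> C; last by rewrite oner_eq0.
apply: (iG (fun k => (k == 0%N)%:R) _ 0%N) => // z.
rewrite big_ord_recl big1 ?addr0 ?mul1r => [|k _]; last by rewrite mul0r.
by apply/eqP; have /negP := G0 z; rewrite negbK.
Qed.

(** A relation between the Wronskians says that a combination of the other
    functions is proportional to the first one. *)
Lemma independent_step n G : (forall i, entire (G i)) -> independent n.+1 G ->
  independent n (wr_step G).
Proof.
move=> eG iG a aG; pose g z := \sum_(k < n) a k * G k.+1 z.
have eg : entire g by exact: (@entire_lincomb R n a (fun k => G k.+1) (fun k => eG k.+1)).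
have [c gc] : exists c, forall z, g z = c * G 0%N z.
  apply: (wr_proportional (eG 0%N) eg); first exact: independent_neq0 iG.
  move=> z; rewrite -[RHS](aG z) /wr /g.
  rewrite (derive1_lincomb n a z (fun k => eG k.+1)) !mulr_sumr -sumrB.
  by apply: eq_bigr => k _; rewrite /wr_step /wr [RHS]mulrBr; congr (_ - _); rewrite mulrCA.
move=> k kn; apply: (iG (fun k => if k is k'.+1 then a k' else - c) _ k.+1) => // z.
by rewrite big_ord_recl /= -/(g z) gc mulNr addNr.
Qed.

Lemma head_neq0 n G j : (forall i, entire (G i)) -> independent n G ->
  (j < n)%N -> exists z, head G j z != 0.
Proof.
elim: j n G => [|j IH] [|n] G eG iG // jn; first exact: independent_neq0 iG.
rewrite headS; apply: IH jn; [exact: entire_wr_step|exact: independent_step].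
Qed.

(** The coefficient of the k-th derivative of y in the i-th derivative of
    the Wronskian of f and y, when u is the jet of f. *)
Definition wr_coef (u : nat -> C) (i k : nat) : C :=
  (if k is k'.+1 then 'C(i, k')%:R * u (i - k')%N else 0) -
  'C(i, k)%:R * u (i.+1 - k)%N.

Lemma derive1n_wr f g z i : entire f -> entire g ->
  derive1n i (wr f g) z =
  \sum_(k < i.+2) wr_coef (fun j => derive1n j f z) i k * derive1n k g z.
Proof.
move=> ef eg; have ef' := entire_derive1 ef; have eg' := entire_derive1 eg.
rewrite (derive1nB i (entireM ef eg') (entireM ef' eg)).
rewrite (leibniz i z ef eg') (leibniz i z ef' eg).
under [in RHS]eq_bigr => k _ do rewrite /wr_coef mulrBl.
rewrite sumrB; congr (_ - _).
  rewrite [RHS]big_ord_recl mul0r add0r; apply: eq_bigr => k _ /=.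
  by rewrite /bump /= ?add1n -derive1Sn.
rewrite [RHS]big_ord_recr /= bin_small // !mul0r addr0.
by apply: eq_bigr => k _; rewrite -derive1Sn subSn // -ltnS.
Qed.

Lemma wr_coef_top u i : wr_coef u i i.+1 = u 0%N.
Proof. by rewrite /wr_coef binn subnn mul1r bin_small // mul0r subr0. Qed.

Lemma wr_coef_above u i k : (i.+1 < k)%N -> wr_coef u i k = 0.
Proof.
case: k => // k ik; have ik' : (i < k)%N by rewrite -ltnS.
by rewrite /wr_coef (bin_small ik') (bin_small (leqW ik')) !mul0r subrr.
Qed.

Lemma natr_cabs (k : nat) : cabs (k%:R : C) = k%:R.
Proof. by have := cabs_real (k%:R : R); rewrite rmorph_nat normr_nat. Qed.

Lemma wr_coef_bound u i k (B : R) : 1 <= B ->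
  (forall j, (j <= i.+1)%N -> cabs (u j) <= B ^+ j * cabs (u 0%N)) ->
  cabs (wr_coef u i k) <= (2 * B) ^+ i.+1 * cabs (u 0%N).
Proof.
move=> B1 H.
have bin2 a b : 'C(a, b)%:R <= 2 ^+ a :> R.
  rewrite -natrX ler_nat -[2%N]/(1 + 1)%N expnDn.
  have [ba|ab] := leqP b a; last by rewrite bin_small.
  rewrite (bigD1 (Ordinal (ba : (b < a.+1)%N))) //= !exp1n !muln1.
  exact: leq_addr.
have term a j : (j <= i.+1)%N -> (a <= i)%N ->
    forall b, cabs ('C(a, b)%:R * u j) <= 2 ^+ i * (B ^+ i.+1 * cabs (u 0%N)).
  move=> ji ai b; rewrite (cabsM _ (u j)) natr_cabs; apply: ler_pM => //.
  - exact: cabs_ge0.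
  - by apply: le_trans (bin2 a b) _; rewrite ler_weXn2l // ler1n.
  - apply: le_trans (H j ji) _; rewrite ler_wpM2r ?cabs_ge0 //.
    by rewrite ler_weXn2l.
have T0 : 0 <= 2 ^+ i * (B ^+ i.+1 * cabs (u 0%N)).
  by rewrite !mulr_ge0 ?exprn_ge0 ?cabs_ge0 // (le_trans ler01 B1).
rewrite /wr_coef; apply: le_trans (cabsD _ _) _; rewrite cabsN.
have -> : (2 * B) ^+ i.+1 * cabs (u 0%N) =
  2 ^+ i * (B ^+ i.+1 * cabs (u 0%N)) + 2 ^+ i * (B ^+ i.+1 * cabs (u 0%N)).
  by rewrite exprMn [2 ^+ i.+1]exprS; ring.
apply: lerD; last by apply: term => //; apply: leq_subr.
case: k => [|k]; first by rewrite cabs0.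
by apply: term => //; apply: leq_trans (leq_subr _ _) _; apply: leqW.
Qed.

(** Division with remainder of a functional on jets by the Wronskian with f:
    the remainder has order zero and annihilates f, hence vanishes. *)
Lemma wr_division (u al : nat -> C) m : u 0%N != 0 ->
  (forall i, \sum_(k < i.+2) wr_coef u i k * u k = 0) ->
  \sum_(k < m.+1) al k * u k = 0 ->
  exists be : nat -> C, forall k, (k <= m)%N ->
    al k = \sum_(i < m) be i * wr_coef u i k.
Proof.
move=> u0 W0; elim: m al => [|m IH] al.
  rewrite big_ord_recl big_ord0 addr0 => /eqP; rewrite mulf_eq0 (negPf u0) orbF => /eqP a0.
  by exists (fun=> 0) => -[|//] _; rewrite big_ord0.
move=> al0; pose c := al m.+1 / u 0%N.
have [|be Hbe] := IH (fun k => al k - c * wr_coef u m k).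
  have := al0; rewrite big_ord_recr /=; have := W0 m; rewrite big_ord_recr /= wr_coef_top.
  set S := \sum_(i < _) _; set S' := \sum_(i < _) _ => h1 h2.
  under eq_bigr => k _ do rewrite mulrBl -mulrA.
  rewrite sumrB -mulr_sumr -/S -/S'.
  have -> : S' = - (al m.+1 * u m.+1) by apply/eqP; rewrite -subr_eq0 opprK h2.
  have -> : S = - (u 0%N * u m.+1) by apply/eqP; rewrite -subr_eq0 opprK h1.
  by rewrite mulrN opprK mulrA /c mulfVK // addNr.
exists (fun i => if i == m then c else be i) => k.
rewrite leq_eqVlt big_ord_recr /= eqxx => /orP[/eqP ->|km].
  rewrite wr_coef_top big1 => [|i _]; first by rewrite add0r /c mulfVK.
  by rewrite wr_coef_above ?mulr0 // ltnS ltn_ord.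
have -> : al k = (al k - c * wr_coef u m k) + c * wr_coef u m k by rewrite subrK.
rewrite Hbe //; congr (_ + _); apply: eq_bigr => i _.
by rewrite ltn_eqF.
Qed.

Lemma lincomb_exchange (F : comNzRingType) m (al be y : nat -> F) (W : nat -> nat -> F) :
  (forall k, (k <= m.+1)%N -> al k = \sum_(i < m.+1) be i * W i k) ->
  (forall i k, (i.+1 < k)%N -> W i k = 0) ->
  \sum_(k < m.+2) al k * y k =
  \sum_(i < m.+1) be i * \sum_(k < i.+2) W i k * y k.
Proof.
move=> Hal W0.
under eq_bigr => k _ do rewrite (Hal k (ltn_ord k)) mulr_suml.
rewrite exchange_big /=; apply: eq_bigr => j _.
under eq_bigr => k _ do rewrite -mulrA.
rewrite -mulr_sumr; congr (_ * _).
have jm : (j.+2 <= m.+2)%N by rewrite ltnS; exact: ltn_ord.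
rewrite [RHS](big_ord_widen m.+2 (fun k => W j k * y k) jm).
rewrite [LHS](bigID (fun k : 'I_m.+2 => (k < j.+2)%N)) /=.
rewrite [X in _ + X]big1 ?addr0 // => k kj.
by rewrite W0 ?mul0r // ltnNge -ltnS.
Qed.

(** An operator annihilating the first function of the family factors
    through the Wronskian with it, so that the quotient annihilates the next
    family. *)
Lemma annihilator_reduction G z (al : nat -> C) m p :
  (forall i, entire (G i)) -> G 0%N z != 0 ->
  (forall i, (i < p.+1)%N -> \sum_(k < m.+2) al k * derive1n k (G i) z = 0) ->
  exists be : nat -> C,
    (forall k, (k <= m.+1)%N -> al k =
      \sum_(i < m.+1) be i * wr_coef (fun j => derive1n j (G 0%N) z) i k) /\
    forall i, (i < p)%N -> \sum_(k < m.+1) be k * derive1n k (wr_step G i) z = 0.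
Proof.
move=> eG G0 H; pose u j := derive1n j (G 0%N) z.
have W0 i : \sum_(k < i.+2) wr_coef u i k * u k = 0.
  rewrite -(derive1n_wr z i (eG 0%N) (eG 0%N)).
  have -> : wr (G 0%N) (G 0%N) = fun=> 0 by apply/funext => w; rewrite /wr mulrC subrr.
  by case: i => [|i]; rewrite ?derive1n_cst.
have [be Hbe] := wr_division (m := m.+1) (al := al) (u := u) G0 W0 (H 0%N isT).
exists be; split=> [|i ip]; first exact: Hbe.
have := H i.+1 ip.
rewrite (lincomb_exchange (fun k => derive1n k (G i.+1) z) Hbe (@wr_coef_above u)).
move=> h; rewrite -[RHS]h; apply: eq_bigr => k _; congr (_ * _).
by rewrite -(derive1n_wr z k (eG 0%N) (eG i.+1)).
Qed.

Lemma annihilator_kill m G z (al : nat -> C) : (forall i, entire (G i)) ->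
  (forall j, (j <= m)%N -> head G j z != 0) ->
  (forall i, (i < m.+1)%N -> \sum_(k < m.+1) al k * derive1n k (G i) z = 0) ->
  al m = 0.
Proof.
elim: m G al => [|m IH] G al eG hG H.
  have /eqP := H 0%N isT; rewrite big_ord_recl big_ord0 addr0 mulf_eq0.
  by rewrite (negPf (hG 0%N isT)) orbF => /eqP.
have [be [Hbe Hw]] := annihilator_reduction eG (hG 0%N isT) H.
have bm : be m = 0.
  apply: (IH (wr_step G) be (entire_wr_step eG) _ Hw) => j jm.
  by rewrite -headS; apply: hG.
rewrite (Hbe m.+1 (leqnn _)) big_ord_recr /= bm mul0r addr0 big1 // => i _.
by rewrite wr_coef_above ?mulr0 // !ltnS ltn_ord.
Qed.

End Heads.

Section HeadBounds.
Variable R : realType.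
Notation C := (R[i]^o).
Implicit Types (z w c : C) (r s x : R) (f g y : C -> C) (G : nat -> C -> C).

(** By induction on the order. The operator is recovered from its quotient by
    [wr_coef], whose entries are bounded multiples of the value at [z] of the
    function divided by; this value is also the ratio of the leading
    coefficients, so it cancels. *)
Lemma annihilator_bound m N G z (al : nat -> C) (B : R) :
  (forall i, entire (G i)) -> 1 <= B -> (m <= N)%N ->
  (forall j, (j < m)%N -> head G j z != 0 /\ forall i, (i <= N)%N ->
     cabs (derive1n i (head G j) z) <= B ^+ i * cabs (head G j z)) ->
  (forall i, (i < m)%N -> \sum_(k < m.+1) al k * derive1n k (G i) z = 0) ->
  forall k, (k <= m)%N -> cabs (al k) <= (4 * B) ^+ (m * m) * cabs (al m).
Proof.
move=> eG B1; elim: m G al eG => [|m IH] G al eG mN hG H k.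
  by rewrite leqn0 => /eqP ->; rewrite mul1r.
move=> km; have [G0 dG0] := hG 0%N isT.
have [be [Hbe Hw]] := annihilator_reduction eG G0 H.
have IHb i : (i <= m)%N -> cabs (be i) <= (4 * B) ^+ (m * m) * cabs (be m).
  apply: (IH (wr_step G) be (entire_wr_step eG) (ltnW mN) _ Hw) => j jm.
  by have := hG j.+1 jm; rewrite headS.
set u := fun j => derive1n j (G 0%N) z in Hbe.
have top : al m.+1 = be m * u 0%N.
  rewrite (Hbe m.+1 (leqnn _)) big_ord_recr /= wr_coef_top big1 ?add0r // => i _.
  by rewrite wr_coef_above ?mulr0 // !ltnS ltn_ord.
have B0 : 0 <= B := le_trans ler01 B1.
have B2 : 1 <= 2 * B by move: B1; clear; lra.
have B4 : 1 <= 4 * B by move: B1; clear; lra.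
have B20 := le_trans ler01 B2; have B40 := le_trans ler01 B4.
rewrite (Hbe k km); apply: le_trans (cabs_sum _ _ _) _.
apply: le_trans (_ : \sum_(i < m.+1) (4 * B) ^+ (m * m) * cabs (be m) *
    ((2 * B) ^+ m.+1 * cabs (u 0%N)) <= _).
  apply: ler_sum => i _; rewrite cabsM; apply: ler_pM; rewrite ?cabs_ge0 //.
    by apply: IHb; rewrite -ltnS ltn_ord.
  apply: le_trans (@wr_coef_bound R u i k B B1 _) _.
    move=> j ji; apply: dG0; apply: leq_trans ji _.
    by apply: leq_trans mN; rewrite ltnS -ltnS ltn_ord.
  by rewrite ler_wpM2r ?cabs_ge0 // ler_weXn2l.
rewrite sumr_const card_ord -[leLHS]mulr_natl top cabsM.
have -> : m.+1%:R * ((4 * B) ^+ (m * m) * cabs (be m) *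
    ((2 * B) ^+ m.+1 * cabs (u 0%N))) =
  m.+1%:R * (2 * B) ^+ m.+1 * (4 * B) ^+ (m * m) * (cabs (be m) * cabs (u 0%N)).
  by ring.
rewrite ler_wpM2r ?mulr_ge0 ?cabs_ge0 //.
apply: le_trans (_ : (4 * B) ^+ m.+1 * (4 * B) ^+ (m * m) <= _).
  rewrite ler_wpM2r ?exprn_ge0 //.
  have -> : (4 * B) ^+ m.+1 = 2 ^+ m.+1 * (2 * B) ^+ m.+1.
    by rewrite -exprMn; congr (_ ^+ _); ring.
  rewrite ler_wpM2r ?exprn_ge0 //.
  by rewrite -natrX ler_nat ltnW // ltn_expl.
by rewrite -exprD ler_weXn2l //; lia.
Qed.

(** The derivative costs a factor [2 / L] by Cauchy's estimate, absorbed by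
    [1 <= L * (M + 1)] and the exponential. *)
Lemma wr_step_growth G (rho L M : R) : (forall i, entire (G i)) ->
  0 < L -> 3 <= M -> 1 <= L * (M + 1) ->
  (forall i z, cabs z <= rho -> cabs (G i z) <= expR M) ->
  forall i z, cabs z <= rho - L -> cabs (wr_step G i z) <= expR (4 * M).
Proof.
move=> eG L0 M3 LM H i z zL.
have e0 := expR_ge0 M.
have dG k : cabs (derive1 (G k) z) <= 2 * expR M / L.
  apply: (cauchy_estimate1 (eG k) L0) => w wz; apply: H.
  have : cabs w <= cabs z + cabs (w - z) by rewrite -{1}(subrKC z w) cabsD.
  by move: zL; rewrite wz; clear; lra.
have G1 k : cabs (G k z) <= expR M by apply: H; move: zL L0; clear; lra.
have T : expR M * (2 * expR M / L) <= 2 * (M + 1) * expR (2 * M).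
  have -> : expR (2 * M) = expR M * expR M :> R by rewrite -expRD; congr expR; ring.
  have -> : expR M * (2 * expR M / L) = 2 * L^-1 * (expR M * expR M) by ring.
  apply: ler_wpM2r; first by apply: mulr_ge0.
  apply: ler_wpM2l => //; by rewrite -[L^-1]mul1r ler_pdivrMr // mulrC.
rewrite /wr_step /wr; apply: le_trans (cabsD _ _) _; rewrite cabsN.
rewrite !cabsM; have h1 := le_trans (ler_pM (cabs_ge0 _) (cabs_ge0 _) (G1 0%N) (dG i.+1)) T.
have h2 := ler_pM (cabs_ge0 _) (cabs_ge0 _) (dG 0%N) (G1 i.+1).
rewrite [leRHS]mulrC in h2; have {}h2 := le_trans h2 T.
apply: le_trans (lerD h1 h2) _.
have -> : expR (4 * M) = expR M * expR M * expR (2 * M) :> R.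
  by rewrite -!expRD; congr expR; ring.
rewrite -mulrDl ler_wpM2r ?expR_ge0 //.
have h3 := expR_ge1Dx M.
apply: le_trans (_ : (1 + M) * (1 + M) <= _).
  have -> : 2 * (M + 1) + 2 * (M + 1) = (1 + M) * 4 by ring.
  by apply: ler_wpM2l; move: M3; clear; lra.
have p0 : 0 <= 1 + M by move: M3; clear; lra.
exact: (ler_pM p0 p0 h3 h3).
Qed.

Lemma head_growth G j (rho L M : R) : (forall i, entire (G i)) ->
  0 < L -> 3 <= M -> 1 <= L * (M + 1) ->
  (forall i z, cabs z <= rho -> cabs (G i z) <= expR M) ->
  forall z, cabs z <= rho - j%:R * L -> cabs (head G j z) <= expR (4 ^+ j * M).
Proof.
elim: j G rho M => [|j IH] G rho M eG L0 M3 LM H z zL.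
  by rewrite expr0 mul1r; apply: H; move: zL; clear; lra.
rewrite headS exprSr -mulrA.
apply: (IH (wr_step G) (rho - L) _ (entire_wr_step eG) L0).
- by move: M3; clear; lra.
- by apply: le_trans LM _; rewrite ler_wpM2l ?(ltW L0) // lerD2r; move: M3; clear; lra.
- exact: wr_step_growth.
- by move: zL; rewrite -natr1; clear; lra.
Qed.

End HeadBounds.

(** * Local estimates for the solutions *)

Section SolutionEstimates.
Variable R : realType.
Notation C := (R[i]^o).
Implicit Types (z w c : C) (r s x : R) (f g y : C -> C) (G : nat -> C -> C).
Local Notation mu := (@lebesgue_measure R).

Lemma window_avoid (Bad : set R) (a L : R) : measurable Bad -> 0 < L ->
  (mu Bad <= (L / 2)%:E)%E -> exists2 r, a <= r <= a + L & ~ Bad r.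
Proof.
move=> mB L0 BL; apply: contrapT => H.
have sub : `[a, a + L]%classic `<=` Bad.
  move=> r /=; rewrite in_itv /= => rI; apply: contrapT => nB.
  by apply: H; exists r.
have : (mu `[a, (a + L)%R]%classic <= (L / 2)%:E)%E.
  by apply: le_trans BL; apply: le_measure => //; rewrite inE.
rewrite lebesgue_measure_itv /= lte_fin ltrDl L0 -EFinB lee_fin.
by move: L0; clear; lra.
Qed.

Lemma family_radial_estimates (h : nat -> C -> C) (m n : nat) (eta : R) :
  (forall j, (j < m)%N -> entire (h j)) ->
  (forall j, (j < m)%N -> exists z, h j z != 0) -> 0 < eta ->
  exists2 K : R, 1 <= K & forall rho L N : R, 0 < L -> 4 <= rho -> 4 * L <= rho ->
    0 <= N -> 1 <= L * (N + 1) -> ln (rho / L) <= N ->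
    (forall j z, (j < m)%N -> cabs z <= rho -> cabs (h j z) <= expR N) ->
    let Z := rho / L * (N + 1) in
    exists Bad : set R, [/\ measurable Bad, (mu Bad <= (eta * L)%:E)%E &
      forall z, ~ Bad (cabs z) -> rho - 3 * L <= cabs z <= rho - 2 * L ->
      forall j, (j < m)%N -> h j z != 0 /\ forall i, (i <= n)%N ->
          cabs (derive1n i (h j) z) <= (K * Z ^+ 4) ^+ i * cabs (h j z)].
Proof.
elim: m eta => [|m IH] eta eh hn0 eta0.
  exists 1 => // rho L N L0 _ _ _ _ _ _ Z; exists set0; split => //.
  by rewrite measure0 lee_fin mulr_ge0 // ltW.
have eta2 : 0 < eta / 2 by rewrite divr_gt0.
have [K K1 HK] := IH (eta / 2) (fun j jm => eh j (ltnW jm))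
  (fun j jm => hn0 j (ltnW jm)) eta2.
have [K' K'1 HK'] := entire_radial_estimates n (eh m (ltnSn m)) (hn0 m (ltnSn m)) eta2.
exists (K + K'); first by move: K1 K'1; clear; lra.
move=> rho L N L0 R4 LR N0 LN lnN hN Z.
have [Bad [mBad BadL HB]] := HK rho L N L0 R4 LR N0 LN lnN
  (fun j z jm => hN j z (ltnW jm)).
have [Bad' [mBad' BadL' HB']] := HK' rho L N L0 R4 LR N0 LN lnN
  (fun z => hN m z (ltnSn m)).
exists (Bad `|` Bad'); split; first exact: measurableU.
  apply: le_trans (measureU2 _ _ _) _ => //; apply: le_trans (leeD BadL BadL') _.
  by rewrite -EFinD lee_fin le_eqVlt; apply/orP; left; apply/eqP; field.
have Z0 : 0 <= Z ^+ 4.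
  have -> : Z ^+ 4 = (Z ^+ 2) ^+ 2 by rewrite -exprM.
  exact: sqr_ge0.
have KZ : 0 <= K * Z ^+ 4 by rewrite mulr_ge0 // (le_trans ler01).
have KZ' : 0 <= K' * Z ^+ 4 by rewrite mulr_ge0 // (le_trans ler01).
have mono i (D : R) (k : R) : 0 <= k -> k <= (K + K') * Z ^+ 4 -> 0 <= D ->
    k ^+ i * D <= ((K + K') * Z ^+ 4) ^+ i * D.
  move=> k0 kk D0; apply: ler_wpM2r => //; apply: lerXn2r; rewrite ?nnegrE //.
  exact: le_trans kk.
move=> z nB zI j; rewrite ltnS leq_eqVlt => /orP[/eqP ->|jm].
  have [gz _ Hd] := HB' z (fun b => nB (or_intror b)) zI.
  split => // i im; apply: le_trans (Hd i im) _; apply: mono => //.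
    by rewrite mulrDl lerDr.
  exact: cabs_ge0.
have [gz Hd] := HB z (fun b => nB (or_introl b)) zI j jm.
split => // i im; apply: le_trans (Hd i im) _; apply: mono => //.
  by rewrite mulrDl lerDl.
exact: cabs_ge0.
Qed.

(** The product of the functions does not vanish identically. *)
Lemma common_nonzero (h : nat -> C -> C) (m : nat) :
  (forall j, (j < m)%N -> entire (h j)) ->
  (forall j, (j < m)%N -> exists z, h j z != 0) ->
  exists z, forall j, (j < m)%N -> h j z != 0.
Proof.
move=> eh hn0.
suff [p [_ [z pz] Hp]] : exists p : C -> C, [/\ entire p, exists z, p z != 0 &
    forall z, p z != 0 -> forall j, (j < m)%N -> h j z != 0].
  by exists z => j; apply: Hp.
elim: m eh hn0 => [|m IH] eh hn0.
  exists (fun=> 1); split; [exact: entire_cst| |by []].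
  by exists 0; exact: oner_neq0.
have [p [ep pn0 Hp]] := IH (fun j jm => eh j (ltnW jm)) (fun j jm => hn0 j (ltnW jm)).
exists (fun z => p z * h m z); split.
- exact: entireM ep (eh m (ltnSn m)).
- exact: entire_mul_neq0 ep (eh m (ltnSn m)) pn0 (hn0 m (ltnSn m)).
move=> z; rewrite mulf_eq0 negb_or => /andP[pz hz] j.
by rewrite ltnS leq_eqVlt => /orP[/eqP -> //|]; apply: Hp.
Qed.

Section Equation.
Variables (n : nat) (A F : 'I_n -> C -> C).
Hypothesis bF : solution_base A F.

(** The coefficients of the equation with the leading one appended, so that the
    operator is a single sum. *)
Definition opcoef z (k : nat) : C := if insub k is Some j then A j z else 1.

Definition fam : nat -> C -> C := fun k =>
  if insub k is Some j then F j else fun=> 0.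

Lemma opcoef_ord z (k : 'I_n) : opcoef z k = A k z.
Proof. by rewrite /opcoef valK. Qed.

Lemma opcoef_top z : opcoef z n = 1.
Proof. by rewrite /opcoef insubF // ltnn. Qed.

Lemma fam_ord (k : 'I_n) : fam k = F k.
Proof. by rewrite /fam valK. Qed.

Lemma solution_opcoef f z : is_solution A f ->
  \sum_(k < n.+1) opcoef z k * derive1n k f z = 0.
Proof.
move=> [_ /(_ z) Hf]; rewrite big_ord_recr /= opcoef_top mul1r addrC -[RHS]Hf.
by congr (_ + _); apply: eq_bigr => k _; rewrite opcoef_ord.
Qed.

Lemma entire_fam i : entire (fam i).
Proof.
rewrite /fam; case: insubP => [k _ _|_]; last exact: entire_cst.
exact: (proj1 (proj1 bF k)).
Qed.

Lemma fam_annihilated i z : \sum_(k < n.+1) opcoef z k * derive1n k (fam i) z = 0.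
Proof.
rewrite /fam; case: insubP => [k _ _|_]; first exact: solution_opcoef (proj1 bF k).
rewrite big1 // => k _; have -> : derive1n k (fun=> 0 : C) z = 0 :> C.
  by case: (nat_of_ord k) => [|j]; rewrite ?derive1n_cst.
by rewrite mulr0.
Qed.

Lemma fam_independent : independent n fam.
Proof.
move=> a H k kn; apply: (proj2 bF (fun j => a j) _ (Ordinal kn)) => z.
rewrite -[RHS](H z); apply: eq_bigr => j _.
by rewrite fam_ord.
Qed.

(** A solution outside the span would give a chain of n + 1 Wronskian
    reductions, which would cancel the leading coefficient one of the
    equation. *)
Lemma solution_in_span f : is_solution A f ->
  exists a : nat -> C, forall z, f z = \sum_(k < n) a k * fam k z.
Proof.
move=> sf; have ef := proj1 sf; apply: contrapT => /forallNP H.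
pose G i := if i is i'.+1 then fam i' else f.
have eG i : entire (G i) by case: i => [|i]; [exact: ef|exact: entire_fam].
have iG : independent n.+1 G.
  move=> a Ha.
  have a0 : a 0%N = 0.
    apply: contrapT => /eqP a0; apply: (H (fun k => - (a k.+1 / a 0%N))) => z.
    have := Ha z; rewrite big_ord_recl /= => /eqP; rewrite addr_eq0 => /eqP h.
    rewrite -[LHS](mulKf a0) h mulrN mulr_sumr -sumrN.
    by apply: eq_bigr => k _; rewrite mulNr mulrA [(a 0%N)^-1 * _]mulrC.
  move=> [//|k] kn; apply: (fam_independent (a := fun j => a j.+1) _ kn) => z.
  by have := Ha z; rewrite big_ord_recl /= a0 mul0r add0r.
have [z Hz] := @common_nonzero (head G) n.+1 (fun j _ => @entire_head R G j eG)
  (fun j jn => head_neq0 eG iG jn).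
have /eqP := annihilator_kill (al := opcoef z) eG Hz
  (fun i _ => match i with 0%N => solution_opcoef z sf | i'.+1 => fam_annihilated i' z end).
by rewrite opcoef_top oner_eq0.
Qed.

End Equation.
End SolutionEstimates.

Section LocalEstimate.
Variable R : realType.
Notation C := (R[i]^o).
Implicit Types (z w c : C) (r s x : R) (f g : C -> C).
Local Notation mu := (@lebesgue_measure R).

Lemma ln_pow4_le (K Z c0 x y : R) : 1 <= K -> 1 <= Z ->
  ln Z <= x + y + c0 -> ln (K * Z ^+ 4) <= ln K + 4 * (x + y + c0).
Proof.
move=> K1 Z1 h; have K0 := lt_le_trans ltr01 K1; have Z0 := lt_le_trans ltr01 Z1.
by rewrite lnM ?posrE ?exprn_gt0 // lnXn // -mulr_natl lerD2l; move: h; clear; lra.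
Qed.

(** Where all the heads have controlled logarithmic derivatives the
    coefficients are read off from the solutions; Cauchy's formula transports
    the bound to the disc. *)
Lemma coef_growth (n : nat) (A F : 'I_n -> C -> C) :
  (forall k, entire (A k)) -> solution_base A F ->
  exists2 D : R, 1 <= D & forall rho L M : R, 0 < L ->
  4 <= rho - n%:R * L -> 4 * L <= rho - n%:R * L -> 3 <= M ->
  1 <= L * (M + 1) -> ln (rho / L) <= M ->
  (forall i z, cabs z <= rho -> cabs (fam F i z) <= expR M) ->
  forall k w, cabs w <= rho - n%:R * L - 4 * L ->
    cabs (A k w) <= expR (D * (1 + ln (rho / L) + ln M)).
Proof.
move=> eA bF; have eG := entire_fam bF.
have [K K1 HK] := @family_radial_estimates R (head (fam F)) n n 2^-1
  (fun j _ => @entire_head R _ j eG)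
  (fun j jn => head_neq0 eG (fam_independent bF) jn) (ltac:(by rewrite invr_gt0)).
pose q : R := (n * n)%:R; have q0 : 0 <= q by [].
have K0 := lt_le_trans ltr01 K1.
have lK : 0 <= ln K by rewrite ln_ge0.
pose c0 : R := ln (4 ^+ n.+1).
have c00 : 0 <= c0 by rewrite ln_ge0 // exprn_ege1 // ler1n.
have l20 : 0 <= ln 2 :> R by rewrite ln_ge0 // ler1n.
have l40 : 0 <= ln 4 :> R by rewrite ln_ge0 // ler1n.
pose D := 2 + ln 2 + q * (ln 4 + ln K + 4 * c0 + 4).
have D1 : 1 <= D.
  have : 0 <= q * (ln 4 + ln K + 4 * c0 + 4) by rewrite mulr_ge0 // !addr_ge0 // mulr_ge0.
  by rewrite /D; move: l20; clear; lra.
exists D => // rho L M L0 R4 LR M3 LM lM HM k w wr1.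
set rho1 := rho - n%:R * L in R4 LR wr1 *.
have nL : 0 <= n%:R * L by rewrite mulr_ge0 // ltW.
have r1r : rho1 <= rho by rewrite /rho1; move: nL; clear; lra.
have r10 : 0 < rho1 by move: R4; clear; lra.
have r0 : 0 < rho := lt_le_trans r10 r1r.
have M0 : 0 < M by move: M3; clear; lra.
pose N := 4 ^+ n * M.
have MN j : (j <= n)%N -> 4 ^+ j * M <= N.
  by move=> jn; rewrite ler_pM2r // ler_weXn2l // ler1n.
have MN0 : M <= N by have := MN 0%N isT; rewrite mul1r.
have N0 : 0 < N := lt_le_trans M0 MN0.
have LN : 1 <= L * (N + 1) by apply: le_trans LM _; rewrite ler_pM2l // lerD2r.
have lnr : ln (rho1 / L) <= ln (rho / L).
  by rewrite ler_ln ?posrE ?divr_gt0 // ler_pM2r // invr_gt0.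
have RL4 : 4 <= rho1 / L by rewrite ler_pdivlMr.
have [|Bad [mBad BadL HB]] := HK rho1 L N L0 R4 LR (ltW N0) LN
    (le_trans lnr (le_trans lM MN0)).
  move=> j z jn zr; apply: le_trans (_ : expR (4 ^+ j * M) <= _); last first.
    by rewrite ler_expR MN // ltnW.
  apply: (head_growth eG L0 M3 LM HM); apply: le_trans zr _.
  rewrite /rho1 lerD2l lerN2 ler_pM2r // ler_nat; exact: ltnW.
rewrite mulrC in BadL.
have [r /andP[ra rb] nBr] := @window_avoid R Bad (rho1 - 3 * L) L mBad L0 BadL.
have rI : rho1 - 3 * L <= r <= rho1 - 2 * L by rewrite ra /=; move: rb; clear; lra.
set Z := rho1 / L * (N + 1) in HB.
have Z1 : 1 <= Z.
  rewrite /Z mulr_ege1 //; last by rewrite lerDr ltW.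
  by apply: le_trans RL4; rewrite ler1n.
pose B := K * Z ^+ 4.
have B1 : 1 <= B by rewrite mulr_ege1 // exprn_ege1.
have r00 : 0 < r by case/andP: rI => + _; move: LR L0; clear; lra.
have circ z : cabs z = r -> cabs (A k z) <= (4 * B) ^+ (n * n).
  move=> zr.
  have H1 j : (j < n)%N -> head (fam F) j z != 0 /\ forall i, (i <= n)%N ->
      cabs (derive1n i (head (fam F) j) z) <= B ^+ i * cabs (head (fam F) j z).
    by move=> jn; apply: HB; rewrite ?zr.
  have := @annihilator_bound R n n (fam F) z (opcoef A z) B eG B1 (leqnn n) H1
    (fun i _ => fam_annihilated bF i z) k (ltnW (ltn_ord k)).
  by rewrite opcoef_ord opcoef_top cabs1 mulr1.
have wr : cabs w < r by case/andP: rI => + _; move: wr1 L0; clear; lra.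
apply: le_trans (cauchy_bound r00 (eA k) wr circ) _.
have rw : L <= r - cabs w by case/andP: rI => + _; move: wr1; clear; lra.
have rr : r <= rho by case/andP: rI => _; move: r1r L0; clear; lra.
set P := (4 * B) ^+ (n * n).
have B40 : 0 < 4 * B by rewrite mulr_gt0 // (lt_le_trans ltr01).
have P0 : 0 < P by exact: exprn_gt0.
apply: le_trans (_ : 2 * P * (rho / L) <= _).
  rewrite -mulrA; apply: ler_wpM2l; first by rewrite mulr_ge0 // ltW.
  apply: ler_pM; rewrite ?invr_ge0 ?(ltW r00) //.
    by rewrite (le_trans _ rw) // ltW.
  by rewrite lef_pV2 ?posrE ?(lt_le_trans L0).
have P2 : 0 < 2 * P by rewrite mulr_gt0.
have RL0 : 0 < rho / L by rewrite divr_gt0.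
have B0 := lt_le_trans ltr01 B1.
have X0 : 0 < 2 * P * (rho / L) by exact: mulr_gt0.
have XE : ln (2 * P * (rho / L)) = ln 2 + (ln 4 + ln B) *+ (n * n) + ln (rho / L).
  have h4 : ln (4 * B) = ln 4 + ln B by rewrite lnM ?posrE.
  have h2 : ln (2 * P) = ln 2 + ln (4 * B) *+ (n * n) by rewrite lnM ?posrE // lnXn.
  by rewrite lnM ?posrE // h2 h4.
have -> : 2 * P * (rho / L) = expR (ln (2 * P * (rho / L))) by rewrite lnK ?posrE.
rewrite ler_expR XE -[_ *+ (n * n)]mulr_natl -/q.
have lnZ : ln Z <= ln (rho / L) + ln M + c0.
  rewrite /Z lnM ?posrE ?(lt_le_trans _ RL4) ?addr_gt0 // -addrA; apply: lerD => //.
  rewrite /c0 -lnM ?posrE ?exprn_gt0 // ler_ln ?posrE ?addr_gt0 ?mulr_gt0 ?exprn_gt0 //.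
  rewrite exprS [M * _]mulrC -mulrA -/N; move: MN0 M3; clear; lra.
have x0 : 0 <= ln (rho / L).
  rewrite ln_ge0 // (le_trans (_ : 1 <= 4)) ?ler1n // (le_trans RL4) // ler_pM2r // invr_gt0 //.
have y0 : 0 <= ln M by rewrite ln_ge0 //; move: M3; clear; lra.
have lB := ln_pow4_le K1 Z1 lnZ; rewrite -/B in lB.
set x := ln (rho / L) in lB x0 *; set y := ln M in lB y0 *.
have h1 : q * (ln 4 + ln B) <= q * (ln 4 + ln K + 4 * (x + y + c0)).
  by apply: ler_wpM2l => //; move: lB; clear; lra.
have xy : 0 <= x + y by rewrite addr_ge0.
have h2 : q * (ln 4 + ln K + 4 * (x + y + c0)) <= q * ((ln 4 + ln K + 4 * c0 + 4) * (1 + x + y)).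
  apply: ler_wpM2l => //.
  have h : 0 <= (ln 4 + ln K + 4 * c0) * (x + y).
    by rewrite mulr_ge0 // !addr_ge0 // mulr_ge0.
  have -> : (ln 4 + ln K + 4 * c0 + 4) * (1 + x + y) =
    ln 4 + ln K + 4 * c0 + (ln 4 + ln K + 4 * c0) * (x + y) + 4 + 4 * (x + y) by ring.
  by move: h; clear; lra.
have h3 : 0 <= ln 2 * (x + y) by rewrite mulr_ge0.
have -> : D * (1 + x + y) = 2 + 2 * (x + y) + ln 2 + ln 2 * (x + y) +
  q * ((ln 4 + ln K + 4 * c0 + 4) * (1 + x + y)) by rewrite /D; ring.
by move: h1 h2 h3 y0 x0; clear; lra.
Qed.

End LocalEstimate.

Section ProximityEstimate.
Variable R : realType.
Notation C := (R[i]^o).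
Implicit Types (z w c : C) (r s x : R) (f g : C -> C).
Local Notation mu := (@lebesgue_measure R).

Lemma solution_growth (n : nat) (F : 'I_n -> C -> C) f (a : nat -> C) (b : C) :
  (forall z, f z = \sum_(k < n) a k * fam F k z) ->
  exists2 c : R, 0 <= c & forall z (M : R), 0 <= M ->
    (forall i, cabs (fam F i z) <= expR M) -> cabs (f z - b) <= expR (M + c).
Proof.
move=> fE; pose S := \sum_(k < n) cabs (a k) + cabs b + 1.
have S0 : 0 <= \sum_(k < n) cabs (a k) by apply: sumr_ge0 => k _; exact: cabs_ge0.
have b0 := cabs_ge0 b.
have S1 : 1 <= S by rewrite lerDr addr_ge0.
exists (ln S) => [|z M M0 H]; first by rewrite ln_ge0.
rewrite expRD lnK ?posrE ?(lt_le_trans ltr01) //.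
have e1 : 1 <= expR M by rewrite -expR0 ler_expR.
apply: le_trans (cabsD _ _) _; rewrite cabsN fE.
have h : cabs (\sum_(k < n) a k * fam F k z) <= expR M * \sum_(k < n) cabs (a k).
  apply: le_trans (cabs_sum _ _ _) _; rewrite mulr_sumr; apply: ler_sum => k _.
  by rewrite cabsM mulrC ler_wpM2r ?cabs_ge0.
have h2 : cabs b <= expR M * cabs b by rewrite ler_peMl.
have -> : expR M * S = expR M * \sum_(k < n) cabs (a k) + expR M * cabs b + expR M.
  by rewrite /S; ring.
by move: h h2 e1; clear; lra.
Qed.

Lemma lincomb_shift (K : comNzRingType) n (al y y' : nat -> K) (b : K) :
  y' 0%N = y 0%N - b -> (forall k, y' k.+1 = y k.+1) ->
  \sum_(k < n.+1) al k * y k = 0 ->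
  \sum_(k < n.+1) al k * y' k = - (b * al 0%N).
Proof.
move=> y0 yS; rewrite !big_ord_recl /= => h; rewrite y0.
under eq_bigr => k _ do rewrite yS.
by rewrite mulrBr addrAC h sub0r mulrC.
Qed.

(** Applied to f - a the operator gives - a A_0. With the derivatives of
    f - a bounded by multiples of f - a itself, a lower bound for A_0 becomes
    one for f - a. *)
Lemma operator_lower_bound (n : nat) (n_gt0 : (0 < n)%N) (A : 'I_n -> C -> C)
    f (a z : C) (B V : R) : is_solution A f -> 1 <= B -> 1 <= V ->
  (forall k, cabs (A k z) <= V) ->
  (forall j, (j <= n)%N -> cabs (derive1n j (fun w => f w - a) z) <=
     B ^+ j * cabs (f z - a)) ->
  cabs a * cabs (A (Ordinal n_gt0) z) <= n.+1%:R * V * B ^+ n * cabs (f z - a).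
Proof.
move=> sf B1 V1 HA Hg; have ef := proj1 sf.
have eg : derive1n 0 (fun w => f w - a) z = derive1n 0 f z - a by [].
have egk k : derive1n k.+1 (fun w => f w - a) z = derive1n k.+1 f z.
  by rewrite (derive1nB k.+1 ef (@entire_cst R a)) derive1n_cst subr0.
have E := @lincomb_shift C n (opcoef A z) (fun k => derive1n k f z)
  (fun k => derive1n k (fun w => f w - a) z) a eg egk (solution_opcoef z sf).
have A0E : opcoef A z 0 = A (Ordinal n_gt0) z by rewrite -(opcoef_ord A z (Ordinal n_gt0)).
rewrite A0E in E.
rewrite -cabsM -cabsN -E; apply: le_trans (cabs_sum _ _ _) _.
have B0 := le_trans ler01 B1; have V0 := le_trans ler01 V1.
apply: le_trans (_ : \sum_(k < n.+1) V * (B ^+ n * cabs (f z - a)) <= _).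
  apply: ler_sum => k _; rewrite cabsM; apply: ler_pM; rewrite ?cabs_ge0 //.
    rewrite /opcoef; case: insubP => [j _ _|_]; first exact: HA.
    by rewrite cabs1.
  apply: le_trans (Hg k _) _; first by rewrite -ltnS.
  rewrite ler_wpM2r ?cabs_ge0 // ler_weXn2l //.
  by rewrite -ltnS.
by rewrite sumr_const card_ord -[leLHS]mulr_natl !mulrA.
Qed.

Lemma solution_nonconstant (n : nat) (n_gt0 : (0 < n)%N) (A : 'I_n -> C -> C) f
    (a : C) : (exists z, A (Ordinal n_gt0) z != 0) -> is_solution A f -> a != 0 ->
  exists z, f z - a != 0.
Proof.
move=> An0 sf a0; have aA0 : 0 < cabs a by rewrite cabs_gt0.
apply: contrapT => /forallNP g0.
have fa z : f z - a = 0 by apply/eqP; have /negP := g0 z; rewrite negbK.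
have g00 : (fun w => f w - a) = fun=> 0 by apply/funext.
have [z /negP] := An0; apply; pose S := \sum_(k < n) cabs (A k z).
have S0 : 0 <= S by apply: sumr_ge0 => k _; exact: cabs_ge0.
have AS k : cabs (A k z) <= 1 + S.
  rewrite /S (bigD1 k) //= addrCA lerDl addr_ge0 // sumr_ge0 // => i _.
  exact: cabs_ge0.
have dg j : (j <= n)%N -> cabs (derive1n j (fun w => f w - a) z) <= 1 ^+ j * cabs (f z - a).
  rewrite g00 fa cabs0 mulr0 => _.
  by case: j => [|j]; rewrite ?derive1n0 ?derive1n_cst cabs0.
have S1 : 1 <= 1 + S by rewrite lerDl.
have := @operator_lower_bound n n_gt0 A f a z 1 (1 + S) sf (lexx _) S1 AS dg.
rewrite fa cabs0 mulr0 pmulr_rle0 // => h.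
by rewrite -cabs_eq0 eq_le h cabs_ge0.
Qed.

(** The lower bound for [A_0] loses [Z], which is [rho / L] times the logarithm
    of the maximum of [A_0], itself of the order of [ln M] only. All the other
    losses are logarithmic in [rho / L] and [M]. *)
Lemma local_estimate (n : nat) (n_gt0 : (0 < n)%N) (A F : 'I_n -> C -> C) f (a : C)
    (eta : R) : (forall k, entire (A k)) ->
  (exists z, A (Ordinal n_gt0) z != 0) -> solution_base A F -> is_solution A f ->
  a != 0 -> 0 < eta ->
  exists2 D : R, 1 <= D & forall rho L M : R, 0 < L ->
    4 <= rho - (n%:R + 4) * L -> (n%:R + 8) * L <= rho -> 3 <= M ->
    1 <= L * (1 + ln M) -> ln (rho / L) <= M ->
    (forall i z, cabs z <= rho -> cabs (fam F i z) <= expR M) ->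
    exists Bad : set R, [/\ measurable Bad, (mu Bad <= (eta * L)%:E)%E &
      forall z, ~ Bad (cabs z) ->
      rho - (n%:R + 7) * L <= cabs z <= rho - (n%:R + 6) * L ->
      f z != a /\ - ln (cabs (f z - a)) <=
        D * (rho / L * (1 + ln (rho / L) + ln M))].
Proof.
move=> eA An0 bF sf a0 eta0; have ef := proj1 sf.
have [D0 D01 HA] := coef_growth eA bF.
have [al fE] := solution_in_span bF sf.
have [c1 c10 Hf] := solution_growth a fE.
have eg : entire (fun z => f z - a) := entireB ef (@entire_cst R a).
have aA0 : 0 < cabs a by rewrite cabs_gt0.
have gn0 : exists z, f z - a != 0 := solution_nonconstant An0 sf a0.
have eta2 : 0 < eta / 2 by rewrite divr_gt0.
have [Kg Kg1 Hg] := entire_radial_estimates n eg gn0 eta2.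
have [K0 K01 H0] := entire_radial_estimates 0 (eA (Ordinal n_gt0)) An0 eta2.
have lK : 0 <= ln Kg by rewrite ln_ge0.
pose c2 := ln (c1 + 2); have c20 : 0 <= c2 by rewrite ln_ge0 //; move: c10; clear; lra.
have ln0 : 0 <= ln n.+1%:R :> R by rewrite ln_ge0 // ler1n.
pose D := ln n.+1%:R + `|ln (cabs a)| + D0 + n%:R * (ln Kg + 4 * c2 + 4) + K0 * (2 * D0).
have nn0 : 0 <= n%:R :> R by [].
have t1 : 0 <= n%:R * (ln Kg + 4 * c2 + 4) by rewrite mulr_ge0 // !addr_ge0 // mulr_ge0.
have t2 : 0 <= K0 * (2 * D0) by rewrite mulr_ge0 ?(le_trans ler01 K01) // mulr_ge0 ?(le_trans ler01 D01).
have D1 : 1 <= D.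
  have := normr_ge0 (ln (cabs a)); rewrite /D.
  by move: ln0 D01 t1 t2; clear; lra.
exists D => // rho L M L0 R4 LR M3 LM lM HM.
set rho2 := rho - (n%:R + 4) * L in R4.
have nL : 0 <= n%:R * L by rewrite mulr_ge0 // ltW.
have r2r : rho2 <= rho by rewrite /rho2 mulrDl; move: nL L0; clear; lra.
have r20 : 0 < rho2 by move: R4; clear; lra.
have r0 : 0 < rho := lt_le_trans r20 r2r.
have LR2 : 4 * L <= rho2 by rewrite /rho2; move: LR; clear; lra.
have M0 : 0 < M by move: M3; clear; lra.
set x := ln (rho / L) in lM *; set y := ln M in LM *.
have RL4 : 4 <= rho2 / L by rewrite ler_pdivlMr.
have RL : rho2 / L <= rho / L by rewrite ler_pM2r // invr_gt0.
have x2 : ln (rho2 / L) <= x by rewrite ler_ln ?posrE ?divr_gt0.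
have RL1 : 1 <= rho / L by apply: le_trans RL; apply: le_trans RL4; rewrite ler1n.
have x0 : 0 <= x by rewrite ln_ge0.
have y0 : 0 <= y by rewrite ln_ge0 //; move: M3; clear; lra.
have yM : y <= M - 1 by have := @le_ln1Dx R (M - 1); rewrite [1 + _]addrC subrK; apply; move: M0; clear; lra.
have Lle : L * (1 + y) <= L * M by rewrite ler_pM2l //; move: yM; clear; lra.
pose Ng := M + c1; pose N0 := D0 * (1 + x + y).
have xy1 : 1 <= 1 + x + y by move: x0 y0; clear; lra.
have D00 := le_trans ler01 D01.
have N01 : 1 + x + y <= N0 by rewrite /N0 ler_peMl // (le_trans ler01).
have HAk k w : cabs w <= rho2 -> cabs (A k w) <= expR N0.
  move=> wr; apply: (HA rho L M) => //.
  - apply: le_trans R4 _; rewrite /rho2 mulrDl; move: L0; clear; lra.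
  - by move: LR; rewrite mulrDl; move: nL L0; clear; lra.
  - by apply: le_trans LM (le_trans Lle _); rewrite ler_pM2l //; clear; lra.
  - by apply: le_trans wr _; rewrite /rho2 mulrDl; clear; lra.
have [||||Bg [mBg BgL HBg]] := Hg rho2 L Ng L0 R4 LR2.
- by move: M0 c10; rewrite /Ng; clear; lra.
- by apply: le_trans LM (le_trans Lle _); rewrite ler_pM2l // /Ng; move: c10; clear; lra.
- by apply: le_trans x2 (le_trans lM _); rewrite /Ng lerDl.
- move=> z zr; apply: Hf; first exact: ltW.
  by move=> i; apply: HM; exact: le_trans r2r.
have [||||B0 [mB0 B0L HB0]] := H0 rho2 L N0 L0 R4 LR2.
- by move: N01 xy1; clear; lra.
- by apply: le_trans LM _; rewrite ler_pM2l //; move: N01 x0; clear; lra.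
- by move: x2 N01 y0; clear; lra.
- exact: HAk.
exists (Bg `|` B0); split; first exact: measurableU.
  apply: le_trans (measureU2 _ _ _) _ => //; apply: le_trans (leeD BgL B0L) _.
  by rewrite -EFinD lee_fin le_eqVlt; apply/orP; left; apply/eqP; field.
move=> z nB zI.
have zI2 : rho2 - 3 * L <= cabs z <= rho2 - 2 * L.
  by move: zI; rewrite /rho2 !mulrDl => /andP[h1 h2]; apply/andP; move: h1 h2; clear; split; lra.
have [gz _ Hd] := HBg z (fun b => nB (or_introl b)) zI2.
have [Az Al _] := HB0 z (fun b => nB (or_intror b)) zI2.
set Zg := rho2 / L * (Ng + 1) in Hd; set Z0 := rho2 / L * (N0 + 1) in Al.
have Zg1 : 1 <= Zg.
  rewrite /Zg mulr_ege1 ?(le_trans _ RL4) ?ler1n //.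
  by rewrite lerDr /Ng addr_ge0 // ltW.
pose B := Kg * Zg ^+ 4.
have B1 : 1 <= B by rewrite mulr_ege1 // exprn_ege1.
have zr2 : cabs z <= rho2 by case/andP: zI2 => _; move: L0; clear; lra.
have V1 : 1 <= expR N0 by rewrite -expR0 ler_expR (le_trans _ N01) // (le_trans ler01).
have Hop := @operator_lower_bound n n_gt0 A f a z B (expR N0) sf B1 V1
  (fun k => HAk k z zr2) Hd.
split; first by rewrite -subr_eq0.
have g0 : 0 < cabs (f z - a) by rewrite cabs_gt0.
have A0 : 0 < cabs (A (Ordinal n_gt0) z) by rewrite cabs_gt0.
have Bn0 : 0 < B ^+ n by rewrite exprn_gt0 // (lt_le_trans ltr01).
have n1 : 0 < n.+1%:R :> R by [].
have B0' := lt_le_trans ltr01 B1.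
have e0 := expR_gt0 N0.
have Hln : ln (cabs a) + ln (cabs (A (Ordinal n_gt0) z)) <=
    ln n.+1%:R + N0 + n%:R * ln B + ln (cabs (f z - a)).
  have h1 : 0 < n.+1%:R * expR N0 := mulr_gt0 n1 e0.
  have h2 : 0 < n.+1%:R * expR N0 * B ^+ n := mulr_gt0 h1 Bn0.
  have -> : n%:R * ln B = ln (B ^+ n) by rewrite lnXn // mulr_natl.
  rewrite -{1}[N0]expRK -(lnM n1 e0) -(lnM h1 Bn0) -(lnM h2 g0) -(lnM aA0 A0).
  by rewrite ler_ln ?posrE ?mulr_gt0.
have lZ : ln Zg <= x + y + c2.
  have h1 : 0 < Ng + 1 by rewrite /Ng; move: M0 c10; clear; lra.
  have h2 : 0 < c1 + 2 by move: c10; clear; lra.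
  have h3 : 0 < rho2 / L by rewrite divr_gt0.
  rewrite /Zg (lnM h3 h1) -[x + y + c2]addrA; apply: lerD => //.
  rewrite /y /c2 -(lnM M0 h2) ler_ln ?posrE ?mulr_gt0 // /Ng.
  have h : 0 <= (M - 1) * c1 by rewrite mulr_ge0 //; move: M3; clear; lra.
  have -> : M * (c1 + 2) = (M - 1) * c1 + c1 + 2 * M by ring.
  by move: h M3; clear; lra.
have lB := ln_pow4_le Kg1 Zg1 lZ; rewrite -/B in lB.
set T := 1 + x + y in xy1 N01 *; have N0E : N0 = D0 * T by [].
set P := rho / L * T.
have TP : T <= P by rewrite /P ler_peMl // (le_trans ler01).
have P1 := le_trans xy1 TP; have P0 := le_trans ler01 P1.
have q1 : K0 * Z0 <= K0 * (2 * D0) * P.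
  rewrite -mulrA; apply: ler_wpM2l; first exact: le_trans K01.
  apply: le_trans (_ : rho / L * (2 * N0) <= _).
    apply: ler_pM; rewrite ?divr_ge0 ?(ltW r20) ?(ltW L0) //.
      by move: N01 xy1; clear; lra.
    by move: N01 xy1; clear; lra.
  by rewrite N0E /P le_eqVlt; apply/orP; left; apply/eqP; ring.
have q2 : n%:R * ln B <= n%:R * (ln Kg + 4 * c2 + 4) * P.
  rewrite -mulrA; apply: ler_wpM2l => //; apply: le_trans lB _.
  have -> : ln Kg + 4 * (x + y + c2) = ln Kg + 4 * c2 + 4 * (x + y) by ring.
  have w0 : 0 <= ln Kg + 4 * c2 by rewrite addr_ge0 // mulr_ge0.
  have -> : (ln Kg + 4 * c2 + 4) * P = (ln Kg + 4 * c2) * P + 4 * P by ring.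
  apply: lerD; first by rewrite ler_peMr.
  by move: TP; rewrite /T; clear; lra.
have q3 : N0 <= D0 * P by rewrite N0E ler_wpM2l.
have q4 : ln n.+1%:R <= ln n.+1%:R * P by rewrite ler_peMr.
have q5 : - ln (cabs a) <= `|ln (cabs a)| * P.
  by apply: le_trans (norm_ln_bound aA0) _; rewrite ler_peMr.
have -> : D * P = ln n.+1%:R * P + `|ln (cabs a)| * P + D0 * P +
  n%:R * (ln Kg + 4 * c2 + 4) * P + K0 * (2 * D0) * P by rewrite /D; ring.
by move: Hln Al q1 q2 q3 q4 q5; clear; lra.
Qed.

End ProximityEstimate.

(** * Radii of regular growth outside the exceptional set *)

Section RegularGrowth.
Variable R : realType.
Implicit Types (a b c d m r s t x : R) (E : set R).
Local Notation mu := (@lebesgue_measure R).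

(** Adding a Borel null set that contains the negligible part of [E] changes no
    measure, hence no density, and makes intersections with tiles
    measurable. *)
Lemma density_majorant E : lebesgue_measurable E -> (upper_density E < 1)%E ->
  exists E' : set R, exists d X : R, [/\ measurable E', E `<=` E', 0 <= d < 1 &
    forall r, X <= r -> 0 < r -> (mu (E' `&` `[0%R, r]) <= (d * r)%:E)%E].
Proof.
move=> mE; rewrite /upper_density limf_esupE => /ereal_inf_lt[_ [V nV <-] supV].
have mE' : (@wlength R idfun)^*%mu.-cara.-measurable E.
  by rewrite -completed_caratheodory_measurable; exact: sub_sigma_algebra.
have [B mB [N [N' [mN' N'0 NN']] BN]] := mE.
have intE (r : R) : (\int[@completed_lebesgue_measure R]_(t in E `&` `[0%R, r]%classic) 1 =
    @completed_lebesgue_measure R (E `&` `[0%R, r]%classic))%E.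
  rewrite (@integral_cst _ _ _ (@completed_lebesgue_measure R)) ?mul1e //.
  apply: measurableI => //; apply: sub_caratheodory.
  exact: (@measurable_itv R).
have [d d01 supd] : exists2 d : R, 0 <= d < 1 & (ereal_sup [set ((r^-1)%:E *
    \int[@completed_lebesgue_measure R]_(t in E `&` `[0%R, r]%classic) 1)%E
    | r in V] <= d%:E)%E.
  move: supV; set S := ereal_sup _; case: S => [d|//|] h.
    exists (Num.max 0 d); last by rewrite lee_fin le_max lexx orbT.
    by rewrite le_max lexx /= gt_max ltr01 -lte_fin.
  by exists 0; rewrite ?lexx ?ltr01 ?leNye.
have [X [_ HX]] := nV.
exists (B `|` N'), d, (X + 1); split => //.
- exact: measurableU.
- by rewrite -BN; apply: setUS.
move=> r Xr r0; have Vr : V r by apply: HX; move: Xr; clear; lra.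
have := le_trans (ereal_sup_ubound _) supd => /(_ _ (ex_intro2 _ _ r Vr erefl)).
rewrite intE lee_pdivrMl // => h; rewrite mulrC.
apply: le_trans h; rewrite setIUl.
apply: le_trans (measureU2 _ _ _) _; [exact: measurableI|exact: measurableI|].
have N0r : (mu (N' `&` `[0%R, r]) <= 0)%E.
  have mI : measurable (N' `&` `[0%R, r]%classic) by exact: measurableI.
  by rewrite -N'0; apply: le_measure; rewrite ?inE //; exact: subIsetl.
apply: le_trans (leeD (lexx _) N0r) _.
rewrite adde0; apply: (@le_outer_measure R _ ((@wlength R idfun)^*%mu)).
by rewrite -BN; apply: setSI; exact: subsetUl.
Qed.

(** The derivative of the potential is [(1 - m) x^(-m)], and [x^(-m)] varies by a
    bounded factor on a step of length one. Exponentials of multiples of [ln]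
    stand for the real powers. *)
Lemma potential_drop m a b : 1 < m -> 1 <= a -> a + 1 <= b ->
  (m - 1) / (m + 1) * expR (- (m * ln a)) <=
  expR (- ((m - 1) * ln a)) - expR (- ((m - 1) * ln b)).
Proof.
move=> m1 a1 ab; pose h := m - 1.
have h0 : 0 < h by rewrite subr_gt0.
have m0 : 0 < m := lt_trans ltr01 m1.
have a0 := lt_le_trans ltr01 a1.
have b0 : 0 < b by apply: lt_le_trans ab; rewrite addr_gt0.
have a10 : 0 < a + 1 by rewrite addr_gt0.
have l1 : ln a + (a + 1)^-1 <= ln b.
  apply: le_trans (_ : ln (a + 1) <= _); last by rewrite ler_ln ?posrE.
  have := @le_ln1Dx R (- (a + 1)^-1).
  have -> : 1 + - (a + 1)^-1 = a / (a + 1) by field; rewrite gt_eqF.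
  have i1 : (a + 1)^-1 < 1 by rewrite invf_lt1 // ltrDr.
  rewrite ln_div ?posrE // => /(_ _); rewrite ltrN2 => /(_ i1).
  by clear; lra.
pose v := h / (2 * a).
have v0 : 0 < v by rewrite divr_gt0 // mulr_gt0.
have l2 : ln a + (2 * a)^-1 <= ln b.
  apply: le_trans l1; rewrite lerD2l lef_pV2 ?posrE ?mulr_gt0 //.
  by move: a1; clear; lra.
have e2 : expR (- (h * ln b)) <= expR (- (h * ln a)) * expR (- v).
  rewrite -expRD ler_expR.
  have -> : - (h * ln a) + - v = - (h * (ln a + (2 * a)^-1)) by rewrite /v; ring.
  by rewrite lerN2 ler_pM2l.
have e3 : expR (- v) <= (1 + v)^-1.
  by rewrite expRN lef_pV2 ?posrE ?expR_gt0 ?addr_gt0 // expR_ge1Dx.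
have e4 : h / (m + 1) / a <= 1 - (1 + v)^-1.
  have -> : 1 - (1 + v)^-1 = h / (2 * a + h).
    rewrite /v; move: h0 a0; clearbody h; clear; move=> h0 a0; field.
    by rewrite !gt_eqF ?addr_gt0 ?mulr_gt0.
  have -> : h / (m + 1) / a = h / ((m + 1) * a) by rewrite invfM mulrA.
  have d1 : 0 < (m + 1) * a by rewrite mulr_gt0 // addr_gt0.
  have d2 : 0 < 2 * a + h by rewrite addr_gt0 // mulr_gt0.
  rewrite ler_pM2l // lef_pV2 ?posrE //.
  have -> : (m + 1) * a = 2 * a + h * a by rewrite /h; ring.
  by rewrite lerD2l ler_peMr // ltW.
have -> : expR (- (m * ln a)) = expR (- (h * ln a)) / a.
  have -> : - (m * ln a) = - (h * ln a) + - ln a by rewrite /h; ring.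
  by rewrite expRD [expR (- ln a)]expRN lnK.
rewrite -/h; set Q := expR (- (h * ln a)).
have Q0 : 0 < Q by exact: expR_gt0.
apply: le_trans (_ : Q * (1 - (1 + v)^-1) <= _).
  have -> : h / (m + 1) * (Q / a) = Q * (h / (m + 1) / a) by ring.
  by rewrite ler_pM2l.
rewrite mulrBr mulr1 lerD2l lerN2; apply: le_trans e2 _.
by rewrite ler_pM2l.
Qed.

End RegularGrowth.

Section GoodTile.
Variable R : realType.
Implicit Types (a b c d m r s t x : R) (E : set R).
Local Notation mu := (@lebesgue_measure R).

(** The sum with delay [J] is a sum of [J] telescoping sums. *)
Lemma telescope_delay (u : nat -> R) (J N : nat) :
  (forall i j, (i <= j)%N -> u j <= u i) -> (forall i, 0 <= u i) ->
  \sum_(k < N) (u k - u (k + J)%N) <= J%:R * u 0%N.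
Proof.
move=> um u0; elim: J => [|J IH].
  by rewrite mul0r big1 // => k _; rewrite addn0 subrr.
have tel : \sum_(k < N) (u (k + J)%N - u (k + J.+1)%N) = u J - u (N + J)%N.
  elim: N {IH} => [|N IH]; first by rewrite big_ord0 add0n subrr.
  by rewrite big_ord_recr /= IH addSn addnS; ring.
apply: le_trans (_ : \sum_(k < N) (u k - u (k + J)%N) +
    \sum_(k < N) (u (k + J)%N - u (k + J.+1)%N) <= _).
  rewrite -big_split /= le_eqVlt; apply/orP; left; apply/eqP.
  by apply: eq_bigr => k _; ring.
rewrite tel -natr1 mulrDl mul1r; apply: lerD => //.
by have := um 0%N J isT; have := u0 (N + J)%N; clear; lra.
Qed.

(** Tiles of length g(t) = t / y(t)^m: a tile near which y grows by one is
    charged to a drop of y^(1-m), so these tiles are asymptotically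
    negligible; the set E' cannot nearly fill all the others. *)
Lemma good_tile (y : R -> R) s0 m c E' d X : 0 < s0 ->
  (forall s t, s0 <= s -> s <= t -> y s <= y t) ->
  (forall s, s0 <= s -> 1 <= y s) ->
  (forall Y, exists2 s, s0 <= s & Y <= y s) -> 1 < m -> 0 <= c ->
  measurable E' -> 0 <= d < 1 ->
  (forall r, X <= r -> 0 < r -> (mu (E' `&` `[0%R, r]) <= (d * r)%:E)%E) ->
  let g t := t / expR (m * ln (y t)) in
  forall Y, exists s, [/\ s0 <= s, Y <= y s &
    let t := s + g s in y (t + c * g t) <= y s + 1 /\
    (mu (E' `&` `]t, (t + g t)%R]) <= ((1 - (1 - d) / 4) * g t)%:E)%E].
Proof.
move=> s00 ym y1 yinf m1 c0 mE /andP[d0 d1] dens g Y.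
have m0 : 0 < m := lt_trans ltr01 m1.
(* small enough for (1 - eta) (1 - 2 eta) > d *)
pose eta := (1 - d) / 4; have eta0 : 0 < eta by rewrite divr_gt0 // subr_gt0.
have etaE : 4 * eta = 1 - d by rewrite /eta; field.
pose C := (m + 1) / (m - 1).
have C0 : 0 < C by rewrite divr_gt0 ?subr_gt0 // addr_gt0.
have [J cJ] : exists J : nat, c * expR (m * ln 2) <= J%:R.
  exists (Num.truncn (c * expR (m * ln 2))).+1.
  have h0 : 0 <= c * expR (m * ln 2) by rewrite mulr_ge0 // expR_ge0.
  by have /andP[_ /ltW] := truncn_itv h0.
pose Q := C * J.+1%:R / eta.
have Q0 : 0 < Q by rewrite divr_gt0 // mulr_gt0.
pose Psi (a : R) := expR (- ((m - 1) * ln a)).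
have [s1 s01 ys1] := yinf (Num.max Y (expR (ln Q / (m - 1)))).
have [yY yQ] : Y <= y s1 /\ expR (ln Q / (m - 1)) <= y s1.
  by move: ys1; rewrite ge_max => /andP[].
have Psi0 : C * (J.+1%:R * Psi (y s1)) <= eta.
  have h : Psi (y s1) <= Q^-1.
    rewrite /Psi -[Q]lnK ?posrE // -expRN ler_expR lerN2 mulrC -ler_pdivrMr ?subr_gt0 //.
    by rewrite -[leLHS]expRK ler_ln ?posrE ?expR_gt0 // (lt_le_trans ltr01) // y1.
  apply: le_trans (_ : C * (J.+1%:R * Q^-1) <= _).
    by rewrite ler_pM2l // ler_pM2l.
  rewrite /Q le_eqVlt; apply/orP; left; apply/eqP; field.
  by rewrite !gt_eqF // addr_gt0.
apply: contrapT => /forallNP H.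
have [t [t0E tS]] : exists t : nat -> R, t 0%N = s1 /\ forall k, t k.+1 = t k + g (t k).
  by exists (fun k => iter k (fun s => s + g s) s1).
have gpos s : s0 <= s -> 0 < g s.
  by move=> ss; rewrite divr_gt0 ?expR_gt0 // (lt_le_trans s00).
have ts0 k : s0 <= t k.
  elim: k => [|k IH]; first by rewrite t0E.
  by rewrite tS; apply: (le_trans IH); rewrite lerDl ltW // gpos.
have tmono i j : (i <= j)%N -> t i <= t j.
  move=> /subnK <-; elim: (j - i)%N => [|k IH]; first by rewrite add0n.
  by apply: le_trans IH _; rewrite addSn tS lerDl ltW // gpos.
have tpos k : 0 < t k := lt_le_trans s00 (ts0 k).
have yt1 k : 1 <= y (t k) by apply: y1.
have ypos k : 0 < y (t k) := lt_le_trans ltr01 (yt1 k).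
have ytm i j : (i <= j)%N -> y (t i) <= y (t j) by move=> ij; apply: ym => //; exact: tmono.
have yYt k : Y <= y (t k) by apply: le_trans yY _; rewrite -t0E; exact: ytm.
pose bad k := y (t k) + 1 < y (t k.+1 + c * g (t k.+1)).
(* near a tile where y has not grown by one, the tiles have comparable lengths,
   and J of them cover the required distance *)
have jump k : bad k -> y (t k) + 1 <= y (t (k.+1 + J)%N).
  move=> bk; rewrite leNgt; apply/negP => small.
  have y2 : y (t (k.+1 + J)%N) <= 2 * y (t k.+1).
    by have := ytm k k.+1 (leqnSn k); have := yt1 k; move: small; clear; lra.
  have step j : (j <= J)%N -> t k.+1 + j%:R * (g (t k.+1) / expR (m * ln 2)) <= t (k.+1 + j)%N.
    elim: j => [|j IH] jJ; first by rewrite mul0r addr0 addn0.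
    rewrite addnS (tS (k.+1 + j)%N) -natr1 mulrDl mul1r addrA; apply: lerD; first exact: IH (ltnW jJ).
    rewrite /g -mulrA -invfM -expRD; apply: ler_pM; rewrite ?invr_ge0 ?expR_ge0 ?(ltW (tpos _)) //.
      by apply: tmono; rewrite leq_addr.
    rewrite lef_pV2 ?posrE ?expR_gt0 // ler_expR -mulrDr ler_pM2l // addrC -lnM ?posrE //.
    rewrite ler_ln ?posrE ?mulr_gt0 //; apply: le_trans y2; apply: ytm.
    by rewrite leq_add2l ltnW.
  have far : t k.+1 + c * g (t k.+1) <= t (k.+1 + J)%N.
    apply: le_trans (step J (leqnn J)); rewrite lerD2l.
    have -> : J%:R * (g (t k.+1) / expR (m * ln 2)) =
      J%:R / expR (m * ln 2) * g (t k.+1) by ring.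
    by rewrite ler_wpM2r ?(ltW (gpos _ (ts0 _))) // ler_pdivlMr ?expR_gt0.
  have := ym _ _ _ far; rewrite (le_trans (ts0 k.+1)) ?lerDl; last first.
    by rewrite mulr_ge0 // ltW // gpos.
  by move=> /(_ isT); move: small bk; rewrite /bad; clear; lra.
pose w k := if bad k then g (t k.+1) else 0.
pose u k := Psi (y (t k)).
have um i j : (i <= j)%N -> u j <= u i.
  move=> ij; rewrite /u /Psi ler_expR lerN2 ler_pM2l ?subr_gt0 // ler_ln ?posrE //.
  exact: ytm.
have w_le N k : (k < N)%N -> w k <= t N.+1 * (C * (u k - u (k + J.+1)%N)).
  move=> kN; have U0 : 0 <= C * (u k - u (k + J.+1)%N).
    by rewrite mulr_ge0 ?(ltW C0) // subr_ge0 um // leq_addr.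
  rewrite /w; case: ifP => [bk|_]; last by rewrite mulr_ge0 // ltW.
  apply: ler_pM; rewrite ?invr_ge0 ?expR_ge0 ?(ltW (tpos _)) //.
    by apply: tmono; rewrite ltnS ltnW.
  rewrite -expRN; apply: le_trans (_ : expR (- (m * ln (y (t k)))) <= _).
    by rewrite ler_expR lerN2 ler_pM2l // ler_ln ?posrE // ytm.
  have := potential_drop m1 (yt1 k) (jump k bk).
  rewrite -addSnnS -/(Psi _) -/(Psi _) -/(u k) -/(u _) => h.
  rewrite -ler_pdivrMl // /C invf_div; exact: h.
have W_le N : \sum_(k < N) w k <= eta * t N.+1.
  apply: le_trans (_ : \sum_(k < N) t N.+1 * (C * (u k - u (k + J.+1)%N)) <= _).
    by apply: ler_sum => k _; exact: w_le.
  rewrite -!mulr_sumr [leRHS]mulrC ler_pM2l //; apply: le_trans Psi0.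
  rewrite ler_pM2l //; have -> : Psi (y s1) = u 0%N by rewrite /u t0E.
  by apply: telescope_delay => // i; exact: expR_ge0.
have e1 : 0 < 1 - eta by move: etaE d0; clear; lra.
(* by the assumption for contradiction, E' nearly fills each tile that is not
   bad *)
have mass N : (((1 - eta) * (t N.+1 - t 1%N - \sum_(k < N) w k))%:E <=
    mu (E' `&` `](t 1%N), (t N.+1)]))%E.
  elim: N => [|N IH]; first by rewrite big_ord0 subrr subr0 mulr0 measure_ge0.
  have split_itv : E' `&` `]t 1%N, t N.+2]%classic =
      (E' `&` `]t 1%N, t N.+1]%classic) `|` (E' `&` `]t N.+1, t N.+2]%classic).
    rewrite -setIUr; congr (_ `&` _); apply/seteqP; split=> x /=; rewrite !in_itv /=.
      by move=> /andP[h1 h2]; have [h|h] := leP x (t N.+1); [left|right]; apply/andP.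
    have h1 := tmono 1%N N.+1 isT; have h2 := tmono N.+1 N.+2 (leqnSn _).
    by move=> [|] /andP[h3 h4]; apply/andP; split; move: h1 h2 h3 h4; clear; lra.
  rewrite split_itv measureU; [|exact: measurableI|exact: measurableI|]; last first.
    apply/seteqP; split=> // x /= [[_ +] [_]]; rewrite !in_itv /= => /andP[_ h1] /andP[h2 _].
    by move: h1 h2; clear; lra.
  rewrite big_ord_recr /=.
  have -> : (1 - eta) * (t N.+2 - t 1%N - (\sum_(k < N) w k + w N)) =
    (1 - eta) * (t N.+1 - t 1%N - \sum_(k < N) w k) + (1 - eta) * (g (t N.+1) - w N).
    by rewrite (tS N.+1); ring.
  rewrite EFinD; apply: leeD IH _; rewrite /w; case: ifP => [_|bN].
    by rewrite subrr mulr0 measure_ge0.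
  rewrite subr0 leNgt; apply/negP => h; apply: (H (t N)); split => //=.
  by rewrite -!tS; split; [rewrite leNgt -/(bad N) bN|exact: ltW].
have unb B : exists N, B <= t N.+1.
  apply: contrapT => /forallNP HB.
  have tB k : t k <= B.
    by apply: le_trans (tmono k k.+1 (leqnSn k)) _; apply: ltW; rewrite ltNge; apply/negP; exact: HB.
  pose del := t 0%N / expR (m * ln (y B)).
  have s1p : 0 < t 0%N := tpos 0%N.
  have del0 : 0 < del by rewrite divr_gt0 ?expR_gt0.
  have yB : 0 < y B by apply: lt_le_trans (ypos 0%N) _; apply: ym (tB 0%N).
  have lin k : t 0%N + k%:R * del <= t k.
    elim: k => [|k IH]; first by rewrite mul0r addr0.
    rewrite tS -natr1 mulrDl mul1r addrA; apply: lerD IH _.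
    rewrite /del /g; apply: ler_pM; rewrite ?invr_ge0 ?expR_ge0 ?(ltW s1p) //.
      exact: (tmono 0%N).
    rewrite lef_pV2 ?posrE ?expR_gt0 // ler_expR ler_pM2l // ler_ln ?posrE //.
    exact: ym (tB k).
  have := lin (Num.truncn (B / del)).+1; have := tB (Num.truncn (B / del)).+1.
  have B0 : 0 <= B / del by rewrite divr_ge0 ?(ltW del0) // (le_trans _ (tB 0%N)) // ltW.
  have /andP[_] := truncn_itv B0; rewrite ltr_pdivrMr // => h1 h2 h3.
  by move: h1 h2 h3 s1p; clear; lra.
have [N HN] := unb (Num.max X (t 1%N / eta + 1)).
move: HN; rewrite ge_max => /andP[XN tN].
have sub : E' `&` `]t 1%N, t N.+1]%classic `<=` E' `&` `[0, t N.+1]%classic.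
  move=> x [Ex]; rewrite /= !in_itv /= => /andP[h1 h2]; split => //.
  by rewrite h2 andbT; have := tpos 1%N; move: h1; clear; lra.
have submu : (mu (E' `&` `]t 1%N, t N.+1]%classic) <= mu (E' `&` `[0%R, t N.+1]%classic))%E.
  by apply: le_measure; rewrite ?inE //; exact: measurableI.
have := le_trans (mass N) (le_trans submu (dens _ XN (tpos _))).
rewrite lee_fin => final.
have W := W_le N; set tt := t N.+1 in final W tN; set S := \sum_(k < N) w k in final W.
have tt0 : 0 < tt := tpos _.
have t1 : t 1%N <= eta * tt.
  rewrite mulrC -ler_pdivrMr //; move: tN; clear; lra.
have : (1 - eta) * ((1 - 2 * eta) * tt) <= d * tt.
  apply: le_trans final; rewrite ler_pM2l //; move: W t1; clear; lra.
rewrite mulrA ler_pM2r //.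
have : 0 < eta * eta by exact: mulr_gt0.
have -> : (1 - eta) * (1 - 2 * eta) = 1 - 3 * eta + 2 * (eta * eta) by ring.
by move: etaE eta0; clear; lra.
Qed.

End GoodTile.

(** * Maximum modulus and characteristic function *)

Section MaximumModulus.
Variable R : realType.
Notation C := (R[i]^o).
Implicit Types (z w c : C) (r s x : R) (f g : C -> C).

Definition max_mod (n : nat) (F : 'I_n -> C -> C) s : R :=
  sup [set \sum_(k < n) cabs (F k z) | z in [set z | cabs z <= s]].

Section Family.
Variables (n : nat) (F : 'I_n -> C -> C).
Hypothesis eF : forall k, entire (F k).

Lemma max_mod_has_sup s : 0 <= s ->
  has_sup [set \sum_(k < n) cabs (F k z) | z in [set z | cabs z <= s]].
Proof.
move=> s0; split; first by exists (\sum_(k < n) cabs (F k 0)); exists 0; rewrite //= cabs0.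
pose B (k : 'I_n) := s2val (cid2 (circle_bound s (@eF k))).
exists (\sum_(k < n) B k) => _ [z zs <-]; apply: ler_sum => k _.
by rewrite /B; case: cid2 => /= M _; apply.
Qed.

Lemma max_mod_ub s z : cabs z <= s -> \sum_(k < n) cabs (F k z) <= max_mod F s.
Proof.
move=> zs; apply: ub_le_sup; last by exists z.
by apply: (max_mod_has_sup (le_trans (cabs_ge0 z) zs)).2.
Qed.

Lemma max_mod_term s z k : cabs z <= s -> cabs (F k z) <= max_mod F s.
Proof.
move=> zs; apply: le_trans (max_mod_ub zs).
by rewrite (bigD1 k) //= lerDl sumr_ge0 // => i _; exact: cabs_ge0.
Qed.

Lemma max_mod_le s (B : R) : 0 <= s ->
  (forall z, cabs z <= s -> \sum_(k < n) cabs (F k z) <= B) -> max_mod F s <= B.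
Proof.
move=> s0 H; apply: ge_sup; first exact: (max_mod_has_sup s0).1.
by move=> _ [z zs <-]; exact: H.
Qed.

Lemma max_mod_mono s r : 0 <= s -> s <= r -> max_mod F s <= max_mod F r.
Proof.
by move=> s0 sr; apply: max_mod_le => // z zs; apply: max_mod_ub; exact: le_trans sr.
Qed.

Lemma cont_characteristic_integrand r : continuous (fun t : R =>
  ln (Num.sqrt (1 + \sum_(k < n) cabs (F k (circle_point r t)) ^+ 2))).
Proof.
have S0 t : 0 < 1 + \sum_(k < n) cabs (F k (circle_point r t)) ^+ 2.
  by rewrite ltr_pwDl // sumr_ge0 // => k _; exact: sqr_ge0.
apply: cont_ln => [|t]; last by rewrite sqrtr_gt0.
have cS : continuous (fun t : R => 1 + \sum_(k < n) cabs (F k (circle_point r t)) ^+ 2).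
  apply: contD; first exact: cont_cst.
  elim: (index_enum _) => [|k l IH].
    by under eq_fun do rewrite big_nil; exact: cont_cst.
  under eq_fun do rewrite big_cons expr2.
  have ck := @cont_cabs R _ (tcont_entire r (@eF k)).
  by apply: contD => //; exact: contM.
by move=> t; apply: continuous_comp; [exact: cS|exact: sqrt_continuous].
Qed.

(** The maximum modulus is controlled by the characteristic function on a
    larger circle, since the logarithm of the modulus is subharmonic. *)
Lemma max_mod_characteristic (T : R -> R) s r : 0 <= s -> s < r ->
  T r = circle_mean (fun z => ln (Num.sqrt (1 + \sum_(k < n) cabs (F k z) ^+ 2))) r ->
  max_mod F s <= n%:R * (2 * expR ((r + s) / (r - s) * (T r + ln 3))).
Proof.
move=> s0 sr TE; have r0 : 0 < r := le_lt_trans s0 sr.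
pose u t := ln (Num.sqrt (1 + \sum_(k < n) cabs (F k (circle_point r t)) ^+ 2)).
have cu : continuous u := @cont_characteristic_integrand r.
have c3 : continuous (fun t : R => u t + ln 3) by apply: contD => //; exact: cont_cst.
have Tu : T r + ln 3 = rmean (fun t => u t + ln 3).
  by rewrite rmeanD ?rmean_cst //; [rewrite TE circle_meanE|exact: cont_cst].
have S0 t : 0 <= \sum_(k < n) cabs (F k (circle_point r t)) ^+ 2.
  by apply: sumr_ge0 => k _; exact: sqr_ge0.
have u0 t : 0 <= u t.
  rewrite ln_ge0 // -[leLHS]sqrtr1 ler_wsqrtr // lerDl; exact: S0.
have T0 : 0 <= T r + ln 3.
  by rewrite Tu; apply: rmean_ge0 => t; rewrite addr_ge0 // ln_ge0 // ler1n.
apply: max_mod_le => // z zs.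
have zr : cabs z < r := le_lt_trans zs sr.
rewrite -[n in n%:R]card_ord -sumr_const mulr_suml; apply: ler_sum => k _.
rewrite mul1r; apply: le_trans (log_max_bound (@eF k) r0 c3 _ zr) _.
  move=> t; rewrite /u expRD !lnK ?posrE ?sqrtr_gt0 // ?ltr_pwDl //.
  set Q := Num.sqrt _.
  have Q1 : 1 <= Q by rewrite /Q -[leLHS]sqrtr1 ler_wsqrtr // lerDl; exact: S0.
  have Qk : cabs (F k (circle_point r t)) <= Q.
    rewrite -[leLHS]ger0_norm ?cabs_ge0 // -sqrtr_sqr ler_wsqrtr //.
    rewrite (bigD1 k) //= addrCA lerDl addr_ge0 // sumr_ge0 // => i _; exact: sqr_ge0.
  by move: Q1 Qk; clear; lra.
rewrite ler_pM2l // ler_expR -Tu; apply: ler_wpM2r => //.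
apply: ler_pM; rewrite ?addr_ge0 ?invr_ge0 ?subr_ge0 ?cabs_ge0 ?(ltW r0) ?(ltW zr) //.
  by rewrite lerD2l.
by rewrite lef_pV2 ?posrE ?subr_gt0 // lerD2l lerN2.
Qed.

End Family.

(** By Liouville's theorem, since no nonzero constant solves the equation when
    [A_0] does not vanish identically. *)
Lemma max_mod_unbounded (n : nat) (n_gt0 : (0 < n)%N) (A F : 'I_n -> C -> C) :
  (exists z, A (Ordinal n_gt0) z != 0) -> solution_base A F ->
  forall B, exists2 s, 0 <= s & B <= max_mod F s.
Proof.
move=> An0 bF B; have eF k : entire (F k) := proj1 (proj1 bF k).
apply: contrapT => H; pose k0 := Ordinal n_gt0.
have bd z : cabs (F k0 z) <= B.
  apply: le_trans (max_mod_term eF k0 (lexx (cabs z))) _; apply: ltW; rewrite ltNge.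
  by apply/negP => h; apply: H; exists (cabs z) => //; exact: cabs_ge0.
have Fc := liouville (eF k0) bd; set a := coef (F k0) 0 in Fc.
have [a0|a0] := eqVneq a 0.
  have lin z : \sum_(k < n) (k == k0)%:R * F k z = 0.
    rewrite big1 // => k _; case: eqP => [->|_]; last by rewrite mul0r.
    by rewrite Fc a0 mulr0.
  by have /eqP := proj2 bF (fun k => (k == k0)%:R) lin k0; rewrite eqxx oner_eq0.
have [z] := solution_nonconstant An0 (proj1 bF k0) a0.
by rewrite Fc subrr eqxx.
Qed.

End MaximumModulus.

(** * Comparison on good radii *)

Section GoodRadii.
Variable R : realType.
Notation C := (R[i]^o).
Implicit Types (z w c : C) (r s x : R) (f g : C -> C).
Local Notation mu := (@lebesgue_measure R).

(** From [v <= exp v] at [v = a / (2 m)], squared. *)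
Lemma ln_le_linear (m a : R) : 0 < m -> 0 < a -> 4 * m ^+ 2 <= a -> m * ln a <= a.
Proof.
move=> m0 a0 ma; rewrite mulrC -ler_pdivlMr // -ler_expR lnK ?posrE //.
have am0 : 0 <= a / m / 2 by rewrite !divr_ge0 // ltW.
have h : a / m / 2 <= expR (a / m / 2).
  by have := expR_ge1Dx (a / m / 2); clear; lra.
have -> : a / m = a / m / 2 + a / m / 2 by field; rewrite gt_eqF.
rewrite expRD; apply: le_trans (ler_pM am0 am0 h h).
have -> : a / m / 2 * (a / m / 2) = a * (a / (4 * m ^+ 2)) by field; rewrite gt_eqF.
by rewrite ler_peMr ?(ltW a0) // ler_pdivlMr ?mul1r // mulr_gt0 // exprn_gt0.
Qed.

(** The bound 320 makes [exp (x / 2) >= 20 x], so that the product of [x] and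
    [exp (x / 2)] stays well below [exp x]. *)
Lemma characteristic_lower (N K x T : R) : 1 <= N -> N <= x -> 320 <= x ->
  0 <= K -> K <= x ->
  expR (expR x) <= N * (2 * expR (5 * K * (T + ln 3))) -> expR (x / 2) <= T.
Proof.
move=> N1 Nx x320 K0 Kx H; rewrite leNgt; apply/negP => Th.
set h := expR (x / 2) in Th.
have N0 := lt_le_trans ltr01 N1.
have {}H : expR x <= ln (N * 2) + 5 * K * (T + ln 3).
  rewrite -ler_expR expRD lnK ?posrE ?mulr_gt0 //.
  by apply: le_trans H _; rewrite mulrA.
have l2 : ln (N * 2) <= 2 * x.
  have := @le_ln1Dx R (N * 2 - 1); rewrite [1 + _]addrC subrK => l.
  by apply: le_trans (l _) _; move: N1 Nx; clear; lra.
have l3 : ln 3 <= 2 :> R.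
  have -> : 3 = 1 + 2 :> R by ring.
  by apply: le_ln1Dx; clear; lra.
have hh : expR x = h * h by rewrite /h -expRD; congr expR; field.
have x0 : 0 <= x by move: x320; clear; lra.
have k1 : K * (T + ln 3) <= x * (h + 2).
  apply: le_trans (_ : K * (h + 2) <= _).
    by apply: ler_wpM2l => //; move: Th l3; clear; lra.
  by apply: ler_wpM2r => //; rewrite addr_ge0 // expR_ge0.
have q : x / 4 <= expR (x / 4) by have := expR_ge1Dx (x / 4); clear; lra.
have x40 : 0 <= x / 4 by rewrite divr_ge0.
have hx : 20 * x <= h.
  have -> : h = expR (x / 4) * expR (x / 4) by rewrite /h -expRD; congr expR; field.
  apply: le_trans (ler_pM x40 x40 q q).
  have -> : x / 4 * (x / 4) = x / 16 * x by field.
  by apply: ler_wpM2r => //; move: x320; clear; lra.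
have h1 : 1 <= h by move: hx x320; clear; lra.
have p1 : 20 * x * h <= h * h by apply: ler_wpM2r => //; move: h1; clear; lra.
have p2 : x * 1 <= x * h by apply: ler_wpM2l.
have : h * h <= 2 * x + 5 * (x * (h + 2)).
  by rewrite -hh; apply: le_trans H _; apply: lerD => //; rewrite -mulrA ler_pM2l.
rewrite mulrDr => p3.
have p4 : 20 * x * h = 20 * (x * h) by ring.
by move: p1 p2 p3 p4 x320; clear; lra.
Qed.

Lemma Phi_lower (m a T : R) : 0 <= m -> 4 <= a -> expR (expR a / 2) <= T ->
  expR a / 2 * (expR (m * ln a) / expR (m * ln 2)) <=
  ln T * expR (m * ln (ln (ln T))).
Proof.
move=> m0 a4 H; have T0 : 0 < T := lt_le_trans (expR_gt0 _) H.
have ea0 : 0 < expR a / 2 by rewrite divr_gt0 // expR_gt0.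
have l1 : expR a / 2 <= ln T by rewrite -[leLHS]expRK ler_ln ?posrE ?expR_gt0.
have lT0 := lt_le_trans ea0 l1.
have l2 : a - ln 2 <= ln (ln T).
  apply: le_trans (_ : ln (expR a / 2) <= _); last by rewrite ler_ln ?posrE.
  by rewrite ln_div ?posrE ?expR_gt0 // expRK.
have ln21 := @ln2_le1 R.
have a20 : 0 < a / 2 by move: a4; clear; lra.
have l3 : a / 2 <= ln (ln T) by move: l2 ln21 a4; clear; lra.
have llT0 := lt_le_trans a20 l3.
have q0 : 0 <= expR (m * ln a) / expR (m * ln 2) by rewrite divr_ge0 // expR_ge0.
apply: (ler_pM (ltW ea0) q0 l1).
rewrite -expRB ler_expR -mulrBr; apply: ler_wpM2l => //.
rewrite -ln_div ?posrE //; last by move: a4; clear; lra.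
by rewrite ler_ln ?posrE.
Qed.

Lemma triple_log (M : R) : expR (expR (expR 1)) <= M ->
  1 <= ln (ln (ln M)) /\ expR (expR (expR (ln (ln (ln M))))) = M.
Proof.
move=> H; have M0 := lt_le_trans (expR_gt0 _) H.
have h1 : expR (expR 1) <= ln M by rewrite -[leLHS]expRK ler_ln ?posrE ?expR_gt0.
have l0 := lt_le_trans (expR_gt0 _) h1.
have h2 : expR 1 <= ln (ln M) by rewrite -[leLHS]expRK ler_ln ?posrE ?expR_gt0.
have l1 := lt_le_trans (expR_gt0 _) h2.
split; last by rewrite !lnK ?posrE.
by rewrite -[leLHS]expRK ler_ln ?posrE ?expR_gt0.
Qed.

Lemma tile_avoid (E' Bad : set R) (t w d e : R) : measurable E' -> measurable Bad ->
  0 < w -> (mu (E' `&` `]t, (t + w)%R]) <= (d * w)%:E)%E ->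
  (mu Bad <= (e * w)%:E)%E -> d + e < 1 ->
  exists r, [/\ t < r <= t + w, ~ E' r & ~ Bad r].
Proof.
move=> mE mB w0 Ew Bw de; apply: contrapT => /forallNP H.
have sub : `]t, t + w]%classic `<=` (E' `&` `]t, t + w]%classic) `|` Bad.
  move=> r rI; have [Er|nE] := pselect (E' r); first by left.
  have [Br|nB] := pselect (Bad r); first by right.
  by case: (H r); split => //; move: rI; rewrite /= in_itv.
have : (mu `]t, (t + w)%R]%classic <= (d * w)%:E + (e * w)%:E)%E.
  apply: le_trans (_ : mu ((E' `&` `]t, (t + w)%R]%classic) `|` Bad) <= _)%E.
    apply: le_measure; rewrite ?inE //; apply: measurableU => //.
    exact: measurableI.
  apply: le_trans (measureU2 _ _ _) _ => //; first exact: measurableI.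
  exact: leeD.
rewrite lebesgue_measure_itv /= lte_fin ltrDl w0 -EFinB -EFinD lee_fin -mulrDl.
have -> : t + w - t = 1 * w by ring.
by rewrite ler_pM2r // leNgt de.
Qed.

End GoodRadii.

Section ExceptionalRadii.
Variable R : realType.
Notation C := (R[i]^o).
Implicit Types (z w c : C) (r s x : R) (f g : C -> C).
Local Notation mu := (@lebesgue_measure R).

(** Along good tiles everything is comparable: with a the triple logarithm of
    the maximum modulus, the proximity to the value is at most a constant times
    a^m exp(a), while the characteristic function is at least
    exp(exp(a) / 2). *)
Lemma exceptional_radii (n : nat) (n_gt0 : (0 < n)%N) (A F : 'I_n -> C -> C)
    (T : R -> R) f (al : C) (E : set R) (m : R) :
  (forall k, entire (A k)) -> (exists z, A (Ordinal n_gt0) z != 0) ->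
  solution_base A F ->
  (forall r, 0 <= r -> T r =
    circle_mean (fun z => ln (Num.sqrt (1 + \sum_(k < n) cabs (F k z) ^+ 2))) r) ->
  is_solution A f -> al != 0 -> lebesgue_measurable E ->
  (upper_density E < 1)%E -> 1 < m ->
  exists2 D : R, 0 < D & forall X : R, exists r, [/\ X < r, 0 < r, ~ E r &
    let Phi := ln (T r) * expR (m * ln (ln (ln (T r)))) in
    [/\ 0 < Phi, 0 < ln (ln (T r)) & forall z, cabs z = r -> f z != al /\
      - ln (cabs (f z - al)) <= D * Phi]].
Proof.
move=> eA An0 bF TE sf al0 mE dE m1.
have eF k : entire (F k) := proj1 (proj1 bF k).
have m0 : 0 < m := lt_trans ltr01 m1.
have [E' [d [X0 [mE' EE' d01 dens]]]] := density_majorant mE dE.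
have /andP[d0 d1] := d01.
(* half of the proportion of a good tile that E' leaves free *)
pose eta := (1 - d) / 8; have eta0 : 0 < eta by rewrite divr_gt0 // subr_gt0.
have [D D1 HD] := local_estimate eA An0 bF sf al0 eta0.
pose c : R := n%:R + 7; have c7 : 7 <= c by rewrite lerDr.
have [s' s'0 Ms'] := max_mod_unbounded An0 bF (expR (expR (expR 1))).
have [s0 s04 s's0] : exists2 s0 : R, 4 <= s0 & s' <= s0.
  by exists (Num.max 4 s'); rewrite le_max lexx ?orbT.
have s00 : 0 < s0 by apply: lt_le_trans s04.
have [y [y1 yE]] : exists y : R -> R, (forall s, s0 <= s -> 1 <= y s) /\
    forall s, s0 <= s -> expR (expR (expR (y s))) = max_mod F s.
  have big s : s0 <= s -> expR (expR (expR 1)) <= max_mod F s.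
    by move=> h; apply: le_trans Ms' _; apply: max_mod_mono => //; exact: le_trans h.
  exists (fun s => ln (ln (ln (max_mod F s)))).
  by split=> s /big/triple_log[].
have ycmp s t : expR (expR (expR (y s))) <= expR (expR (expR (y t))) -> y s <= y t.
  by rewrite !ler_expR.
have ym s t : s0 <= s -> s <= t -> y s <= y t.
  move=> ss st; have tt := le_trans ss st; apply: ycmp; rewrite (yE s ss) (yE t tt).
  by apply: max_mod_mono => //; exact: le_trans (ltW s00) ss.
have yinf Y : exists2 s, s0 <= s & Y <= y s.
  have [s ss Ms] := max_mod_unbounded An0 bF (expR (expR (expR Y))).
  have [s2 s02 s2s] : exists2 s2, s0 <= s2 & s <= s2.
    by exists (Num.max s0 s); rewrite le_max lexx ?orbT.
  exists s2 => //; have : expR (expR (expR Y)) <= expR (expR (expR (y s2))).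
    by rewrite (yE s2 s02); apply: le_trans Ms _; exact: max_mod_mono.
  by rewrite !ler_expR.
have c0 : 0 <= c by move: c7; clear; lra.
have tile := good_tile s00 ym y1 yinf m1 c0 mE' d01 dens.
pose P2 := expR (m * ln 2); have P20 : 0 < P2 := expR_gt0 _.
pose D2 := D * ((P2 + c) * (4 * expR 1)).
have D20 : 0 < D2.
  have Dp := lt_le_trans ltr01 D1.
  have cp : 0 < P2 + c by move: P20 c0; clear; lra.
  have e10 := expR_gt0 (1 : R).
  exact: (mulr_gt0 Dp (mulr_gt0 cp (mulr_gt0 (ltr0n R 4) e10))).
exists (D2 * (2 * P2)); first by apply: mulr_gt0 => //; exact: mulr_gt0.
move=> X.
(* a lower bound on the triple logarithm which exceeds every threshold below and
   forces the radius beyond X *)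
pose Y := `|y (Num.max X s0)| + 1 + 320 + c + 4 * m ^+ 2.
have [s [ss Ys tl]] := tile Y.
have ms0 : 0 <= 4 * m ^+ 2 by rewrite mulr_ge0 // sqr_ge0.
pose a := y s; rewrite -/a in Ys.
have [a320 ac am aX] : [/\ 320 <= a, c <= a, 4 * m ^+ 2 <= a & y (Num.max X s0) < a].
  have h1 := normr_ge0 (y (Num.max X s0)); have h2 := ler_norm (y (Num.max X s0)).
  by split; move: Ys ms0 c7 h1 h2; rewrite /Y; clear; lra.
have Xs : X < s.
  rewrite ltNge; apply/negP => sX; move: aX; rewrite ltNge => /negP; apply.
  by apply: ym => //; rewrite le_max sX.
pose Ka := expR (m * ln a).
have a0 : 0 < a by move: a320; clear; lra.
have la0 : 0 <= ln a by rewrite ln_ge0 //; move: a320; clear; lra.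
have Ka1 : 1 <= Ka by rewrite -expR0 ler_expR mulr_ge0 // ltW.
have Ka0 := lt_le_trans ltr01 Ka1.
have Kae : Ka <= expR a by rewrite ler_expR ln_le_linear.
have sp : 0 < s := lt_le_trans s00 ss.
pose t := s + s / Ka; pose b := y t; pose Kb := expR (m * ln b); pose w := t / Kb.
have [good massE] : y (t + c * w) <= a + 1 /\
  (mu (E' `&` `]t, (t + w)%R]) <= ((1 - (1 - d) / 4) * w)%:E)%E := tl.
have ga0 : 0 < s / Ka by exact: divr_gt0.
have gas : s / Ka <= s by rewrite ler_pdivrMr // ler_peMr // ltW.
have st : s < t by rewrite ltrDl.
have t2s : t <= 2 * s by rewrite /t -/a -/Ka; move: gas; clear; lra.
have tp : 0 < t := lt_trans sp st.
have s0t : s0 <= t := le_trans ss (ltW st).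
have ab : a <= b by apply: ym => //; exact: ltW.
have b0 : 0 < b := lt_le_trans a0 ab.
have lb0 : 0 <= ln b by rewrite ln_ge0 //; move: a320 ab; clear; lra.
have Kb1 : 1 <= Kb by rewrite -expR0 ler_expR mulr_ge0 // ltW.
have Kb0 := lt_le_trans ltr01 Kb1.
have w0 : 0 < w by exact: divr_gt0.
have wt : w <= t by rewrite /w ler_pdivrMr // ler_peMr // ltW.
pose rho := t + c * w; rewrite -/rho in good.
have cw : 0 <= c * w by rewrite mulr_ge0 // ltW.
have trho : t <= rho by rewrite lerDl.
have s0rho : s0 <= rho := le_trans s0t trho.
pose br := y rho; rewrite -/br in good; have bbr : b <= br by apply: ym.
have b2a : b <= 2 * a by move: good bbr a320; clear; lra.
have KbK : Kb <= P2 * Ka.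
  rewrite /Kb /P2 /Ka -expRD ler_expR -mulrDr ler_pM2l // -lnM ?posrE //.
  by rewrite ler_ln ?posrE ?mulr_gt0.
have Kbe : Kb <= expR b.
  by rewrite ler_expR ln_le_linear //; exact: le_trans ab.
have eb : b + 1 <= expR b by have := expR_ge1Dx b; rewrite addrC.
have ebr : expR b <= expR br by rewrite ler_expR.
pose M := expR (expR br).
have MMrho : max_mod F rho = expR M by rewrite -yE.
have rw : rho / w = Kb + c by rewrite /rho /w; field; rewrite !gt_eqF.
have Mbig : expR br + expR br <= M.
  have h1 : expR (expR br - 1) >= expR br by have := expR_ge1Dx (expR br - 1); rewrite [1 + _]addrC subrK.
  have h2 : 2 <= expR 1 :> R by have := expR_ge1Dx (1 : R); clear; lra.
  have -> : M = expR 1 * expR (expR br - 1) by rewrite /M -expRD; congr expR; ring.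
  have h3 := ler_pM (ler0n _ 2) (expR_ge0 br) h2 h1.
  by move: h3; clear; lra.
have cb : c <= expR br by move: ac ab eb ebr; clear; lra.
have rwM : rho / w <= expR br + expR br.
  by rewrite rw; move: Kbe ebr cb; clear; lra.
have rw1 : 1 <= rho / w by rewrite rw; move: Kb1 c0; clear; lra.
have rw0 := lt_le_trans ltr01 rw1.
have lnrw : ln (rho / w) <= rho / w - 1.
  have := @le_ln1Dx R (rho / w - 1); rewrite [1 + _]addrC subrK; apply.
  by move: rw0; clear; lra.
have lnM' : ln M = expR br by rewrite expRK.
have fb i z : cabs z <= rho -> cabs (fam F i z) <= expR M.
  move=> zr; rewrite -MMrho /fam; case: insubP => [k _ _|_]; last first.
    by rewrite cabs0 MMrho expR_ge0.
  exact: max_mod_term.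
have c_n : c = n%:R + 7 by [].
(* the window of the local estimate is the tile from t to t + w *)
have [|||||Bad [mBad BadL HB]] := HD rho w M w0 _ _ _ _ _ fb.
- have -> : rho - (n%:R + 4) * w = t + 3 * w by rewrite /rho c_n; ring.
  by move: s0t s04 w0; clear; lra.
- have -> : (n%:R + 8) * w = c * w + w by rewrite c_n; ring.
  by rewrite /rho; move: wt; clear; lra.
- by move: Mbig eb ebr ab a320; clear; lra.
- rewrite lnM'; apply: le_trans (_ : w * Kb <= _); last first.
    by rewrite ler_pM2l //; move: Kbe ebr; clear; lra.
  rewrite /w mulfVK ?gt_eqF //; move: s0t s04; clear; lra.
- by move: lnrw rwM Mbig; clear; lra.
have dsum : (1 - (1 - d) / 4) + eta < 1 by move: eta0; rewrite /eta; clear; lra.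
have [r [/andP[tr rtw] nE' nBad]] := tile_avoid mE' mBad w0 massE BadL dsum.
have rp : 0 < r := lt_trans tp tr.
have sr : s < r := lt_trans st tr.
have cmp := max_mod_characteristic eF (ltW sp) sr (TE r (ltW rp)).
set Tr := T r in cmp *.
have l30 : 0 <= ln 3 :> R by rewrite ln_ge0 // ler1n.
have Tr0 : 0 <= Tr.
  rewrite /Tr TE ?(ltW rp) // circle_meanE; apply: rmean_ge0 => u.
  rewrite ln_ge0 // -[leLHS]sqrtr1 ler_wsqrtr // lerDl sumr_ge0 // => k _; exact: sqr_ge0.
have ratio : (r + s) / (r - s) <= 5 * Ka.
  rewrite ler_pdivrMr ?subr_gt0 //.
  have h1 : s / Ka <= r - s by move: tr; rewrite /t -/a -/Ka; clear; lra.
  apply: le_trans (_ : 5 * Ka * (s / Ka) <= _); last by rewrite ler_wpM2l // mulr_ge0 // ltW.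
  have -> : 5 * Ka * (s / Ka) = 5 * s by field; rewrite gt_eqF.
  by move: rtw wt t2s; clear; lra.
have ea : a + 1 <= expR a by have := expR_ge1Dx a; rewrite addrC.
have n1 : 1 <= n%:R :> R by rewrite ler1n.
have Tlow : expR (expR a / 2) <= Tr.
  apply: (@characteristic_lower R n%:R Ka (expR a) Tr) => //.
  - by move: ac ea; rewrite c_n; clear; lra.
  - by move: a320 ea; clear; lra.
  - exact: ltW.
  rewrite (yE s ss); apply: le_trans cmp _.
  rewrite ler_wpM2l // ler_wpM2l // ler_expR ler_wpM2r // addr_ge0 //.
have PhiL := Phi_lower (ltW m0) (_ : 4 <= a) Tlow.
have {PhiL} := PhiL (ltac:(by move: a320; clear; lra)).
rewrite -/Ka -/P2; set Phi := ln Tr * _ => PhiL.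
have e0 := expR_gt0 a.
have low0 : 0 < expR a / 2 * (Ka / P2) by rewrite mulr_gt0 // divr_gt0.
exists r; split => //.
- exact: lt_trans sr.
- by move=> /EE'.
have lnlnT : 0 < ln (ln Tr).
  have h1 : expR a / 2 <= ln Tr.
    by rewrite -[leLHS]expRK ler_ln ?posrE ?expR_gt0 // (lt_le_trans (expR_gt0 _) Tlow).
  by rewrite ln_gt0 //; move: h1 ea a320; clear; lra.
split => //; first exact: lt_le_trans PhiL.
move=> z zr; have nBz : ~ Bad (cabs z) by rewrite zr.
have zI : rho - (n%:R + 7) * w <= cabs z <= rho - (n%:R + 6) * w.
  have -> : rho - (n%:R + 7) * w = t by rewrite /rho c_n; ring.
  have -> : rho - (n%:R + 6) * w = t + w by rewrite /rho c_n; ring.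
  by rewrite zr (ltW tr).
have [fz Hz] := HB z nBz zI.
split => //; apply: le_trans Hz _.
have q1 : rho / w <= (P2 + c) * Ka.
  rewrite rw mulrDl; apply: lerD => //; by rewrite ler_peMr.
have ebra : expR br <= expR 1 * expR a.
  by rewrite -expRD ler_expR addrC.
have q2 : 1 + ln (rho / w) + ln M <= 4 * expR 1 * expR a.
  have h : expR 1 * expR a >= 1 by apply: le_trans ebra; rewrite -expR0 ler_expR; move: b0 bbr; clear; lra.
  by rewrite lnM'; move: h lnrw rwM ebra; clear; lra.
have D0 := le_trans ler01 D1.
apply: le_trans (_ : D * ((P2 + c) * Ka * (4 * expR 1 * expR a)) <= _).
  apply: ler_wpM2l => //; apply: ler_pM => //; first exact: ltW.
  by rewrite lnM' !addr_ge0 ?expR_ge0 // ln_ge0.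
have -> : D * ((P2 + c) * Ka * (4 * expR 1 * expR a)) =
  D2 * (2 * P2) * (expR a / 2 * (Ka / P2)) by rewrite /D2; field; rewrite gt_eqF.
by apply: (ler_wpM2l _ PhiL); exact: (mulr_ge0 (ltW D20) (mulr_ge0 (ler0n R 2) (ltW P20))).
Qed.

End ExceptionalRadii.

(** * Characteristic and deficiency of an entire function *)

Section EntireCharacteristic.
Variable R : realType.
Notation C := (R[i]^o).
Implicit Types (z w c : C) (r s x : R) (f g : C -> C).

(** The order zero already gives a finite limit, by continuity. *)
Lemma pole_order_entire f z : entire f -> pole_order f z = 0%N.
Proof.
move=> ef; rewrite /pole_order.
have P0 : cvg ((fun w : C => (w - z) ^+ 0 * f w : C) @ z^').
  have cf : {for z, continuous f}.
    by apply: differentiable_continuous; apply/derivable1_diffP; exact: ef.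
  apply/cvg_ex; exists (f z).
  under eq_fun do rewrite expr0 mul1r.
  exact: cvg_within_filter cf.
by case: xgetP => [k _ [_ /(_ 0%N P0)]|//]; rewrite leqn0 => /eqP.
Qed.

Lemma nevanlinna_T_entire f r : entire f ->
  nevanlinna_T f r = circle_mean (fun z => logp (cabs (f z))) r.
Proof.
move=> ef; have pc t : pole_count f t = 0.
  by rewrite /pole_count fsbig1 // => z _; rewrite pole_order_entire.
rewrite /nevanlinna_T /nevanlinna_N pc mul0r addr0.
under eq_Rintegral => t _ do rewrite !pc subrr mul0r.
by rewrite Rintegral_cst // mul0r addr0.
Qed.

Lemma nevanlinna_T_ge0 f r : entire f -> 0 <= nevanlinna_T f r.
Proof.
move=> ef; rewrite nevanlinna_T_entire // circle_meanE; apply: rmean_ge0 => t.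
by rewrite /logp le_max lexx orbT.
Qed.

Lemma prox_max_le r (a : C) f (B : R) : 0 <= B ->
  (forall z, cabs z = r -> f z != a /\ - ln (cabs (f z - a)) <= B) ->
  (prox_max r a f <= B%:E)%E.
Proof.
move=> B0 H; apply: ge_ereal_sup => _ [z /= zr <-]; have [fz Hz] := H z zr.
have g0 : 0 < cabs (f z - a) by rewrite cabs_gt0 subr_eq0.
by rewrite inver gt_eqF // lneV // lne_EFin // -EFinN ge_max !lee_fin Hz B0.
Qed.

Lemma prox_max_ge0 r (a : C) f : 0 <= r -> (0 <= prox_max r a f)%E.
Proof.
move=> r0; apply: (@le_trans _ _ (maxe (lne ((cabs (f (r%:C%C) - a))%:E^-1)) 0)%E).
  by rewrite le_max lexx orbT.
by apply: ereal_sup_ubound; exists (r%:C%C) => //=; rewrite cabs_real ger0_norm.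
Qed.

Lemma deltaP_eq0 (a : C) f : entire f ->
  (forall e X : R, 0 < e -> exists2 r, X < r &
     (prox_max r a f / (nevanlinna_T f r)%:E <= e%:E)%E) -> deltaP a f = 0%E.
Proof.
move=> ef H; rewrite /deltaP limf_einfE; apply/eqP; rewrite eq_le; apply/andP; split.
  apply: ge_ereal_sup => _ [V [X [_ HV]] <-]; set S := (X in ereal_inf X).
  have small (e : R) : 0 < e -> (ereal_inf S <= e%:E)%E.
    move=> e0; have [r Xr Hr] := H e X e0; apply: ge_ereal_inf.
    by exists (prox_max r a f / (nevanlinna_T f r)%:E)%E => //; exists r => //; exact: HV.
  rewrite leNgt; apply/negP; case: (ereal_inf S) small => [v| |] small.
  - rewrite lte_fin => v0; have v20 : 0 < v / 2 by rewrite divr_gt0.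
    by have := small _ v20; rewrite lee_fin; move: v0; clear; lra.
  - by move=> _; have := small 1 ltr01; rewrite leye_eq.
  - by [].
have I0 : (0 <= ereal_inf [set (prox_max r a f / (nevanlinna_T f r)%:E)%E
    | r in [set r : R | (0 < r)%R]])%E.
  apply: le_ereal_inf_tmp => _ [r /= r0 <-]; apply: mule_ge0.
    exact: prox_max_ge0 (ltW r0).
  by rewrite inve_ge0 lee_fin nevanlinna_T_ge0.
apply: (le_trans I0); apply: ereal_sup_ubound.
by exists [set r : R | 0 < r] => //; exists 0; split => // r /=.
Qed.

End EntireCharacteristic.

(* That A_0 is not identically zero is needed: for f'' - f' = 0 with the
   solution f = 1 + e^z and E empty, both T(r) and T(r,f) are asymptotic to
   r / pi, whereas max_{|z|=r} log^+ (1 / |f(z) - 1|) = r. *)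
Theorem theorem2p2 (R : realType) (n : nat) (n_gt0 : (0 < n)%N)
    (A : 'I_n -> R[i]^o -> R[i]^o) (A_entire : forall k, entire (A k))
    (A0_neq0 : exists z, A (Ordinal n_gt0) z != 0)
    (T : R -> R) (T_char : is_characteristic A T)
    (f : R[i]^o -> R[i]^o) (f_sol : is_solution A f)
    (E : set R) (E_meas : lebesgue_measurable E) (E_ge0 : E `<=` `[0, +oo[)
    (E_dens : (upper_density E < 1)%E)
    (m : R) (m_gt1 : 1 < m)
    (T_small : ((fun r => ln (T r) * (ln (ln (T r)) `^ m)) : R -> R^o)
        =o_ (pinfty_off E)
      (nevanlinna_T f : R -> R^o)) :
  P_standard A f.
Proof.
split=> // a a0; have [F bF TE] := T_char.
have [D D0 good] := exceptional_radii A_entire A0_neq0 bF TE f_sol a0 E_meas E_dens m_gt1.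
have ef := proj1 f_sol; apply: (deltaP_eq0 ef) => e X e0.
have eD : 0 < e / D by rewrite divr_gt0.
have /eqoP/(_ _ eD) := T_small; rewrite /within /= => -[X' [_ HX']].
have [r [Xr r0 nEr [Phi0 llT0 Hz]]] := good (Num.max X X').
move: Xr; rewrite gt_max => /andP[Xr X'r]; exists r => //.
have := HX' r X'r nEr; rewrite /powR gt_eqF //=.
rewrite (ger0_norm (ltW Phi0)) (ger0_norm (nevanlinna_T_ge0 r ef)) => small.
have NT0 : 0 < nevanlinna_T f r.
  by rewrite -(pmulr_rgt0 _ eD); exact: lt_le_trans small.
have DPhi := ltW (mulr_gt0 D0 Phi0).
rewrite inver gt_eqF // lee_pdivrMr //; apply: le_trans (prox_max_le DPhi Hz) _.
by rewrite -EFinM lee_fin -ler_pdivlMl // mulrA [D^-1 * e]mulrC.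
Qed.
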